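(* Let $G$ be a (countable) discrete group, $M\subseteq\mathcal B(\mathcal H_M)$ a von Neumann algebra acting on a separable Hilbert space $\mathcal H_M$, and $(M,G,\beta)$ a $W^*$-dynamical system. Consider the conditions: (i) $(M,G,\beta)$ is weakly amenable; (ii) the von Neumann crossed product $M\rtimes_\beta^{\mathrm{vN}}G$ has the weak* completely bounded approximation property. Then (i) implies (ii). If $G$ is weakly amenable then (i) and (ii) are equivalent.
   Context: A $W^*$-dynamical system $(M,G,\beta)$ with $G$ discrete consists of a von Neumann algebra $M\subseteq\mathcal B(\mathcal H_M)$, the group $G$, and a group homomorphism $\beta:G\to\mathrm{Aut}(M)$. On $\ell^2(G,\mathcal H_M)$ define $(\pi(a)\xi)(s)=\beta_{s^{-1}}(a)(\xi(s))$ and $(\lambda_t\xi)(s)=\xi(t^{-1}s)$ for $a\in M$, $s,t\in G$. The crossed product $M\rtimes_\beta^{\mathrm{vN}}G$ is the von Neumann algebra on $\ell^2(G,\mathcal H_M)$ generated by $\pi(M)$ and $\lambda(G)$. Let $M_\beta:=\{x\in M: t\mapsto\beta_t(x)\text{ is norm-continuous}\}$, a $G$-invariant weak*-dense unital $C^*$-subalgebra of $M$ (since $G$ is discrete, $M_\beta=M$); $(M_\beta,G,\beta)$ is a $C^*$-dynamical system with $M_\beta$ faithfully represented on $\mathcal H_M$ by the identity representation $\mathrm{id}$, and its reduced crossed product (the norm closure of the span of $\{\pi(a)\lambda_t:a\in M_\beta,t\in G\}$) is weak*-dense in $M\rtimes^{\mathrm{vN}}_\beta G$. For a $C^*$-algebra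 $B$ acting on a Hilbert space, $\mathcal{CB}(B)$ is the space of completely bounded maps on $B$, and $\mathcal{CB}_\sigma(B)$ is the space of completely bounded maps on $B$ that extend to completely bounded weak*-continuous maps on $B''$. A bounded function $F:G\to\mathcal{CB}(M_\beta)$ is a Herz--Schur $\mathrm{id}$-multiplier of $(M_\beta,G,\beta)$ if the map $\pi(a)\lambda_t\mapsto\pi(F(t)(a))\lambda_t$ ($a\in M_\beta$, $t\in G$) extends to a completely bounded weak*-continuous map $S_F$ on the weak* closure of the reduced crossed product of $(M_\beta,G,\beta)$ in $\mathcal B(\ell^2(G,\mathcal H_M))$, i.e. on $M\rtimes^{\mathrm{vN}}_\beta G$; put $\|F\|_{\mathrm{HS}}:=\|S_F\|_{\mathrm{cb}}$. $(M,G,\beta)$ is weakly amenable if there is a net of finitely supported Herz--Schur $\mathrm{id}$-multipliers $F_i:G\to\mathcal{CB}_\sigma(M_\beta)$ of $(M_\beta,G,\beta)$ such that $F_i(t)$ extends to a finite rank completely bounded map on $M$ for every $t\in G$, $F_i(t)(a)\to a$ in the weak* topology for all $t\in G$, $a\in M$, and $\sup_i\|F_i\|_{\mathrm{HS}}<\infty$. A discrete group $G$ is weakly amenable if there is a net $(\varphi_j)$ of finitely supported Herz--Schur multipliers $\varphi_j:G\to\mathbb C$ (completely bounded multipliers of the Fourier algebra of $G$), uniformly bounded in the Herz--Schur (completely bounded multiplier) norm, converging pointwise to $1$. A von Neumann algebra $N$ has the weak* completely bounded approximation property if there is a net $(R_\gamma)$ of ultraweakly continuous, finite rank, completely bounded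 maps on $N$ with $R_\gamma\to\mathrm{id}_N$ in the point-weak* topology and $\sup_\gamma\|R_\gamma\|_{\mathrm{cb}}<\infty$. *)

(* Defs.v *)
From HB Require Import structures.
From mathcomp Require Import all_boot all_order all_algebra finmap.
From mathcomp Require Import complex.
From mathcomp Require Import all_classical all_reals all_analysis.
From mathcomp Require Import summability ring.

Set Implicit Arguments.
Unset Strict Implicit.
Unset Printing Implicit Defensive.

Import Order.TTheory GRing.Theory Num.Theory.
Import numFieldNormedType.Exports.

Local Open Scope classical_set_scope.
Local Open Scope ring_scope.

(* Packed so that the topology and norm of a numFieldType apply to R[i]. *)
Definition Cx (R : realType) : numClosedFieldType := R[i]%C.

Section Complex.
Variable R : realType.
Implicit Types z w : Cx R.

Lemma Cx_realE z : 0 <= z -> z = (complex.Re z)%:C%C.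
Proof. by case: z => a b; rewrite lecE /= => /andP[/eqP-> _]. Qed.

Lemma Cx_normE z : `|z| = (complex.Re `|z|)%:C%C.
Proof. exact/Cx_realE/normr_ge0. Qed.

Lemma ler_RC (a b : R) : ((a%:C%C : Cx R) <= b%:C%C) = (a <= b).
Proof. by rewrite lecE /= eqxx. Qed.

Lemma ltr_RC (a b : R) : ((a%:C%C : Cx R) < b%:C%C) = (a < b).
Proof. by rewrite ltcE /= eqxx. Qed.

Lemma norm_RC (a : R) : `|a%:C%C : Cx R| = (`|a|)%:C%C.
Proof. by rewrite normc_def /= expr0n /= addr0 sqrtr_sqr. Qed.

Lemma Re_ge0 z : 0 <= z -> 0 <= complex.Re z.
Proof. by case: z => a b; rewrite lecE /= => /andP[]. Qed.

Lemma le_Re z w : z <= w -> complex.Re z <= complex.Re w.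
Proof. by rewrite lecE => /andP[]. Qed.

Lemma Re_gt0 z : 0 < z -> 0 < complex.Re z.
Proof. by case: z => a b; rewrite ltcE /= => /andP[]. Qed.

Lemma Re_norm_le z : `|complex.Re z|%:C%C <= `|z|.
Proof.
case: z => a b; rewrite normc_def /= ler_RC -sqrtr_sqr ler_wsqrtr//.
by rewrite lerDl sqr_ge0.
Qed.

Lemma Im_norm_le z : `|complex.Im z|%:C%C <= `|z|.
Proof.
case: z => a b; rewrite normc_def /= ler_RC -sqrtr_sqr ler_wsqrtr//.
by rewrite lerDr sqr_ge0.
Qed.

Lemma norm_le_ReIm z :
  `|z| <= (`|complex.Re z| + `|complex.Im z|)%:C%C.
Proof.
case: z => a b; rewrite normc_def /= ler_RC.
rewrite -[leRHS]ger0_norm ?addr_ge0// -sqrtr_sqr ler_wsqrtr//.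
rewrite sqrrD !real_normK ?num_real// lerD2r lerDl.
by rewrite mulrn_wge0// mulr_ge0.
Qed.

Lemma Cx_complete (F : set_system (Cx R)) : ProperFilter F -> cauchy F -> cvg F.
Proof.
move=> FF /cauchy_ballP Fc.
have sub (f : Cx R -> R) : (forall z w, `|f z - f w|%:C%C <= `|z - w|) ->
    cvg (f @ F).
  move=> fl; apply: R_complete; apply/cauchy_ballP => e e0.
  have e0' : 0 < (e%:C%C : Cx R) by rewrite ltr_RC.
  have := Fc _ e0'.
  case=> -[A B] /= [FA FB] AB; exists (f @` A, f @` B) => /=.
    by split; [apply: filterS FA|apply: filterS FB] => x ?; exists x.
  move=> [_ _] /= [[x Ax <-] [y By <-]].
  have := AB (x, y) (conj Ax By); rewrite -!ball_normE/=.
  by rewrite -ltr_RC; exact: le_lt_trans (fl _ _).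
have /sub/cvg_ex[a Ha] : forall z w, `|complex.Re z - complex.Re w|%:C%C <= `|z - w|.
  by move=> z w; have := Re_norm_le (z - w); case: z; case: w.
have /sub/cvg_ex[b Hb] : forall z w, `|complex.Im z - complex.Im w|%:C%C <= `|z - w|.
  by move=> z w; have := Im_norm_le (z - w); case: z; case: w.
apply/cvg_ex; exists (a +i* b)%C; apply/cvgrPdist_le => e e0.
have e2 : 0 < complex.Re e / 2 by rewrite divr_gt0 ?Re_gt0.
move/cvgrPdist_le : Ha => /(_ _ e2) Ha; move/cvgrPdist_le : Hb => /(_ _ e2) Hb.
near=> z; rewrite (le_trans (norm_le_ReIm _))// (Cx_realE (ltW e0)) ler_RC.
rewrite [leRHS]splitr; apply: lerD.
  have : `|a - complex.Re z| <= complex.Re e / 2 by near: z; exact: Ha.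
  by case: (z).
have : `|b - complex.Im z| <= complex.Re e / 2 by near: z; exact: Hb.
by case: (z).
Unshelve. all: by end_near. Qed.

End Complex.

#[global] Existing Instance totally_filter.

Section UnorderedSums.
Variables (R : realType) (I : choiceType).
Implicit Types (a b : I -> Cx R) (A : {fset I}).

Definition bounded_sums a := exists c : Cx R, forall A, \sum_(i <- A) a i <= c.

Lemma partial_sumE a A : partial_sum a A = \sum_(i <- A) a i.
Proof. by rewrite /partial_sum (big_seq_fsetE _ _ xpredT). Qed.

Lemma bounded_sumsD a b : bounded_sums a -> bounded_sums b ->
  bounded_sums (fun i => a i + b i).
Proof.
move=> [c ac] [d bd]; exists (c + d) => A.
by rewrite big_split/= lerD.
Qed.

Lemma bounded_sumsZ (r : Cx R) a : 0 <= r -> bounded_sums a ->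
  bounded_sums (fun i => r * a i).
Proof.
by move=> r0 [c ac]; exists (r * c) => A; rewrite -mulr_sumr ler_wpM2l.
Qed.

Lemma le_bounded_sums a b : (forall i, a i <= b i) ->
  bounded_sums b -> bounded_sums a.
Proof.
by move=> ab [c bc]; exists c => A; apply: le_trans (bc A); exact: ler_sum.
Qed.

Lemma sum_fset_le a A B : (forall i, 0 <= a i) -> (A `<=` B)%fset ->
  \sum_(i <- A) a i <= \sum_(i <- B) a i.
Proof.
move=> a0 AB; rewrite -subr_ge0 (big_fsetID _ (mem A) B)/=.
have -> : [fset x | x in B & x \in A]%fset = A.
  apply/fsetP => x; rewrite !inE/=.
  by apply/andP/idP => [[]//|xA]; split=> //; exact: (fsubsetP AB).
by rewrite addrAC subrr add0r sumr_ge0.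
Qed.

Lemma nneg_sum_cvg a : (forall i, 0 <= a i) -> bounded_sums a ->
  exists2 l, partial_sum a @ totally --> (l : Cx R) &
    (forall A, \sum_(i <- A) a i <= l) /\
    (forall c, (forall A, \sum_(i <- A) a i <= c) -> l <= c).
Proof.
move=> a0 [c ac].
have sE A : \sum_(i <- A) a i = (complex.Re (\sum_(i <- A) a i))%:C%C.
  by apply/Cx_realE/sumr_ge0.
pose E := [set complex.Re (\sum_(i <- A) a i) | A in [set: {fset I}]].
have E0 : E !=set0 by exists (complex.Re (\sum_(i <- fset0) a i)), fset0.
have Ec : ubound E (complex.Re c) by move=> _ [A _ <-]; exact/le_Re.
have hE : has_sup E by split=> //; exists (complex.Re c).
have Al A : \sum_(i <- A) a i <= (sup E)%:C%C.
  by rewrite sE ler_RC; apply: ub_le_sup => //; [case: hE|exists A].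
exists (sup E)%:C%C; last first.
  split=> // d ad.
  have dE : d = (complex.Re d)%:C%C.
    by apply: Cx_realE; have := ad fset0; rewrite big_nil.
  rewrite dE ler_RC; apply: ge_sup => // _ [A _ <-].
  exact: le_Re.
apply/cvgrPdist_le => e e0.
have [_ [A _ <-] AE] := sup_adherent (Re_gt0 e0) hE.
exists A => // B /= AB.
rewrite partial_sumE ger0_norm ?subr_ge0//.
rewrite lerBlDl -lerBlDr (le_trans _ (sum_fset_le a0 AB))//.
by rewrite (Cx_realE (ltW e0)) [leRHS]sE -rmorphB ler_RC ltW.
Qed.

Lemma partial_sumD a b A : partial_sum (fun i => a i + b i) A =
  partial_sum a A + partial_sum b A.
Proof. by rewrite !partial_sumE big_split. Qed.

Lemma partial_sumZ r a A : partial_sum (fun i => r * a i) A =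
  r * partial_sum a A.
Proof. by rewrite !partial_sumE mulr_sumr. Qed.

Lemma sum_cvg a : bounded_sums (fun i => `|a i|) ->
  cvg (partial_sum a @ totally).
Proof.
move=> ba; pose n i := `|a i|.
pose p i := `|a i| + 'Re (a i); pose q i := `|a i| + 'Im (a i).
have nc : cvg (partial_sum n @ totally).
  by have [|l ? _] := @nneg_sum_cvg n _ ba; [move=> i; exact: normr_ge0|apply/cvg_ex; exists l].
have b2 : bounded_sums (fun i => `|a i| + `|a i|) by exact: bounded_sumsD.
have real_le (x : Cx R) : x \is Num.real -> forall y, `|x| <= y -> 0 <= y + x /\ y + x <= y + y.
  move=> xr y; rewrite real_ler_norml// => /andP[yx xy].
  by rewrite lerD2l -lerBlDl sub0r.
have pP i : 0 <= p i /\ p i <= `|a i| + `|a i|.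
  apply: real_le; first exact: Creal_Re.
  exact: (leif_normC_Re_Creal _).1.
have qP i : 0 <= q i /\ q i <= `|a i| + `|a i|.
  apply: real_le; first exact: Creal_Im.
  by rewrite -normrN -ReMil (le_trans (leif_normC_Re_Creal _).1)// normrM normCi mul1r.
have pc : cvg (partial_sum p @ totally).
  have [||l ? _] := @nneg_sum_cvg p; first by move=> i; case: (pP i).
    by apply: le_bounded_sums b2 => i; case: (pP i).
  by apply/cvg_ex; exists l.
have qc : cvg (partial_sum q @ totally).
  have [||l ? _] := @nneg_sum_cvg q; first by move=> i; case: (qP i).
    by apply: le_bounded_sums b2 => i; case: (qP i).
  by apply/cvg_ex; exists l.
have -> : partial_sum a = fun A => (partial_sum p A - partial_sum n A) +
    'i * (partial_sum q A - partial_sum n A).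
  apply/funext => A; rewrite !partial_sumE -!sumrB mulr_sumr -big_split/=.
  apply: eq_bigr => i _; rewrite [in LHS](Crect (a i)) /p /q /n.
  by congr (_ + 'i * _); rewrite addrC addKr.
case/cvg_ex: nc => ln nl; case/cvg_ex: pc => lp pl; case/cvg_ex: qc => lq ql.
have lin := cvgD (cvgB pl nl) (cvgM (cvg_cst ('i : Cx R)) (cvgB ql nl)).
by apply/cvg_ex; eexists; exact: lin.
Qed.

Lemma cvg_sum a (l : Cx R) : partial_sum a @ totally --> l -> sum a = l.
Proof. exact: (@cvg_lim (Cx R) (@norm_hausdorff (Cx R) (Cx R))). Qed.

Lemma sumD a b : bounded_sums (fun i => `|a i|) ->
  bounded_sums (fun i => `|b i|) ->
  sum (fun i => a i + b i) = sum a + sum b :> Cx R.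
Proof.
move=> /sum_cvg ac /sum_cvg bc; have ab := cvgD ac bc.
have E : partial_sum (fun i => a i + b i) = partial_sum a \+ partial_sum b.
  by apply/funext => A; rewrite partial_sumD.
by apply: cvg_sum; rewrite E; exact: ab.
Qed.

Lemma sumZ r a : bounded_sums (fun i => `|a i|) ->
  sum (fun i => r * a i) = r * sum a :> Cx R.
Proof.
move=> /sum_cvg ac; have ra := cvgM (cvg_cst r) ac.
have E : partial_sum (fun i => r * a i) = fun A => r * partial_sum a A.
  by apply/funext => A; rewrite partial_sumZ.
by apply: cvg_sum; rewrite E; exact: ra.
Qed.

Lemma nneg_sumP a : (forall i, 0 <= a i) -> bounded_sums a ->
  (forall A, \sum_(i <- A) a i <= sum a) /\
  (forall c, (forall A, \sum_(i <- A) a i <= c) -> sum a <= c).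
Proof.
move=> a0 ba; have [l al lP] := nneg_sum_cvg a0 ba.
by rewrite (cvg_sum al).
Qed.

Lemma sumJ a : bounded_sums (fun i => `|a i|) ->
  sum (fun i => (a i)^*) = (sum a)^* :> Cx R.
Proof.
move=> /sum_cvg ac; apply: cvg_sum.
have -> : partial_sum (fun i => (a i)^*) = fun A => (partial_sum a A)^*.
  by apply/funext => A; rewrite !partial_sumE rmorph_sum.
apply/cvgrPdist_le => e e0.
move/cvgrPdist_le : ac => /(_ _ e0) ac; near=> A.
rewrite -rmorphB norm_conjC; near: A; exact: ac.
Unshelve. all: by end_near. Qed.

End UnorderedSums.

HB.mixin Record CompleteNormedModule_isHilbert (R : realType) H
    & CompleteNormedModule (Cx R) H := {
  ip : H -> H -> Cx R ;
  ip_linearl : forall y a x1 x2, ip (a *: x1 + x2) y = a * ip x1 y + ip x2 y ;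
  ipC : forall x y, ip x y = (ip y x)^* ;
  ip_norm : forall x, ip x x = `|x| ^+ 2
}.

#[short(type="hilbertType")]
HB.structure Definition Hilbert (R : realType) :=
  {H of CompleteNormedModule_isHilbert R H & CompleteNormedModule (Cx R) H}.

(* norms are valued in Cx R; this is the same norm as a real number *)
Definition hnorm (R : realType) (E : hilbertType R) (x : E) : R :=
  complex.Re `|x|.

(* the one-dimensional Hilbert space *)
Definition scal (R : realType) : Type := Cx R.

Section ScalarHilbert.
Variable R : realType.

HB.instance Definition _ := NormedModule.copy (scal R) (Cx R)^o.
HB.instance Definition _ := Uniform_isComplete.Build (scal R) (@Cx_complete R).

Definition scal_ip (x y : scal R) : Cx R := (x : Cx R) * (y : Cx R)^*.

Lemma scal_ip_linearl (y : scal R) (a : Cx R) (x1 x2 : scal R) :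
  scal_ip (a *: x1 + x2) y = a * scal_ip x1 y + scal_ip x2 y.
Proof. by rewrite /scal_ip mulrDl -mulrA. Qed.

Lemma scal_ipC (x y : scal R) : scal_ip x y = (scal_ip y x)^*.
Proof. by rewrite /scal_ip rmorphM /= conjCK mulrC. Qed.

Lemma scal_ip_norm (x : scal R) : scal_ip x x = `|x| ^+ 2.
Proof. by rewrite [RHS]normCK. Qed.

HB.instance Definition _ := CompleteNormedModule_isHilbert.Build R (scal R)
  scal_ip_linearl scal_ipC scal_ip_norm.

End ScalarHilbert.

Section CauchySchwarz.
Variables (R : realType) (V : lmodType (Cx R)) (f : V -> V -> Cx R).
Hypothesis f_linearl :
  forall y a x1 x2, f (a *: x1 + x2) y = a * f x1 y + f x2 y.
Hypothesis fC : forall x y, f x y = (f y x)^*.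
Hypothesis f_ge0 : forall x, 0 <= f x x.

Let fDl y x1 x2 : f (x1 + x2) y = f x1 y + f x2 y.
Proof. by have := f_linearl y 1 x1 x2; rewrite scale1r mul1r. Qed.
Let f0l y : f 0 y = 0.
Proof. by apply: (addrI (f 0 y)); rewrite -fDl !addr0. Qed.
Let fZl y a x : f (a *: x) y = a * f x y.
Proof. by have := f_linearl y a x 0; rewrite !addr0 f0l addr0. Qed.
Let fDr y x1 x2 : f y (x1 + x2) = f y x1 + f y x2.
Proof. by rewrite fC fDl rmorphD /= -!fC. Qed.
Let fZr y a x : f y (a *: x) = a^* * f y x.
Proof. by rewrite fC fZl rmorphM /= -fC. Qed.

Lemma form_CauchySchwarz x y : `|f x y| ^+ 2 <= f x x * f y y.
Proof.
have key (c : Cx R) : 0 <= f x x + c^* * f x y + (c * (f x y)^* + c * c^* * f y y).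
  have := f_ge0 (x + c *: y).
  by rewrite !(fDl, fDr, fZl, fZr) -fC !mulrA addrA.
have [yy0|yy0] := eqVneq (f y y) 0; last first.
  have yyp : 0 < f y y by rewrite lt_def yy0 f_ge0.
  have := key (- f x y / f y y).
  have yyr : (f y y)^* = f y y by rewrite -fC.
  rewrite rmorphM /= rmorphN /= fmorphV /= yyr.
  rewrite -(pmulr_rge0 _ yyp) [X in 0 <= X -> _](_ : _ =
    f x x * f y y - `|f x y| ^+ 2); last by rewrite normCK; field.
  by rewrite subr_ge0.
have [->|xy0] := eqVneq (f x y) 0; first by rewrite normr0 expr0n yy0 mulr0.
have cxy0 : (f x y)^* != 0 by rewrite conjC_eq0.
have := key (- (f x x + 1) / (f x y)^*).
rewrite yy0 mulr0 addr0 rmorphM /= rmorphN /= rmorphD /= rmorph1 fmorphV /= conjCK -fC.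
rewrite !divfK// .
have -> : f x x + - (f x x + 1) + - (f x x + 1) = - (f x x + 2) by ring.
move=> h; suff : - (f x x + 2) < 0 by move=> /(le_lt_trans h); rewrite ltxx.
by rewrite oppr_lt0 ltr_wpDl.
Qed.

Lemma form_triangle x y :
  sqrtC (f (x + y) (x + y)) <= sqrtC (f x x) + sqrtC (f y y).
Proof.
rewrite -[leRHS]sqrCK ?addr_ge0 ?sqrtC_ge0// ler_sqrtC ?qualifE/= ?exprn_ge0
  ?addr_ge0 ?sqrtC_ge0//.
rewrite sqrrD !sqrtCK fDl !fDr (fC y x).
have -> : f x x + f x y + ((f x y)^* + f y y) =
    f x x + f y y + (f x y + (f x y)^*) by ring.
rewrite [leRHS]addrAC lerD2l.
have -> : f x y + (f x y)^* = 'Re (f x y) *+ 2.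
  by rewrite ReE -mulr_natr divfK// pnatr_eq0.
rewrite lerMn2r (le_trans (leif_Re_Creal _).1)//.
rewrite -[leLHS]sqrCK// -sqrtCM ?qualifE//= ler_sqrtC ?qualifE/= ?exprn_ge0 ?mulr_ge0//.
exact: form_CauchySchwarz.
Qed.

Lemma form_normZ (a : Cx R) x : sqrtC (f (a *: x) (a *: x)) = `|a| * sqrtC (f x x).
Proof.
rewrite fZl fZr mulrA -normCK sqrtCM ?qualifE/= ?exprn_ge0//.
by rewrite sqrCK.
Qed.

End CauchySchwarz.

Section InnerProduct.
Variables (R : realType) (E : hilbertType R).
Implicit Types x y : E.

Lemma ip_norm_le x y : `|ip x y| <= `|x| * `|y|.
Proof.
have h := form_CauchySchwarz (@ip_linearl R E) (@ipC R E).
have {h} := h _ x y; rewrite !ip_norm -exprMn ler_pXn2r ?nnegrE ?mulr_ge0//.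
by apply=> z; rewrite ip_norm exprn_ge0.
Qed.

Lemma norm_sqrt x : `|x| = sqrtC (ip x x).
Proof. by rewrite ip_norm sqrCK. Qed.

Lemma sqr_normD_le x y : `|x + y| ^+ 2 <= 2 * `|x| ^+ 2 + 2 * `|y| ^+ 2.
Proof.
have sqr_ge0' (a b : Cx R) : 0 <= a -> 0 <= b ->
    (a + b) ^+ 2 <= 2 * a ^+ 2 + 2 * b ^+ 2.
  move=> a0 b0; rewrite -subr_ge0.
  have -> : 2 * a ^+ 2 + 2 * b ^+ 2 - (a + b) ^+ 2 = (a - b) ^+ 2 by ring.
  by rewrite real_exprn_even_ge0// rpredB// ger0_real.
apply: le_trans (sqr_ge0' _ _ (normr_ge0 x) (normr_ge0 y)).
by rewrite ler_pXn2r ?nnegrE ?addr_ge0// ler_normD.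
Qed.

Lemma ip_norm_le_sqr x y : `|ip x y| <= `|x| ^+ 2 + `|y| ^+ 2.
Proof.
apply: le_trans (ip_norm_le x y) _; rewrite -subr_ge0.
have xr : `|x| - `|y| \is Num.real by rewrite rpredB// ger0_real.
have -> : `|x| ^+ 2 + `|y| ^+ 2 - `|x| * `|y| =
   (`|x| - `|y|) ^+ 2 + `|x| * `|y| by ring.
by apply: addr_ge0; [rewrite real_exprn_even_ge0|rewrite mulr_ge0].
Qed.

End InnerProduct.

Section L2.
Variables (R : realType) (I : choiceType) (E : hilbertType R).

Definition sqsummable (f : I -> E) : Prop :=
  bounded_sums (fun i => `|f i| ^+ 2).

Definition l2_pred : {pred I -> E} := fun f => `[< sqsummable f >].

Record l2 := L2 { l2val :> I -> E ; _ : l2val \in l2_pred }.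

Lemma l2_submod : submod_closed l2_pred.
Proof.
split; first by apply/asboolP; exists 0 => A; rewrite big1// => i _; rewrite normr0 expr0n.
move=> a f g /asboolP sf /asboolP sg; apply/asboolP.
have a0 : 0 <= 2 * `|a| ^+ 2 by rewrite mulr_ge0// exprn_ge0.
have b := bounded_sumsD (bounded_sumsZ a0 sf) (bounded_sumsZ (ler0n _ 2) sg).
apply: le_bounded_sums b => i.
apply: le_trans (sqr_normD_le _ _) _.
by rewrite normrZ exprMn mulrA.
Qed.

HB.instance Definition _ := [isSub for l2val].
HB.instance Definition _ := [Choice of l2 by <:].
HB.instance Definition _ := GRing.isSubmodClosed.Build (Cx R) (I -> E) l2_pred l2_submod.
HB.instance Definition _ := [SubChoice_isSubLmodule of l2 by <:].

Implicit Types f g h : l2.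

Lemma l2P f : sqsummable f.
Proof. by case: f => f /= /asboolP. Qed.

Lemma l2_ext f g : f =1 g -> f = g.
Proof. by move=> fg; apply/val_inj/funext. Qed.

Definition l2_ip f g : Cx R := sum (fun i => ip (f i) (g i)).

Lemma l2_ip_bounded f g : bounded_sums (fun i => `|ip (f i) (g i)|).
Proof.
by apply: le_bounded_sums (bounded_sumsD (l2P f) (l2P g)) => i; exact: ip_norm_le_sqr.
Qed.

Lemma l2_ip_linearl g (a : Cx R) f1 f2 :
  l2_ip (a *: f1 + f2) g = a * l2_ip f1 g + l2_ip f2 g.
Proof.
have b1 := l2_ip_bounded f1 g; have b2 := l2_ip_bounded f2 g.
rewrite /l2_ip -(sumZ a b1) -sumD//; last first.
  apply: le_bounded_sums (bounded_sumsZ (normr_ge0 a) b1) => i.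
  by rewrite normrM.
by congr sum; apply/funext => i; rewrite ip_linearl.
Qed.

Lemma l2_ipC f g : l2_ip f g = (l2_ip g f)^*.
Proof.
rewrite /l2_ip -(sumJ (l2_ip_bounded g f)).
by congr sum; apply/funext => i; rewrite ipC.
Qed.

Lemma l2_ipE f : l2_ip f f = sum (fun i => `|f i| ^+ 2).
Proof. by congr sum; apply/funext => i; rewrite ip_norm. Qed.

Lemma l2_sqP f : (forall A : {fset I}, \sum_(i <- A) `|f i| ^+ 2 <= l2_ip f f) /\
  (forall c, (forall A : {fset I}, \sum_(i <- A) `|f i| ^+ 2 <= c) -> l2_ip f f <= c).
Proof.
rewrite l2_ipE; apply: nneg_sumP; last exact: l2P.
by move=> i; rewrite exprn_ge0.
Qed.

Lemma l2_ip_ge0 f : 0 <= l2_ip f f.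
Proof. by have := (l2_sqP f).1 fset0; rewrite big_nil. Qed.

Definition l2_norm f : Cx R := sqrtC (l2_ip f f).

Lemma l2_coord_le f i : `|f i| <= l2_norm f.
Proof.
rewrite norm_sqrt ler_sqrtC ?qualifE/= ?ip_norm ?exprn_ge0 ?l2_ip_ge0//.
by have := (l2_sqP f).1 [fset i]%fset; rewrite big_seq_fset1.
Qed.

Lemma l2_normD f g : l2_norm (f + g) <= l2_norm f + l2_norm g.
Proof. exact: form_triangle l2_ip_linearl l2_ipC l2_ip_ge0 f g. Qed.

Lemma l2_normZ a f : l2_norm (a *: f) = `|a| * l2_norm f.
Proof. exact: form_normZ l2_ip_linearl l2_ipC l2_ip_ge0 a f. Qed.

Lemma l2_norm0_eq0 f : l2_norm f = 0 -> f = 0.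
Proof.
move=> f0; apply: l2_ext => i; apply/eqP; rewrite -normr_le0 -f0.
exact: l2_coord_le.
Qed.

HB.instance Definition _ := Lmodule_isNormed.Build (Cx R) l2
  l2_normD l2_normZ l2_norm0_eq0.

Lemma l2_ip_norm f : l2_ip f f = `|f| ^+ 2.
Proof. by rewrite sqrtCK. Qed.

Lemma l2_norm_le f (c : Cx R) : 0 <= c ->
  (forall A : {fset I}, \sum_(i <- A) `|f i| ^+ 2 <= c ^+ 2) -> `|f| <= c.
Proof.
move=> c0 fc; rewrite -(sqrCK c0) ler_sqrtC ?qualifE/= ?l2_ip_ge0 ?exprn_ge0//.
exact: (l2_sqP f).2.
Qed.

Lemma l2_complete (F : set_system l2) : ProperFilter F -> cauchy F -> cvg F.
Proof.
move=> FF /cauchy_ballP Fc.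
have Fn (e : Cx R) : 0 < e ->
    \forall f & g \near F, `|f - g : l2| < e.
  by move=> e0; have := Fc _ e0; rewrite -ball_normE.
have /choice[g gF] i : exists x : E, (fun f : l2 => f i) @ F --> x.
  apply/cvg_ex; apply: cauchy_cvg; apply/cauchy_ballP => e e0.
  have [[A B] /= [FA FB] AB] := Fn _ e0.
  exists ((fun f : l2 => f i) @` A, (fun f : l2 => f i) @` B) => /=.
    by split; [apply: filterS FA|apply: filterS FB] => x ?; exists x.
  move=> [_ _] /= [[x Ax <-] [y By <-]]; rewrite -ball_normE /=.
  exact: le_lt_trans (l2_coord_le (x - y) i) (AB (x, y) (conj Ax By)).
have near_g (e : Cx R) : 0 < e -> \forall f \near F,
    forall A : {fset I}, \sum_(i <- A) `|(f : l2) i - g i| ^+ 2 <= (2 * e) ^+ 2.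
  move=> e0; have := Fn _ e0 => -[[A B] /= [FA FB] AB].
  apply: filterS FA => f Af D.
  pose N : Cx R := (size D).+1%:R.
  have N0 : 0 < N by rewrite ltr0n.
  have N1 : 1 <= N by rewrite ler1n.
  have [h [Bh hD]] : exists h : l2, B h /\ {in D, forall i, `|g i - h i| <= e / N}.
    apply: (@filter_ex _ F); apply: filterI => //.
    have := @filter_bigI l2 I D (fun i => [set h : l2 | `|g i - h i| <= e / N]) F _.
    have H i : i \in D -> F [set h : l2 | `|g i - h i| <= e / N].
      by move=> _; move/cvgrPdist_le : (gF i); apply; rewrite divr_gt0.
    by move=> /(_ _ H); apply: filterS => h Dh i iD; exact: Dh.
  have dom i : `|f i - g i| ^+ 2 <= 2 * `|(f - h) i| ^+ 2 + 2 * `|g i - h i| ^+ 2.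
    rewrite -(normrN (g i - h i)).
    apply: le_trans (sqr_normD_le _ _).
    by rewrite opprB addrA subrK.
  apply: le_trans (ler_sum _ (fun i _ => dom i)) _.
  rewrite big_split /= -!mulr_sumr.
  have fh : \sum_(i <- D) `|(f - h) i| ^+ 2 <= e ^+ 2.
    apply: le_trans ((l2_sqP (f - h)).1 D) _; rewrite l2_ip_norm.
    by rewrite ler_pXn2r ?nnegrE ?(ltW e0)// ltW// (AB (f, h)).
  have gh : \sum_(i <- D) `|g i - h i| ^+ 2 <= e ^+ 2.
    apply: le_trans (_ : \sum_(i <- D) (e / N) ^+ 2 <= _).
      rewrite big_seq [leRHS]big_seq; apply: ler_sum => i iD.
      by rewrite ler_pXn2r ?nnegrE ?divr_ge0 ?(ltW e0) ?(ltW N0)// hD.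
    rewrite big_const_seq count_predT iter_addr_0 exprMn -mulrnAr ler_piMr ?exprn_ge0 ?(ltW e0)//.
    rewrite exprVn -[_ *+ _]mulr_natl ler_pdivrMr ?exprn_gt0// mul1r.
    rewrite (le_trans (_ : _ <= N))// ?ler_nat// expr2 ler_peMr// ltW//.
  rewrite (_ : (2 * e) ^+ 2 = 2 * e ^+ 2 + 2 * e ^+ 2); last by ring.
  by apply: lerD; rewrite ler_wpM2l.
have [f0 f0g] : exists f0 : l2, forall A : {fset I},
   \sum_(i <- A) `|f0 i - g i| ^+ 2 <= (2 * 1) ^+ 2.
  exact: filter_ex (near_g _ ltr01).
have dl2 : (fun i => f0 i - g i) \in l2_pred by apply/asboolP; eexists; exact: f0g.
pose gl : l2 := f0 - L2 dl2.
have glE i : gl i = g i by rewrite /gl /= opprB addrCA subrr addr0.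
apply/cvg_ex; exists gl; apply/cvgrPdist_le => e e0.
have e2 : 0 < e / 2 by rewrite divr_gt0.
apply: filterS (near_g _ e2) => f fg.
rewrite distrC; apply: l2_norm_le; first exact: ltW.
move=> A; have := fg A; rewrite mulrC divfK ?pnatr_eq0//.
apply: le_trans; rewrite le_eqVlt; apply/orP; left; apply/eqP.
by apply: eq_bigr => i _; rewrite -glE.
Qed.

HB.instance Definition _ := Uniform_isComplete.Build l2 l2_complete.
HB.instance Definition _ := CompleteNormedModule_isHilbert.Build R l2
  l2_ip_linearl l2_ipC l2_ip_norm.

End L2.

Section BoundedOperators.
Variables (R : realType) (E : hilbertType R).

Definition bounded_linear (T : E -> E) : Prop :=
  linear T /\ exists2 c : Cx R, 0 <= c & forall x, `|T x| <= c * `|x|.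

Definition bop_pred : {pred E -> E} := fun T => `[< bounded_linear T >].

Record bop := Bop { bopval :> E -> E ; _ : bopval \in bop_pred }.

Lemma bop_submod : submod_closed bop_pred.
Proof.
split.
  apply/asboolP; split; first by move=> a x y; rewrite scaler0 addr0.
  by exists 0 => // x; rewrite normr0 mul0r.
move=> a S T /asboolP[linS [c c0 Sc]] /asboolP[linT [d d0 Td]]; apply/asboolP; split.
  move=> b x y; rewrite !fctE linS linT !scalerDr !scalerA mulrC addrACA.
  by rewrite -!scalerA -scalerDr.
exists (`|a| * c + d) => [|x]; first by rewrite addr_ge0 ?mulr_ge0.
rewrite mulrDl (le_trans (ler_normD _ _))//.
by apply: lerD => //; rewrite normrZ -mulrA ler_wpM2l.
Qed.

HB.instance Definition _ := [isSub for bopval].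
HB.instance Definition _ := [Choice of bop by <:].
HB.instance Definition _ :=
  GRing.isSubmodClosed.Build (Cx R) (E -> E) bop_pred bop_submod.
HB.instance Definition _ := [SubChoice_isSubLmodule of bop by <:].

Lemma bop_comp_subproof (S T : bop) : (fun x => S (T x)) \in bop_pred.
Proof.
case: S T => S /= /asboolP[linS [c c0 Sc]] [T /= /asboolP[linT [d d0 Td]]].
apply/asboolP; split=> [b x y|]; first by rewrite linT linS.
exists (c * d) => [|x]; first exact: mulr_ge0.
by apply: le_trans (Sc _) _; rewrite -mulrA ler_wpM2l.
Qed.

Definition bop_comp (S T : bop) : bop := Bop (bop_comp_subproof S T).

(* The functionals sum_n <T xi_n, eta_n> with xi, eta square-summable are the
   weak*-continuous ones; they induce the topology carried by [bop E], whose
   restriction to a von Neumann algebra N is the weak* topology of N. *)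
Definition ultraweak_functional (p : l2 nat E * l2 nat E) (T : bop) : Cx R :=
  sum (fun n => ip (T (p.1 n)) (p.2 n)).

HB.instance Definition _ := Topological.copy bop
  (sup_topology (fun p : l2 nat E * l2 nat E =>
     Topological.class (initial_topology (ultraweak_functional p)))).
HB.instance Definition _ := isPointed.Build bop 0.

End BoundedOperators.

Arguments l2_pred {R I E}.
Arguments bop_pred {R E}.
Arguments ultraweak_functional {R E}.

Section UltraweakConvergence.
Variables (R : realType) (E : hilbertType R).

Lemma ultraweak_cvgP (F : set_system (bop E)) (T : bop E) : Filter F ->
  F --> T <->
  forall p, ultraweak_functional p @ F --> ultraweak_functional p T.
Proof.
move=> FF; rewrite -[X in X <-> _]/(F --> (T : sup_topology _)) cvg_sup.
have EQ p : F --> (T : initial_topology (ultraweak_functional p)) <->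
    ultraweak_functional p @ F --> ultraweak_functional p T.
  split=> [FT|FT A].
    apply: cvg_trans (cvg_app _ FT) _.
    exact: (@initial_continuous _ _ (ultraweak_functional p)).
  rewrite (@nbhsE (initial_topology (ultraweak_functional p))) => -[B [[C oC <-] BT] BA].
  by apply: (filterS BA); apply: FT; exact: open_nbhs_nbhs.
by split=> h p; apply/EQ; exact: h.
Qed.

End UltraweakConvergence.

Section VonNeumannAlgebras.
Variables (R : realType) (E : hilbertType R).
Implicit Types (A B : set (bop E)) (S T : bop E).

(* S is the adjoint of T *)
Definition is_adjoint T S : Prop := forall x y, ip (T x) y = ip x (S y).

Definition commutant A : set (bop E) :=
  [set S | forall T, A T -> bop_comp S T = bop_comp T S].

Definition bicommutant A := commutant (commutant A).

(* von Neumann algebras as the self-adjoint sets equal to their bicommutant *)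
Definition von_neumann A : Prop :=
  (forall T S, A T -> is_adjoint T S -> A S) /\ bicommutant A = A.

Definition generated_vN A : set (bop E) := smallest von_neumann A.

End VonNeumannAlgebras.

Section CompletelyBoundedMaps.
Variables (R : realType) (E : hilbertType R).
Implicit Types (B : set (bop E)) (Phi : bop E -> bop E).

Definition opnorm (T : bop E) : \bar R :=
  ereal_sup [set (hnorm (T x))%:E | x in [set x | hnorm x <= 1]].

(* norm of the operator [T i j] on the n-fold Hilbert sum of E *)
Definition mx_opnorm n (T : 'M[bop E]_n) : \bar R :=
  ereal_sup [set (Num.sqrt (\sum_i hnorm (\sum_j T i j (x j)) ^+ 2))%:E
            | x in [set x : 'I_n -> E | \sum_j hnorm (x j) ^+ 2 <= 1]].

Definition cbnorm B Phi : \bar R :=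
  ereal_sup [set z | exists n (T : 'M[bop E]_n),
    [/\ forall i j, B (T i j), (mx_opnorm T <= 1)%E
      & z = mx_opnorm (map_mx Phi T)]].

Definition linear_on B Phi : Prop :=
  forall (a : Cx R) S T, B S -> B T -> Phi (a *: S + T) = a *: Phi S + Phi T.

Definition completely_bounded B Phi : Prop :=
  [/\ forall T, B T -> B (Phi T), linear_on B Phi & (cbnorm B Phi < +oo)%E].

Definition CB_sigma B Phi : Prop :=
  completely_bounded B Phi /\
  exists Psi, [/\ completely_bounded (bicommutant B) Psi,
    {within bicommutant B, continuous Psi} &
    forall T, B T -> Psi T = Phi T].

Definition finite_rank B Phi : Prop :=
  exists n (b : 'I_n -> bop E), forall T, B T ->
    exists c : 'I_n -> Cx R, Phi T = \sum_i c i *: b i.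

End CompletelyBoundedMaps.

Definition directed_set (I : Type) (le : I -> I -> Prop) : Prop :=
  [/\ inhabited I, forall i, le i i,
      forall i j k, le i j -> le j k -> le i k &
      forall i j, exists k, le i k /\ le j k].

Definition tails (I : Type) (le : I -> I -> Prop) : set_system I :=
  filter_from setT (fun i => [set j | le i j]).

Definition weakstar_CBAP (R : realType) (E : hilbertType R)
    (N : set (bop E)) : Prop :=
  exists (I : Type) (le : I -> I -> Prop) (Phi : I -> bop E -> bop E),
    [/\ directed_set le,
        forall i, [/\ completely_bounded N (Phi i), finite_rank N (Phi i) &
                      {within N, continuous (Phi i)}],
        forall T, N T -> (fun i => Phi i T) @ tails le --> T &
        exists c : R, forall i, (cbnorm N (Phi i) <= c%:E)%E].

Section OperatorsOnL2.
Variables (R : realType) (G : groupType) (E : hilbertType R).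

(* The bounded operator on l2(G, E) given by xi |-> (s |-> f xi s); it is 0 if
   there is none, see [lambda_opE] and [pi_repE]. *)
Definition l2_operator (f : l2 G E -> G -> E) : bop (l2 G E) :=
  get [set T : bop (l2 G E) | forall xi s, T xi s = f xi s].

Lemma l2_operatorE (f : l2 G E -> G -> E) :
    (forall a (xi eta : l2 G E) s,
      f (a *: xi + eta) s = a *: f xi s + f eta s) ->
    (exists2 c : Cx R, 0 <= c & forall (xi : l2 G E) (A : {fset G}),
      \sum_(s <- A) `|f xi s| ^+ 2 <= (c * `|xi|) ^+ 2) ->
  forall xi s, l2_operator f xi s = f xi s.
Proof.
move=> flin [c c0 fc].
have fl2 xi : f xi \in l2_pred by apply/asboolP; eexists; exact: fc.
have fb : (fun xi => L2 (fl2 xi)) \in bop_pred.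
  apply/asboolP; split=> [a xi eta|]; first by apply: l2_ext => s; exact: flin.
  by exists c => // xi; apply: l2_norm_le; [exact: mulr_ge0|exact: fc].
by apply: (@getPex _ [set T : bop (l2 G E) | forall xi s, T xi s = f xi s]);
  exists (Bop fb).
Qed.

Definition lambda_op (t : G) : bop (l2 G E) :=
  l2_operator (fun xi s => xi (t^-1 * s)%g).

Lemma lambda_opE t (xi : l2 G E) s : lambda_op t xi s = xi (t^-1 * s)%g.
Proof.
apply: (l2_operatorE (f := fun xi s => xi (t^-1 * s)%g)) => //.
exists 1 => // {}xi A; rewrite mul1r -l2_ip_norm.
apply: le_trans ((l2_sqP xi).1 [fset (t^-1 * s)%g | s in A]%fset).
rewrite big_imfset//= => x y _ _; exact: mulgI.
Qed.

Definition pi_rep (beta : G -> bop E -> bop E) (a : bop E) : bop (l2 G E) :=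
  l2_operator (fun xi s => beta s^-1%g a (xi s)).

(* When beta acts by *-automorphisms of a von Neumann algebra containing a,
   the hypothesis holds with c the norm of a. *)
Lemma pi_repE (beta : G -> bop E -> bop E) (a : bop E) :
    (exists2 c : Cx R, 0 <= c &
      forall s x, `|beta s^-1%g a x| <= c * `|x|) ->
  forall xi s, pi_rep beta a xi s = beta s^-1%g a (xi s).
Proof.
move=> [c c0 bc]; apply: l2_operatorE => [b xi eta s|].
  case: (beta _ _) => T /= /asboolP[linT _]; exact: linT.
exists c => // xi A; rewrite exprMn -l2_ip_norm.
apply: le_trans (_ : \sum_(s <- A) c ^+ 2 * `|xi s| ^+ 2 <= _).
  apply: ler_sum => s _.
  by rewrite -exprMn ler_pXn2r ?nnegrE ?mulr_ge0.
by rewrite -mulr_sumr ler_wpM2l ?exprn_ge0// (l2_sqP xi).1.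
Qed.

End OperatorsOnL2.

Section GroupWeakAmenability.
Variables (R : realType) (G : groupType).

Definition group_vN : set (bop (l2 G (scal R))) :=
  generated_vN (range (@lambda_op R G (scal R))).

Definition coefficient (xi eta : l2 G (scal R)) (t : G) : Cx R :=
  ip (lambda_op _ t xi) eta.

Definition fourier_algebra : set (G -> Cx R) :=
  [set u | exists xi eta, u = coefficient xi eta].

(* A(G) is the predual of VN(G) through <T, coefficient xi eta> = <T xi, eta>;
   S is the adjoint on VN(G) of the multiplication by phi on A(G). *)
Definition multiplier_adjoint (phi : G -> Cx R)
    (S : bop (l2 G (scal R)) -> bop (l2 G (scal R))) : Prop :=
  forall T xi eta xi' eta', group_vN T ->
    coefficient xi' eta' = (fun t => phi t * coefficient xi eta t) ->
    ip (S T xi) eta = ip (T xi') eta'.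

Definition HS_multiplier_group (phi : G -> Cx R) : Prop :=
  (forall u, fourier_algebra u -> fourier_algebra (fun t => phi t * u t)) /\
  exists2 S, multiplier_adjoint phi S & completely_bounded group_vN S.

(* S is determined on VN(G) by phi. *)
Definition HS_norm_group (phi : G -> Cx R) : \bar R :=
  ereal_inf [set cbnorm group_vN S | S in multiplier_adjoint phi].

Definition weakly_amenable_group : Prop :=
  exists (I : Type) (le : I -> I -> Prop) (phi : I -> G -> Cx R),
    [/\ directed_set le,
        forall i, HS_multiplier_group (phi i) /\
                  finite_set [set t | phi i t != 0],
        forall t, (fun i => phi i t) @ tails le --> (1 : Cx R) &
        exists c : R, forall i, (HS_norm_group (phi i) <= c%:E)%E].

End GroupWeakAmenability.

Section DynamicalSystems.
Variables (R : realType) (G : groupType) (H : hilbertType R).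
Variables (M : set (bop H)) (beta : G -> bop H -> bop H).

Definition star_automorphism (alpha : bop H -> bop H) : Prop :=
  [/\ set_bij M M alpha, linear_on M alpha,
      forall S T, M S -> M T ->
        alpha (bop_comp S T) = bop_comp (alpha S) (alpha T) &
      forall S T, M S -> M T -> is_adjoint S T ->
        is_adjoint (alpha S) (alpha T)].

Definition Wstar_dynamical_system : Prop :=
  [/\ von_neumann M, forall t, star_automorphism (beta t) &
      forall s t a, M a -> beta (s * t)%g a = beta s (beta t a)].

Definition M_beta : set (bop H) :=
  [set x | M x /\ forall t : discrete_topology G,
    opnorm (beta s x - beta t x) @[s --> t] --> 0%E].

Lemma M_betaE : M_beta = M.
Proof.
apply/seteqP; split=> [x []//|x Mx]; split=> // t.
have opnorm0 : opnorm (0 : bop H) = 0%E.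
  rewrite /opnorm (_ : [set _ | _ in _] = [set 0%E]) ?ereal_sup1//.
  apply/seteqP; split=> [_ [y _ <-]|_ ->]; first by rewrite /hnorm normr0.
  by exists 0 => /=; rewrite /hnorm normr0//= ler01.
apply: cvg_near_cst.
apply: (@filterS _ _ (nbhs_filter t) [set t]); last exact: discrete_set1.
by move=> s ->; rewrite subrr opnorm0.
Qed.

Definition crossed_product : set (bop (l2 G H)) :=
  generated_vN (pi_rep beta @` M `|` range (@lambda_op R G H)).

Definition HS_extension (F : G -> bop H -> bop H)
    (S : bop (l2 G H) -> bop (l2 G H)) : Prop :=
  [/\ completely_bounded crossed_product S,
      {within crossed_product, continuous S} &
      forall a t, M_beta a ->
        S (bop_comp (pi_rep beta a) (lambda_op H t)) =
        bop_comp (pi_rep beta (F t a)) (lambda_op H t)].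

Definition HS_multiplier (F : G -> bop H -> bop H) : Prop :=
  [/\ forall t, completely_bounded M_beta (F t),
      exists c : R, forall t, (cbnorm M_beta (F t) <= c%:E)%E &
      exists S, HS_extension F S].

(* The extension S_F is unique on the crossed product. *)
Definition HS_norm (F : G -> bop H -> bop H) : \bar R :=
  ereal_inf [set cbnorm crossed_product S | S in HS_extension F].

Definition weakly_amenable_system : Prop :=
  exists (I : Type) (le : I -> I -> Prop) (F : I -> G -> bop H -> bop H),
    [/\ directed_set le,
        forall i, HS_multiplier (F i) /\
          finite_set [set t | exists2 a, M_beta a & F i t a != 0],
        forall i t, CB_sigma M_beta (F i t) /\
          exists Psi, [/\ completely_bounded M Psi, finite_rank M Psi &
                          forall a, M_beta a -> Psi a = F i t a],
        forall t a, M a -> (fun i => F i t a) @ tails le --> a &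
        exists c : R, forall i, (HS_norm (F i) <= c%:E)%E].

End DynamicalSystems.

(* Main.v *)
Require Import Defs.
From HB Require Import structures.
From mathcomp Require Import all_boot all_order all_algebra.
From mathcomp Require Import all_classical all_reals all_analysis.
From mathcomp Require Import complex finmap summability ring lra.

Set Implicit Arguments.
Unset Strict Implicit.
Unset Printing Implicit Defensive.
Import Order.TTheory GRing.Theory Num.Theory.
Import numFieldNormedType.Exports.
Local Open Scope classical_set_scope.
Local Open Scope ring_scope.

(* An element T of the crossed product is determined by its coefficients T_t in M
   ([coef T t]), its matrix entries being T_{r,s} = beta_{r^-1} (T_{r s^-1}).  A
   Herz-Schur multiplier acts by S_F(T)_t = F(t)(T_t), so S_F has finite rank when F
   is finitely supported with finite-rank values; if moreover F_i(t)(a) -> a, the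
   bounded net S_{F_i} converges on matrix entries, hence ultraweakly.

   Conversely, from a finite-rank Phi on the crossed product and a finitely
   supported Herz-Schur multiplier phi of G put
   F(t)(a) = phi(t) (Phi(pi(a) lambda_t))_t.  The extension S_F sends T to the
   operator with entries phi(r s^-1) Phi(pi(T_{r s^-1}) lambda_{r s^-1})_{r,s}.  The
   matrix of the pi(T_{r s^-1}) lambda_{r s^-1} has norm at most |T|, and Schur
   multiplication by phi(r s^-1) has norm at most the multiplier norm of phi, so
   |S_F|_cb <= |phi| |Phi|_cb.

   Both directions need that *-automorphisms of M are ultraweakly continuous and
   completely isometric, for which each of them is implemented by an isometry
   H -> l2(nat, H): the operators intertwining it with the identity
   representation have no common kernel. *)

(** * Hilbert spaces and bounded operators *)

(** Automorphisms are not assumed ultraweakly continuous; this must come from algebra and order.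
    Positivity is expressed by invertibility ([opos_inv]), and the resolvents (1 + h)^-1 replace
    functional calculus: they stay in M, reverse the order and are carried along by automorphisms.
    If every intertwiner kills x, a density theorem on countably many copies of H yields
    self-adjoint a_k in M that tend to 0 on a total sequence while their images at x tend to x; an
    order argument then forces x = 0.

    Separability of H provides the total sequence and cuts the intertwiners down to a sequence.
    Countability of G makes a -> pi(a) lambda_t ultraweakly continuous, as ultraweak functionals are
    sums over nat.

    The Schur bound for phi needs no factorisation of phi: if z is a scalar matrix, the matrix of
    the z_{rs} lambda_{r s^-1} has norm at most that of z, and the adjoint of the multiplier,
    applied entrywise, multiplies z_{rs} by phi(r s^-1). The matrix of the pi(T_{r s^-1}) lambda_{r
    s^-1} is bounded by |T| because, after regrouping coordinates, it acts on each right translate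
    of the index set as a compression of T. *)

Section ComplexModulus.
Variable R : realType.
Implicit Types z w : Cx R.

Definition cmod (z : Cx R) : R := complex.Re `|z|.

Lemma cmodE z : `|z| = (cmod z)%:C%C.
Proof. exact: Cx_normE. Qed.

Lemma cmod_ge0 z : 0 <= cmod z.
Proof. exact/Re_ge0. Qed.

Lemma RC_inj (a b : R) : (a%:C%C : Cx R) = b%:C%C -> a = b.
Proof. by case. Qed.

Lemma cmodM z w : cmod (z * w) = cmod z * cmod w.
Proof. by apply: RC_inj; rewrite rmorphM/= -!cmodE normrM. Qed.

Lemma cmodD z w : cmod (z + w) <= cmod z + cmod w.
Proof. by rewrite -ler_RC rmorphD/= -!cmodE ler_normD. Qed.

Lemma cmodN z : cmod (- z) = cmod z.
Proof. by rewrite /cmod normrN. Qed.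

Lemma cmodJ z : cmod z^* = cmod z.
Proof. by rewrite /cmod norm_conjC. Qed.

Lemma cmod0 : cmod 0 = 0.
Proof. by rewrite /cmod normr0. Qed.

Lemma cmod1 : cmod 1 = 1.
Proof. by rewrite /cmod normr1. Qed.

Lemma cmodR (a : R) : cmod (a%:C%C : Cx R) = `|a|.
Proof. by apply: RC_inj; rewrite -cmodE norm_RC. Qed.

Lemma cmod_eq0 z : cmod z = 0 -> z = 0.
Proof. by move=> z0; apply/eqP; rewrite -normr_eq0 cmodE z0. Qed.

Lemma Re_cmod z : `|complex.Re z| <= cmod z.
Proof. by rewrite -ler_RC -cmodE Re_norm_le. Qed.

Lemma mulJ z : z^* * z = (cmod z ^+ 2)%:C%C.
Proof. by rewrite mulrC -normCK cmodE rmorphXn. Qed.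

Lemma ReD z w : complex.Re (z + w) = complex.Re z + complex.Re w.
Proof. by case: z; case: w. Qed.
Lemma ReN z : complex.Re (- z) = - complex.Re z.
Proof. by case: z. Qed.
Lemma ReJ z : complex.Re z^* = complex.Re z.
Proof. by case: z. Qed.
Lemma ReMR (a : R) z : complex.Re ((a%:C%C : Cx R) * z) = a * complex.Re z.
Proof. by case: z => x y /=; rewrite mul0r subr0. Qed.
Lemma Re_sum I (r : seq I) (P : pred I) (F : I -> Cx R) :
  complex.Re (\sum_(i <- r | P i) F i) = \sum_(i <- r | P i) complex.Re (F i).
Proof. by elim/big_rec2: _ => // i y1 y2 _ <-; rewrite ReD. Qed.
Lemma conjRC (a : R) : ((a%:C%C : Cx R)^*) = a%:C%C.
Proof. by apply: conj_Creal; rewrite complex_real. Qed.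

End ComplexModulus.

Section InnerProductTheory.
Variables (R : realType) (E : hilbertType R).
Implicit Types (x y : E) (a : Cx R).

Lemma normE x : `|x| = (hnorm x)%:C%C.
Proof. exact/Cx_realE/normr_ge0. Qed.

Lemma ipDl x1 x2 y : ip (x1 + x2) y = ip x1 y + ip x2 y.
Proof. by have := ip_linearl y 1 x1 x2; rewrite scale1r mul1r. Qed.
Lemma ip0l y : ip 0 y = 0.
Proof. by apply: (addrI (ip 0 y)); rewrite -ipDl !addr0. Qed.
Lemma ipZl a x y : ip (a *: x) y = a * ip x y.
Proof. by have := ip_linearl y a x 0; rewrite !addr0 ip0l addr0. Qed.
Lemma ipNl x y : ip (- x) y = - ip x y.
Proof. by rewrite -scaleN1r ipZl mulN1r. Qed.
Lemma ipBl x1 x2 y : ip (x1 - x2) y = ip x1 y - ip x2 y.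
Proof. by rewrite ipDl ipNl. Qed.
Lemma ip_suml I (r : seq I) (P : pred I) (F : I -> E) y :
  ip (\sum_(i <- r | P i) F i) y = \sum_(i <- r | P i) ip (F i) y.
Proof. by elim/big_rec2: _ => [|i y1 y2 _ <-]; rewrite ?ip0l ?ipDl. Qed.
Lemma ipDr x y1 y2 : ip x (y1 + y2) = ip x y1 + ip x y2.
Proof. by rewrite ipC ipDl rmorphD/= -!ipC. Qed.
Lemma ip0r x : ip x 0 = 0.
Proof. by rewrite ipC ip0l rmorph0. Qed.
Lemma ipZr a x y : ip x (a *: y) = a^* * ip x y.
Proof. by rewrite ipC ipZl rmorphM/= -ipC. Qed.
Lemma ipNr x y : ip x (- y) = - ip x y.
Proof. by rewrite ipC ipNl rmorphN/= -ipC. Qed.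
Lemma ipBr x y1 y2 : ip x (y1 - y2) = ip x y1 - ip x y2.
Proof. by rewrite ipDr ipNr. Qed.
Lemma ip_sumr I (r : seq I) (P : pred I) (F : I -> E) x :
  ip x (\sum_(i <- r | P i) F i) = \sum_(i <- r | P i) ip x (F i).
Proof. by elim/big_rec2: _ => [|i y1 y2 _ <-]; rewrite ?ip0r ?ipDr. Qed.
Lemma ipxx x : ip x x = (hnorm x ^+ 2)%:C%C.
Proof. by rewrite ip_norm normE rmorphXn. Qed.

Lemma hnorm_ge0 x : 0 <= hnorm x.
Proof. exact/Re_ge0. Qed.
Lemma hnorm0 : hnorm (0 : E) = 0.
Proof. by rewrite /hnorm normr0. Qed.
Lemma hnorm_eq0 x : hnorm x = 0 -> x = 0.
Proof. by move=> x0; apply/eqP; rewrite -normr_eq0 normE x0. Qed.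
Lemma hnormN x : hnorm (- x) = hnorm x.
Proof. by rewrite /hnorm normrN. Qed.
Lemma hnormBC x y : hnorm (x - y) = hnorm (y - x).
Proof. by rewrite -hnormN opprB. Qed.
Lemma hnormD x y : hnorm (x + y) <= hnorm x + hnorm y.
Proof. by rewrite -ler_RC rmorphD/= -!normE ler_normD. Qed.
Lemma hnormZ a x : hnorm (a *: x) = cmod a * hnorm x.
Proof. by apply: RC_inj; rewrite rmorphM/= -cmodE -!normE normrZ. Qed.
Lemma hnormZR (r : R) x : hnorm ((r%:C%C : Cx R) *: x) = `|r| * hnorm x.
Proof. by rewrite hnormZ cmodR. Qed.

Lemma cmod_ip x y : cmod (ip x y) <= hnorm x * hnorm y.
Proof. by rewrite -ler_RC rmorphM/= -cmodE -!normE ip_norm_le. Qed.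

Definition rip x y : R := complex.Re (ip x y).

Lemma ripDl x1 x2 y : rip (x1 + x2) y = rip x1 y + rip x2 y.
Proof. by rewrite /rip ipDl ReD. Qed.
Lemma ripDr x y1 y2 : rip x (y1 + y2) = rip x y1 + rip x y2.
Proof. by rewrite /rip ipDr ReD. Qed.
Lemma ripNl x y : rip (- x) y = - rip x y.
Proof. by rewrite /rip ipNl ReN. Qed.
Lemma ripNr x y : rip x (- y) = - rip x y.
Proof. by rewrite /rip ipNr ReN. Qed.
Lemma ripBl x1 x2 y : rip (x1 - x2) y = rip x1 y - rip x2 y.
Proof. by rewrite ripDl ripNl. Qed.
Lemma ripBr x y1 y2 : rip x (y1 - y2) = rip x y1 - rip x y2.
Proof. by rewrite ripDr ripNr. Qed.
Lemma ripC x y : rip x y = rip y x.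
Proof. by rewrite /rip ipC ReJ. Qed.
Lemma rip0l y : rip 0 y = 0. Proof. by rewrite /rip ip0l. Qed.
Lemma ripZl (r : R) x y : rip ((r%:C%C : Cx R) *: x) y = r * rip x y.
Proof. by rewrite /rip ipZl ReMR. Qed.
Lemma ripZr (r : R) x y : rip x ((r%:C%C : Cx R) *: y) = r * rip x y.
Proof. by rewrite ripC ripZl ripC. Qed.
Lemma ripxx x : rip x x = hnorm x ^+ 2.
Proof. by rewrite /rip ipxx. Qed.
Lemma rip_le x y : `|rip x y| <= hnorm x * hnorm y.
Proof. exact: le_trans (Re_cmod _) (cmod_ip _ _). Qed.
Lemma rip_sumr I (r : seq I) (P : pred I) (F : I -> E) x :
  rip x (\sum_(i <- r | P i) F i) = \sum_(i <- r | P i) rip x (F i).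
Proof. by rewrite /rip ip_sumr Re_sum. Qed.
Lemma rip_suml I (r : seq I) (P : pred I) (F : I -> E) x :
  rip (\sum_(i <- r | P i) F i) x = \sum_(i <- r | P i) rip (F i) x.
Proof. by rewrite /rip ip_suml Re_sum. Qed.

Lemma hnorm_sqrD x y :
  hnorm (x + y) ^+ 2 = hnorm x ^+ 2 + hnorm y ^+ 2 + 2 * rip x y.
Proof. by rewrite -!ripxx !(ripDl, ripDr) (ripC y x); ring. Qed.
Lemma hnorm_sqrB x y :
  hnorm (x - y) ^+ 2 = hnorm x ^+ 2 + hnorm y ^+ 2 - 2 * rip x y.
Proof. by rewrite hnorm_sqrD hnormN ripNr; ring. Qed.
Lemma parallelogram x y :
  hnorm (x + y) ^+ 2 + hnorm (x - y) ^+ 2 = 2 * hnorm x ^+ 2 + 2 * hnorm y ^+ 2.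
Proof. by rewrite hnorm_sqrD hnorm_sqrB; ring. Qed.

Lemma ip_eq0 x : (forall y, ip x y = 0) -> x = 0.
Proof.
by move=> /(_ x); rewrite ip_norm => /eqP; rewrite expf_eq0 /= normr_eq0 => /eqP.
Qed.

Lemma ip_ext x y : (forall z, ip x z = ip y z) -> x = y.
Proof.
by move=> h; apply/subr0_eq/ip_eq0 => z; rewrite ipBl h subrr.
Qed.

(** The real inner product determines the complex one, so orthogonality and self-adjointness can be
    proved for [rip] and then lifted. *)
Lemma ImE x y : complex.Im (ip x y) = rip x ('i *: y).
Proof.
rewrite /rip ipZr conjCi; case: (ip x y) => a b.
by rewrite -complexiE/= mulN1r oppr0 mul0r sub0r opprK.
Qed.

Lemma ip_rip0 x y : rip x y = 0 -> rip x ('i *: y) = 0 -> ip x y = 0.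
Proof. by rewrite -ImE /rip; case: (ip x y) => a b /= -> ->. Qed.

Lemma hcauchy (u : nat -> E) :
  (forall e : R, 0 < e -> exists N, forall m n, (N <= m)%N -> (N <= n)%N ->
     hnorm (u m - u n) <= e) ->
  exists l, forall e : R, 0 < e -> exists N, forall n, (N <= n)%N ->
     hnorm (u n - l) <= e.
Proof.
move=> uc; have : cvg (u @ \oo).
  apply: cauchy_cvg; apply/cauchy_ballP => e e0.
  have e2 : 0 < complex.Re e / 2 by rewrite divr_gt0// Re_gt0.
  have [N hN] := uc _ e2.
  exists ([set x | exists2 n, (N <= n)%N & x = u n],
          [set x | exists2 n, (N <= n)%N & x = u n]).
    by split; exists N => // n /= Nn; exists n.
  move=> [_ _] /= [[m Nm ->] [n Nn ->]]; rewrite -ball_normE /= normE.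
  rewrite (Cx_realE (ltW e0)) ltr_RC (le_lt_trans (hN _ _ Nm Nn))//.
  by rewrite ltr_pdivrMr// ltr_pMr ?Re_gt0// ltr1n.
case/cvg_ex => l ul; exists l => e e0.
move/cvgrPdist_le : ul => /(_ e%:C%C); rewrite ltr_RC => /(_ e0) -[N _ hN].
by exists N => n Nn; have := hN n Nn; rewrite /= normE ler_RC hnormBC.
Qed.

End InnerProductTheory.

Section BoundedOperatorTheory.
Variables (R : realType) (E : hilbertType R).
Implicit Types (S T : bop E) (x y : E).

Lemma bop_linear T : linear T.
Proof. by case: T => T /= /asboolP[]. Qed.

HB.instance Definition _ T := GRing.isLinear.Build (Cx R) E E *:%R
  (bopval T) (bop_linear T).

Lemma bop_bound T : exists2 c : R, 0 <= c & forall x, hnorm (T x) <= c * hnorm x.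
Proof.
case: T => T /= /asboolP[_ [c c0 Tc]]; exists (complex.Re c); first exact: Re_ge0.
by move=> x; rewrite -ler_RC rmorphM/= -!normE -(Cx_realE c0).
Qed.

Lemma bop_ext S T : S =1 T -> S = T.
Proof. by move=> ST; apply/val_inj/funext. Qed.

Lemma mkbop (f : E -> E) (c : R) : linear f -> 0 <= c ->
  (forall x, hnorm (f x) <= c * hnorm x) -> {T : bop E | forall x, T x = f x}.
Proof.
move=> fl c0 fc; have fP : f \in bop_pred.
  apply/asboolP; split=> //; exists c%:C%C; first by rewrite ler_RC.
  by move=> x; rewrite !normE -rmorphM/= ler_RC.
by exists (Bop fP).
Qed.

Lemma bopDE S T x : (S + T) x = S x + T x. Proof. by []. Qed.
Lemma bopNE T x : (- T) x = - T x. Proof. by []. Qed.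
Lemma bopBE S T x : (S - T) x = S x - T x. Proof. by []. Qed.
Lemma bopZE (a : Cx R) T x : (a *: T) x = a *: T x. Proof. by []. Qed.
Lemma bop0E x : (0 : bop E) x = 0. Proof. by []. Qed.
Lemma bop_sumE I (r : seq I) (P : pred I) (F : I -> bop E) x :
  (\sum_(i <- r | P i) F i) x = \sum_(i <- r | P i) F i x.
Proof. by elim/big_rec2: _ => // i y1 y2 _ <-. Qed.
Lemma bop_compE S T x : bop_comp S T x = S (T x). Proof. by []. Qed.

Lemma bop_id_subproof : (@id E) \in bop_pred.
Proof.
by apply/asboolP; split=> //; exists 1 => // x; rewrite mul1r.
Qed.
Definition bop_id : bop E := Bop bop_id_subproof.
Lemma bop_idE x : bop_id x = x. Proof. by []. Qed.

Lemma bop_comp1l T : bop_comp bop_id T = T.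
Proof. exact: bop_ext. Qed.
Lemma bop_comp1r T : bop_comp T bop_id = T.
Proof. exact: bop_ext. Qed.
Lemma bop_compDl (S T U : bop E) :
  bop_comp (S + T) U = bop_comp S U + bop_comp T U.
Proof. exact: bop_ext. Qed.
Lemma bop_compDr (S T U : bop E) :
  bop_comp U (S + T) = bop_comp U S + bop_comp U T.
Proof. by apply: bop_ext => x; rewrite !(bop_compE, bopDE) linearD. Qed.

Definition hcl (C : set E) : set E :=
  [set z | forall e : R, 0 < e -> exists2 c, C c & hnorm (z - c) <= e].

Lemma sub_hcl C : C `<=` hcl C.
Proof. by move=> x Cx' e e0; exists x => //; rewrite subrr hnorm0 ltW. Qed.

Lemma hnorm_trib x y z : hnorm (x - z) <= hnorm (x - y) + hnorm (y - z).
Proof. by have := hnormD (x - y) (y - z); rewrite addrA subrK. Qed.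

Lemma hcl_le (C : set E) (f : E -> R) (k b : R) : 0 <= k ->
  (forall x y, f x <= f y + k * hnorm (x - y)) ->
  (forall x, C x -> f x <= b) -> forall x, hcl C x -> f x <= b.
Proof.
move=> k0 fl fC x Cx'; apply/ler_addgt0Pr => e e0.
have [y Cy xy] := Cx' (e / (k + 1)) (divr_gt0 e0 (ltr_wpDl k0 ltr01)).
apply: le_trans (fl _ y) _; apply: lerD; first exact: fC.
apply: le_trans (ler_wpM2l k0 xy) _.
rewrite mulrCA ler_piMr ?(ltW e0)// ler_pdivrMr ?mul1r ?lerDl//.
exact: ltr_wpDl.
Qed.

Lemma hcl_eq0 (C : set E) (f : E -> Cx R) (k : R) : 0 <= k ->
  (forall x y, cmod (f x - f y) <= k * hnorm (x - y)) ->
  (forall x, C x -> f x = 0) -> forall x, hcl C x -> f x = 0.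
Proof.
move=> k0 fl fC x Cx'; apply: cmod_eq0; apply/eqP; rewrite eq_le cmod_ge0 andbT.
apply: (hcl_le (f := fun x => cmod (f x)) k0 _ _ Cx') => [y z|y /fC ->] /=.
  apply: (@le_trans _ _ (cmod (f z) + cmod (f y - f z))); last by rewrite lerD2l.
  by have := cmodD (f z) (f y - f z); rewrite addrC subrK.
by rewrite cmod0.
Qed.

Lemma hcl_ip0 (C : set E) w : (forall c, C c -> ip w c = 0) ->
  forall c, hcl C c -> ip w c = 0.
Proof.
apply: (hcl_eq0 (f := fun c => ip w c) (hnorm_ge0 w)) => x y.
by rewrite -ipBr cmod_ip.
Qed.

(** Real scalars only, because [nearest_point] is also applied to an orbit under the self-adjoint
    elements of M, which is not a complex subspace. *)
Definition real_subspace (C : set E) : Prop :=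
  [/\ C 0, forall x y, C x -> C y -> C (x + y) &
      forall (r : R) x, C x -> C ((r%:C%C : Cx R) *: x)].

Definition cx_subspace (C : set E) : Prop :=
  [/\ C 0, forall x y, C x -> C y -> C (x + y) &
      forall (a : Cx R) x, C x -> C (a *: x)].

(** The first-order condition at a minimum; t = r / (k + 1) is already decisive. *)
Lemma quadratic_eq0 (r k : R) : 0 <= k -> (forall t, 2 * t * r <= t ^+ 2 * k) ->
  r = 0.
Proof.
move=> k0 /(_ (r / (k + 1))) h; have k1 : 0 < k + 1 by rewrite ltr_wpDl.
have : r ^+ 2 * (k + 2) <= 0.
  have := ler_wpM2r (ltW (mulr_gt0 k1 k1)) h.
  have -> : 2 * (r / (k + 1)) * r * ((k + 1) * (k + 1)) = 2 * r ^+ 2 * (k + 1).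
    by field; rewrite gt_eqF.
  have -> : (r / (k + 1)) ^+ 2 * k * ((k + 1) * (k + 1)) = r ^+ 2 * k.
    by field; rewrite gt_eqF.
  by rewrite -subr_ge0 => ?; rewrite -subr_ge0; nra.
rewrite pmulr_lle0; last by rewrite ltr_wpDl.
by move=> r2; apply/eqP; rewrite -sqrf_eq0 eq_le r2 sqr_ge0.
Qed.

Lemma nearest_point (C : set E) w : real_subspace C ->
  exists2 z, hcl C z & forall c, C c -> rip (w - z) c = 0.
Proof.
move=> [C0 CD CZ].
pose A := [set hnorm (w - c) | c in C]; pose d := inf A.
have A0 : has_lbound A by exists 0 => _ [c _ <-]; exact: hnorm_ge0.
have Ai : has_inf A by split=> //; exists (hnorm (w - 0)), 0.
have dle c : C c -> d <= hnorm (w - c) by move=> Cc; apply: ge_inf => //; exists c.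
have d0 : 0 <= d by apply: lb_le_inf; [case: Ai|move=> _ [c _ <-]; exact: hnorm_ge0].
have /choice[c cP] (n : nat) : exists c, C c /\ hnorm (w - c) <= d + n.+1%:R^-1.
  have n0 : 0 < (n.+1%:R^-1 : R) by rewrite invr_gt0.
  have [_ [c Cc <-] cd] := inf_adherent n0 Ai.
  by exists c; split=> //; exact: ltW.
have inv_le (m n : nat) : (m <= n)%N -> (n.+1%:R^-1 : R) <= m.+1%:R^-1.
  by move=> mn; rewrite lef_pV2 ?posrE// ler_nat.
have small (e : R) : 0 < e -> exists N : nat, N.+1%:R^-1 <= e.
  move=> e0; exists (Num.trunc e^-1); rewrite -[leRHS]invrK lef_pV2 ?posrE ?invr_gt0//.
  by rewrite ltW// truncnS_gt.
have [|z zP] := hcauchy (u := c).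
  (* If both distances are at most d + s with s <= 1, the parallelogram law gives |c m - c n|^2 <= 4
     ((d + s)^2 - d^2) <= 4 (2 d + 1) s. *)
  move=> e e0; pose k := 4 * (2 * d + 1).
  have k0 : 0 < k by rewrite mulr_gt0// ltr_wpDl// mulr_ge0.
  have [N hN] := small (e ^+ 2 / k) (divr_gt0 (exprn_gt0 _ e0) k0).
  exists N => m n Nm Nn; set s := (N.+1%:R^-1 : R) in hN.
  have s0 : 0 < s by rewrite invr_gt0.
  have s1 : s <= 1 by rewrite invf_le1// ler1n.
  have [[Cm dm] [Cn dn]] := (cP m, cP n).
  have hm : hnorm (w - c m) <= d + s by rewrite (le_trans dm)// lerD2l inv_le.
  have hn : hnorm (w - c n) <= d + s by rewrite (le_trans dn)// lerD2l inv_le.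
  have mid : d <= hnorm (w - (((2^-1)%:C%C : Cx R) *: (c m + c n))).
    by apply: dle; apply: CZ; exact: CD.
  have midE : (w - c m) + (w - c n) =
      ((2%:C%C : Cx R)) *: (w - (((2^-1)%:C%C : Cx R) *: (c m + c n))).
    rewrite scalerBr scalerA -rmorphM/= divff ?pnatr_eq0// rmorph1 scale1r.
    by rewrite [(2)%:C%C](_ : _ = 2%:R) ?rmorph_nat// scaler_nat mulr2n opprD addrACA.
  have := parallelogram (w - c m) (w - c n).
  rewrite midE hnormZR ger0_norm// opprB [w - c m + _]addrC addrA subrK => P.
  rewrite -(@ler_pXn2r _ 2)// ?nnegrE ?hnorm_ge0 ?(ltW e0)//.
  have ks : s * k <= e ^+ 2 by rewrite -ler_pdivlMr.
  rewrite hnormBC; have := hnorm_ge0 (w - c m); have := hnorm_ge0 (w - c n).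
  move: P ks mid hm hn; rewrite /k exprMn.
  set a := hnorm (w - c m); set b := hnorm (w - c n); set q := hnorm (w - _).
  set p := hnorm (c n - c m) ^+ 2 => P ks mid hm hn b0 a0.
  have q2 : d ^+ 2 <= q ^+ 2 by rewrite ler_pXn2r ?nnegrE// (le_trans d0).
  have a2 : a ^+ 2 <= (d + s) ^+ 2 by rewrite ler_pXn2r ?nnegrE// (le_trans a0).
  have b2 : b ^+ 2 <= (d + s) ^+ 2 by rewrite ler_pXn2r ?nnegrE// (le_trans b0).
  have ss : s ^+ 2 <= s by rewrite expr2 ler_piMr// ltW.
  nra.
exists z => [e e0|x Cx'].
  have [N hN] := zP _ e0; exists (c N); first by case: (cP N).
  by rewrite hnormBC hN.
have zd : hnorm (w - z) <= d.
  apply/ler_addgt0Pr => e e0; have e2 : 0 < e / 2 by rewrite divr_gt0.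
  have [N1 h1] := small _ e2; have [N2 h2] := zP _ e2.
  pose n := maxn N1 N2; apply: le_trans (hnorm_trib _ (c n) _) _.
  rewrite [in leRHS](splitr e) addrA lerD ?h2 ?leq_maxr//.
  have [_ cd] := cP n; rewrite (le_trans cd)// lerD2l (le_trans _ h1)//.
  by rewrite inv_le// leq_maxl.
apply: (quadratic_eq0 (exprn_ge0 2 (hnorm_ge0 x))) => t.
have dt : d <= hnorm (w - z - ((t%:C%C : Cx R) *: x)).
  apply/ler_addgt0Pr => e e0; have [N hN] := zP _ e0.
  have := dle _ (CD _ _ (proj1 (cP N)) (CZ t _ Cx')) => h.
  apply: le_trans h _; apply: le_trans (hnorm_trib _ (z + ((t%:C%C : Cx R) *: x)) _) _.
  rewrite (_ : w - (z + _) = w - z - (t%:C%C : Cx R) *: x); last by rewrite opprD addrA.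
  rewrite lerD2l.
  by rewrite opprD addrACA subrr addr0 hnormBC hN.
have := hnorm_sqrB (w - z) ((t%:C%C : Cx R) *: x).
rewrite hnormZR exprMn real_normK ?num_real// ripZr => h.
have h2 : d ^+ 2 <= hnorm (w - z - ((t%:C%C : Cx R) *: x)) ^+ 2.
  by rewrite ler_pXn2r ?nnegrE ?hnorm_ge0.
have h3 : hnorm (w - z) ^+ 2 <= d ^+ 2 by rewrite ler_pXn2r ?nnegrE ?hnorm_ge0.
by move: h2 h3; rewrite h; nra.
Qed.

Lemma cx_real_subspace C : cx_subspace C -> real_subspace C.
Proof. by move=> [? ? CZ]; split=> // r x; exact: CZ. Qed.

Lemma nearest_point_cx (C : set E) w : cx_subspace C ->
  exists2 z, hcl C z & forall c, C c -> ip (w - z) c = 0.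
Proof.
move=> CS; have [z Cz zP] := nearest_point w (cx_real_subspace CS).
exists z => // c Cc; apply: ip_rip0; apply: zP => //.
by case: CS => _ _; apply.
Qed.

Lemma hcl_cx_subspace C : cx_subspace C -> cx_subspace (hcl C).
Proof.
move=> [C0 CD CZ]; split; first exact: sub_hcl.
  move=> x y Cx' Cy e e0; have e2 : 0 < e / 2 by rewrite divr_gt0.
  have [x' Cx1 hx] := Cx' _ e2; have [y' Cy1 hy] := Cy _ e2.
  exists (x' + y'); first exact: CD.
  by rewrite opprD addrACA (le_trans (hnormD _ _))// [leRHS]splitr lerD.
move=> a x Cx' e e0.
have a1 : 0 < cmod a + 1 by rewrite ltr_wpDl ?cmod_ge0.
have [x' Cx1 hx] := Cx' _ (divr_gt0 e0 a1).
exists (a *: x'); first exact: CZ.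
rewrite -scalerBr hnormZ (le_trans (ler_wpM2l (cmod_ge0 _) hx))//.
by rewrite mulrCA ler_piMr ?(ltW e0)// ler_pdivrMr ?mul1r ?lerDl.
Qed.

Lemma proj_uniq (C : set E) (p : E -> E) w z : cx_subspace C ->
  (forall w, hcl C (p w)) -> (forall w c, hcl C c -> ip (w - p w) c = 0) ->
  hcl C z -> (forall c, hcl C c -> ip (w - z) c = 0) -> p w = z.
Proof.
move=> CS p1 p2 Cz zP; have [_ HD HZ] := hcl_cx_subspace CS.
apply/subr0_eq/hnorm_eq0; apply/eqP; rewrite -sqrf_eq0 -ripxx /rip.
have Cpz : hcl C (p w - z) by rewrite -scaleN1r; apply: HD => //; exact: HZ.
have pzE : p w - z = (w - z) - (w - p w) by rewrite opprB [RHS]addrC addrA subrK.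
by rewrite [X in ip X _]pzE ipBl zP ?p2 ?subrr.
Qed.

Lemma projection (C : set E) : cx_subspace C -> exists P : bop E,
  (forall w, hcl C (P w)) /\ forall w c, hcl C c -> ip (w - P w) c = 0.
Proof.
move=> CS; have /choice[p pP] w : exists z, hcl C z /\
    forall c, hcl C c -> ip (w - z) c = 0.
  by have [z Cz zP] := nearest_point_cx w CS; exists z; split=> //; exact: hcl_ip0.
have [H0 HD HZ] := hcl_cx_subspace CS.
have pu w z := proj_uniq (w := w) (z := z) CS (fun w => proj1 (pP w)) (fun w => proj2 (pP w)).
have pl : linear p.
  move=> a x y; apply: pu; first by apply: HD; [apply: HZ; case: (pP x)|case: (pP y)].
  move=> c Cc; rewrite opprD addrACA -scalerBr ipDl ipZl.
  by rewrite (proj2 (pP x))// (proj2 (pP y))// mulr0 addr0.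
have [//|x|P PE] := mkbop pl (c := 1).
  rewrite mul1r; have [Cp pw] := pP x.
  rewrite -(@ler_pXn2r _ 2)// ?nnegrE ?hnorm_ge0//.
  have := hnorm_sqrD (x - p x) (p x); rewrite subrK => ->.
  by rewrite /rip pw// mulr0 addr0 lerDr sqr_ge0.
by exists P; split=> w; rewrite PE; case: (pP w).
Qed.

Lemma riesz (f : E -> Cx R) (k : R) : 0 <= k ->
  (forall a x y, f (a *: x + y) = a * f x + f y) ->
  (forall x, cmod (f x) <= k * hnorm x) -> exists y, forall x, f x = ip x y.
Proof.
move=> k0 fl fb.
have fD x y : f (x + y) = f x + f y by have := fl 1 x y; rewrite scale1r mul1r.
have f0 : f 0 = 0 by apply: (addrI (f 0)); rewrite -fD !addr0.
have fZ a x : f (a *: x) = a * f x by have := fl a x 0; rewrite !addr0 f0 addr0.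
have fB x y : f (x - y) = f x - f y by rewrite -scaleN1r fD fZ mulN1r.
have [fz|] := pselect (forall x, f x = 0); first by exists 0 => x; rewrite ip0r.
move/existsNP => [w fw].
pose K := [set x | f x = 0].
have KS : cx_subspace K.
  by split=> //= [x y fx fy|a x fx]; rewrite /K/= ?fD ?fZ fx ?fy ?addr0 ?mulr0.
have [z Kz zP] := nearest_point_cx w KS.
have fz : f z = 0.
  by apply: (hcl_eq0 (f := f) k0 _ _ Kz) => // x y; rewrite -fB.
pose u := w - z; have fu : f u != 0 by rewrite fB fz subr0; apply/eqP.
have uu : ip u u != 0.
  apply: contra_neq fu; rewrite ip_norm => /eqP.
  by rewrite expf_eq0/= normr_eq0 => /eqP ->.
have uur : (ip u u)^* = ip u u by rewrite -ipC.
exists ((f u / ip u u)^* *: u) => x; rewrite ipZr conjCK.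
have Kx : K (x - (f x / f u) *: u) by rewrite /K/= fB fZ divfK// subrr.
have : ip (x - (f x / f u) *: u) u = 0 by rewrite ipC zP// rmorph0.
rewrite ipBl ipZl => /eqP; rewrite subr_eq0 => /eqP ->.
by field; rewrite fu uu.
Qed.

Lemma adjoint_exists T : exists S, is_adjoint T S.
Proof.
have [c c0 Tc] := bop_bound T.
have /choice[s sP] y : exists z, forall x, ip (T x) y = ip x z.
  apply: (riesz (f := fun x => ip (T x) y) (mulr_ge0 c0 (hnorm_ge0 y))).
    by move=> a x1 x2; rewrite linearP ip_linearl.
  move=> x; rewrite (le_trans (cmod_ip _ _))// mulrAC ler_wpM2r ?hnorm_ge0//.
have sl : linear s.
  move=> a x y; apply: ip_ext => z; apply: (inv_inj (@conjCK _)); rewrite -!ipC -sP.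
  by rewrite !ipDr !ipZr -!sP.
have [x|S SE] := mkbop sl c0; last by exists S => x y; rewrite SE.
have : hnorm (s x) ^+ 2 <= c * hnorm (s x) * hnorm x.
  rewrite -ler_RC -ipxx -sP (le_trans (real_ler_norm _))//.
    by rewrite sP ipxx complex_real.
  rewrite cmodE ler_RC (le_trans (cmod_ip _ _))// ler_wpM2r ?hnorm_ge0//.
have [->|sx] := eqVneq (hnorm (s x)) 0; first by rewrite mulr_ge0 ?hnorm_ge0.
by rewrite expr2 mulrAC ler_pM2r// lt_def sx hnorm_ge0.
Qed.

Definition adj T : bop E := projT1 (cid (adjoint_exists T)).

Lemma adjP T x y : ip (T x) y = ip x (adj T y).
Proof. exact: (projT2 (cid (adjoint_exists T))). Qed.

Lemma adjPr T x y : ip x (T y) = ip (adj T x) y.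
Proof. by rewrite ipC adjP -ipC. Qed.

Lemma adj_uniq T S : is_adjoint T S -> S = adj T.
Proof.
move=> TS; apply: bop_ext => x; apply: ip_ext => z.
by apply: (inv_inj (@conjCK _)); rewrite -!ipC -TS adjP.
Qed.

Lemma adjK T : adj (adj T) = T.
Proof. by symmetry; apply: adj_uniq => x y; rewrite -adjPr. Qed.

Lemma adj_comp S T : adj (bop_comp S T) = bop_comp (adj T) (adj S).
Proof. by symmetry; apply: adj_uniq => x y; rewrite !bop_compE !adjP. Qed.

Lemma adjD S T : adj (S + T) = adj S + adj T.
Proof. by symmetry; apply: adj_uniq => x y; rewrite !bopDE ipDl ipDr !adjP. Qed.

Lemma adjZ a T : adj (a *: T) = a^* *: adj T.
Proof. by symmetry; apply: adj_uniq => x y; rewrite !bopZE ipZl ipZr conjCK adjP. Qed.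

Lemma adjN T : adj (- T) = - adj T.
Proof. by rewrite -scaleN1r adjZ rmorphN1 scaleN1r. Qed.

Lemma adj0 : adj 0 = 0.
Proof. by symmetry; apply: adj_uniq => x y; rewrite ip0l ip0r. Qed.

End BoundedOperatorTheory.
Arguments bop_id {R E}.

(** * Positive operators and resolvents *)

Section PositiveOperators.
Variables (R : realType) (E : hilbertType R).
Implicit Types (S T h k b c : bop E) (x y z : E) (u v : nat -> E).

Lemma hnorm_dist x y : `|hnorm x - hnorm y| <= hnorm (x - y).
Proof.
have h1 := hnormD (x - y) y; have h2 := hnormD (y - x) x.
by rewrite ler_norml; move: h1 h2; rewrite !subrK (hnormBC y x); lra.
Qed.

Definition hlim u (l : E) : Prop := hnorm (u n - l) @[n --> \oo] --> (0 : R).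

Lemma hlimP u l : hlim u l <-> forall e : R, 0 < e ->
  exists N, forall n, (N <= n)%N -> hnorm (u n - l) <= e.
Proof.
split=> [/cvgrPdist_le ul e e0|ul].
  have [N _ hN] := ul _ e0; exists N => n Nn; have := hN n Nn.
  by rewrite /= sub0r normrN ger0_norm// hnorm_ge0.
apply/cvgrPdist_le => e e0; have [N hN] := ul _ e0.
by exists N => // n Nn /=; rewrite sub0r normrN ger0_norm ?hnorm_ge0// hN.
Qed.

Lemma hlim_squeeze u l (f : nat -> R) : (forall n, hnorm (u n - l) <= f n) ->
  f @ \oo --> (0 : R) -> hlim u l.
Proof.
move=> uf f0; apply: (squeeze_cvgr _ (cvg_cst 0) f0).
by apply: nearW => n; rewrite hnorm_ge0 uf.
Qed.

Lemma cvg_dist0 (f : nat -> R) (l : R) (g : nat -> R) :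
  (forall n, `|f n - l| <= g n) -> g @ \oo --> (0 : R) -> f @ \oo --> l.
Proof.
move=> fg g0; apply/subr_cvg0; apply: norm_cvg0.
by apply: (squeeze_cvgr _ (cvg_cst 0) g0); apply: nearW => n; rewrite normr_ge0 fg.
Qed.

Lemma cvgR_uniq (f : nat -> R) (a b : R) :
  f @ \oo --> a -> f @ \oo --> b -> a = b.
Proof. by move=> /(cvg_lim (@Rhausdorff R)) <- /(cvg_lim (@Rhausdorff R)) <-. Qed.

Lemma cvg0M (c : R) (f : nat -> R) :
  f @ \oo --> (0 : R) -> (fun n => c * f n) @ \oo --> (0 : R).
Proof. by move=> f0; have := cvgM (cvg_cst c) f0; rewrite mulr0; apply. Qed.

Lemma hlimD u v l m : hlim u l -> hlim v m -> hlim (fun n => u n + v n) (l + m).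
Proof.
move=> ul vm; apply: hlim_squeeze (_ : _ --> _); last first.
  by have := cvgD ul vm; rewrite addr0; apply.
by move=> n; rewrite opprD addrACA; exact: hnormD.
Qed.

Lemma hlim_bop T u l : hlim u l -> hlim (fun n => T (u n)) (T l).
Proof.
move=> ul; have [c c0 Tc] := bop_bound T.
apply: hlim_squeeze (cvg0M c ul).
by move=> n; rewrite -linearB; exact: Tc.
Qed.

Lemma hlim_rip u l y : hlim u l -> rip (u n) y @[n --> \oo] --> rip l y.
Proof.
move=> ul; apply: (cvg_dist0 (g := fun n => hnorm y * hnorm (u n - l))).
  by move=> n; rewrite -ripBl mulrC; exact: rip_le.
exact: cvg0M ul.
Qed.

Lemma hlim_uniq u l m : hlim u l -> hlim u m -> l = m.
Proof.
move=> ul um; apply/subr0_eq/hnorm_eq0; apply/eqP; rewrite -sqrf_eq0 -ripxx.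
rewrite ripBl subr_eq0; apply/eqP.
exact: (cvgR_uniq (hlim_rip (y := l - m) ul) (hlim_rip (y := l - m) um)).
Qed.

Definition sa T : Prop := is_adjoint T T.

Definition opos T : Prop := sa T /\ forall x, 0 <= rip (T x) x.

Lemma sa_rip T : sa T -> forall x y, rip (T x) y = rip x (T y).
Proof. by move=> Ts x y; rewrite /rip Ts. Qed.

Lemma sa_ipE T x : sa T -> ip (T x) x = (rip (T x) x)%:C%C.
Proof.
move=> Ts; rewrite /rip RRe_real//; apply/CrealP; rewrite -ipC.
by rewrite Ts.
Qed.

Lemma saD S T : sa S -> sa T -> sa (S + T).
Proof. by move=> Ss Ts x y; rewrite !bopDE ipDl ipDr Ss Ts. Qed.
Lemma saB S T : sa S -> sa T -> sa (S - T).
Proof. by move=> Ss Ts x y; rewrite !bopBE ipBl ipBr Ss Ts. Qed.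
Lemma sa0 : sa (0 : bop E).
Proof. by move=> x y; rewrite !bop0E ip0l ip0r. Qed.
Lemma sa_adjMl T : sa (bop_comp (adj T) T).
Proof. by move=> x y; rewrite !bop_compE -adjP -adjPr. Qed.

Lemma opos0 : opos (0 : bop E).
Proof. by split; [exact: sa0|move=> x; rewrite bop0E rip0l]. Qed.
Lemma opos1 : opos (bop_id : bop E).
Proof. by split=> // x; rewrite ripxx sqr_ge0. Qed.
Lemma oposD S T : opos S -> opos T -> opos (S + T).
Proof.
move=> [Ss S0] [Ts T0]; split; first exact: saD.
by move=> x; rewrite bopDE ripDl addr_ge0.
Qed.
Lemma opos_trans h k c : opos (k - h) -> opos (c - k) -> opos (c - h).
Proof. by move=> h1 h2; have := oposD h2 h1; rewrite addrA subrK. Qed.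
Lemma opos_adjMl T : opos (bop_comp (adj T) T).
Proof. by split=> [|x]; [exact: sa_adjMl|rewrite bop_compE /rip -adjPr -/(rip _ _) ripxx sqr_ge0]. Qed.

Lemma opos_CS T x y : opos T -> rip (T x) y ^+ 2 <= rip (T x) x * rip (T y) y.
Proof.
move=> [Ts T0].
have := @form_CauchySchwarz R E (fun x y => ip (T x) y).
move=> /(_ _ _ _ x y) h; apply: (@le_trans _ _ (cmod (ip (T x) y) ^+ 2)).
  rewrite -[leLHS]real_normK ?num_real// ler_pXn2r ?nnegrE ?cmod_ge0//.
  exact: Re_cmod.
rewrite -ler_RC rmorphXn/= -cmodE rmorphM/= -!sa_ipE//; apply: h.
- by move=> z a x1 x2; rewrite linearP ip_linearl.
- by move=> x1 x2; rewrite Ts -ipC.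
- by move=> z; rewrite sa_ipE// ler_RC.
Qed.

(** Cauchy-Schwarz for the form <T ., .> at the pair x, T x, divided by |T x|^2. *)
Lemma opos_norm_le T (k : R) x : opos T -> (forall z, rip (T z) z <= k * hnorm z ^+ 2) ->
  hnorm (T x) ^+ 2 <= k * rip (T x) x.
Proof.
move=> Tp Tk; have h := opos_CS x (T x) Tp; rewrite ripxx in h.
have [/eqP|Tx0] := eqVneq (hnorm (T x) ^+ 2) 0.
  by rewrite sqrf_eq0 => /eqP/hnorm_eq0 ->; rewrite hnorm0 rip0l mulr0 expr0n.
have Tx : 0 < hnorm (T x) ^+ 2 by rewrite lt_def Tx0 sqr_ge0.
rewrite -(ler_pM2r Tx) -expr2 (le_trans h)// mulrAC [leRHS]mulrC ler_wpM2l//.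
by case: Tp.
Qed.

Lemma ocontr_norm T x : opos T -> opos (bop_id - T) ->
  hnorm (T x) ^+ 2 <= rip (T x) x.
Proof.
move=> Tp [_ T1]; rewrite -[leRHS]mul1r; apply: opos_norm_le => // z.
by have := T1 z; rewrite bopBE bop_idE ripBl ripxx subr_ge0 mul1r.
Qed.

Lemma ocontr_le T x : opos T -> opos (bop_id - T) -> rip (T x) x <= hnorm x ^+ 2.
Proof. by move=> Tp [_ /(_ x)]; rewrite bopBE bop_idE ripBl ripxx subr_ge0. Qed.

Lemma ocontr_contr T x : opos T -> opos (bop_id - T) -> hnorm (T x) <= hnorm x.
Proof.
move=> Tp T1; rewrite -(@ler_pXn2r _ 2)// ?nnegrE ?hnorm_ge0//.
exact: le_trans (ocontr_norm x Tp T1) (ocontr_le x Tp T1).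
Qed.

(** A difference of two terms is a positive contraction, so [ocontr_norm] bounds |(r n - r m) x|^2
    by the increment of the quadratic form at x. Convergence of the bounded monotone forms thus
    becomes strong convergence. *)
Lemma mono_limit (r : nat -> bop E) : (forall n, opos (r n)) ->
  (forall n, opos (bop_id - r n)) -> (forall m n, (m <= n)%N -> opos (r n - r m)) ->
  exists s : bop E, [/\ forall x, hlim (fun n => r n x) (s x),
    opos s, opos (bop_id - s) & forall n, opos (s - r n)].
Proof.
move=> r0 r1 rm.
have rc x : exists l, hlim (fun n => r n x) l.
  pose q n := rip (r n x) x.
  have qm : nondecreasing_seq q.
    move=> m n mn; have [_ /(_ x)] := rm _ _ mn.
    by rewrite bopBE ripBl subr_ge0.
  have qb : has_ubound (range q).
    by exists (hnorm x ^+ 2) => _ [n _ <-]; exact: ocontr_le.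
  have qcv := nondecreasing_is_cvgn qm qb.
  have [|l lP] := @hcauchy R E (fun n => r n x); last first.
    by exists l; apply/hlimP.
  move=> e e0; have e2 : 0 < e ^+ 2 / 2 by rewrite divr_gt0// exprn_gt0.
  move/cvgrPdist_le : qcv => /(_ _ e2) [N _ hN]; exists N.
  have key m n : (m <= n)%N -> (N <= m)%N -> hnorm (r n x - r m x) <= e.
    move=> mn Nm; rewrite -(@ler_pXn2r _ 2)// ?nnegrE ?hnorm_ge0 ?(ltW e0)//.
    have dp := rm _ _ mn.
    have d1 : opos (bop_id - (r n - r m)).
      by have := oposD (r1 n) (r0 m); rewrite opprB addrA addrAC.
    have := ocontr_norm x dp d1; rewrite bopBE ripBl => /le_trans; apply.
    have := hN _ Nm; have := hN _ (leq_trans Nm mn); rewrite /= -/(q n) -/(q m).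
    rewrite !ler_norml => /andP[a1 a2] /andP[b1 b2]; lra.
  move=> m n Nm Nn; have [mn|/ltnW nm] := leqP m n; last exact: key.
  by rewrite hnormBC; exact: key.
have [s sP] := choice rc.
have sl : linear s.
  move=> a x y; apply: (hlim_uniq (sP _)); have := hlimD (sP x) (sP y).
  move=> _; have := hlimD (u := fun n => a *: r n x) (l := a *: s x) _ (sP y).
  rewrite (_ : (fun n => r n (a *: x + y)) = (fun n => a *: r n x + r n y)).
    apply; apply: hlim_squeeze (cvg0M (cmod a) (sP x)).
    by move=> n; rewrite -scalerBr hnormZ.
  by apply/funext => n; rewrite linearP.
have [//|x|S SE] := mkbop (c := 1) sl.
  rewrite mul1r; have cx : hnorm (r n x) @[n --> \oo] --> hnorm (s x).
    by apply: (cvg_dist0 _ (sP x)) => n; exact: hnorm_dist.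
  by apply: (cvgr_to_le cx); apply: nearW => n; exact: ocontr_contr.
have SP x : hlim (fun n => r n x) (S x) by rewrite SE; exact: sP.
have qc x y : rip (r n x) y @[n --> \oo] --> rip (S x) y by apply: hlim_rip.
have Ssa : sa S.
  have h x y : rip (S x) y = rip x (S y).
    apply: (cvgR_uniq (qc x y)); rewrite ripC.
    apply: cvg_trans (qc y x); apply: near_eq_cvg; apply: nearW => n /=.
    by rewrite ripC -(sa_rip (proj1 (r0 n))).
  move=> x y; have := h x y; have := h x ('i *: y); rewrite linearZ/= -!ImE /rip.
  by case: (ip (S x) y) => a b; case: (ip _ _) => a' b' /= -> ->.
have Sge n x : rip (r n x) x <= rip (S x) x.
  apply: (cvgr_to_ge (qc x x)); exists n => // m nm /=.
  by have [_ /(_ x)] := rm _ _ nm; rewrite bopBE ripBl subr_ge0.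
exists S; split=> // [||n].
- split=> // x; apply: le_trans (Sge 0%N x); by case: (r0 0%N).
- split=> [|x]; first exact: saB.
  rewrite bopBE ripBl subr_ge0 ripxx; apply: (cvgr_to_le (qc x x)).
  by apply: nearW => n; exact: ocontr_le.
- split=> [|x]; first by apply: saB => //; case: (r0 n).
  by rewrite bopBE ripBl subr_ge0.
Qed.

End PositiveOperators.

(** * Von Neumann algebras *)

Section Resolvents.
Variables (R : realType) (E : hilbertType R).
Implicit Types (S T h k b c : bop E) (x y z : E).

(** [c] is the two-sided inverse of 1 + h. *)
Definition is_res h c : Prop :=
  (forall x, c x + h (c x) = x) /\ (forall x, c (x + h x) = x).

Lemma inv_succ_small (e : R) : 0 < e -> exists N : nat, forall n, (N <= n)%N ->
  n.+1%:R^-1 <= e.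
Proof.
move=> e0; exists (Num.trunc e^-1) => n Nn.
rewrite -[leRHS]invrK lef_pV2 ?posrE ?invr_gt0// ltW//.
by rewrite (lt_le_trans (truncnS_gt _))// ler_nat.
Qed.

(** 1 + h is bounded below, hence injective with closed range, and self-adjoint, so the orthogonal
    complement of the range is trivial. *)
Lemma res_exists h : opos h -> exists c, is_res h c.
Proof.
move=> [hs h0]; have [A AE] : exists A : bop E, forall x, A x = x + h x by exists (bop_id + h).
have Ab x : hnorm x <= hnorm (A x).
  have [->|x0] := eqVneq (hnorm x) 0; first exact: hnorm_ge0.
  rewrite -(@ler_pM2r _ (hnorm x)); last by rewrite lt_def x0 hnorm_ge0.
  apply: (@le_trans _ _ (rip (A x) x)).
    by rewrite -expr2 -ripxx AE ripDl lerDl.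
  exact: le_trans (ler_norm _) (rip_le _ _).
have As : sa A by move=> x y; rewrite !AE ipDl ipDr hs.
have CS : cx_subspace (range A).
  split; first by exists 0 => //; rewrite linear0.
    by move=> _ _ [x _ <-] [y _ <-]; exists (x + y) => //; rewrite linearD.
  by move=> a _ [x _ <-]; exists (a *: x) => //; rewrite linearZ.
have surj y : exists x, A x = y.
  have [z Cz zP] := nearest_point_cx y CS.
  have yz : y - z = 0.
    apply: hnorm_eq0; apply/eqP; rewrite eq_le hnorm_ge0 andbT.
    rewrite (le_trans (Ab _))// (_ : A _ = 0) ?hnorm0//.
    by apply: ip_eq0 => x; rewrite As zP//; exists x.
  have {zP yz}Cy : hcl (range A) y by rewrite (subr0_eq yz).
  have /choice[u uP] (n : nat) : exists x, hnorm (y - A x) <= n.+1%:R^-1.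
    have [|_ [x _ <-]] := Cy n.+1%:R^-1; first by rewrite invr_gt0.
    by exists x.
  have uA : hlim (fun n => A (u n)) y.
    apply/hlimP => e /inv_succ_small[N hN]; exists N => n Nn.
    by rewrite hnormBC (le_trans (uP n))// hN.
  have [|x xP] := hcauchy (u := u).
    move=> e e0; have e2 : 0 < e / 2 by rewrite divr_gt0.
    have [N hN] := (hlimP _ _).1 uA _ e2; exists N => m n Nm Nn.
    apply: le_trans (Ab _) _; rewrite linearB/=.
    apply: le_trans (hnorm_trib _ y _) _; rewrite [leRHS]splitr.
    by rewrite lerD ?hN// hnormBC hN.
  exists x; apply: hlim_uniq uA; apply: hlim_bop; exact/hlimP.
have Ai x y : A x = A y -> x = y.
  move=> Axy; apply/subr0_eq/hnorm_eq0; apply/eqP; rewrite eq_le hnorm_ge0 andbT.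
  rewrite (le_trans (Ab _))// (_ : A _ = 0) ?hnorm0//.
  by rewrite linearB; apply/eqP; rewrite subr_eq0; apply/eqP.
have [c cP] := choice surj.
have cl : linear c by move=> a x y; apply: Ai; rewrite linearP/= !cP.
have [//|x|C CE] := mkbop (c := 1) cl; first by rewrite mul1r -{2}(cP x).
exists C; split=> x; rewrite !CE; first by rewrite -AE.
by apply: Ai; rewrite cP AE.
Qed.

Section Facts.
Variables (h c : bop E).
Hypotheses (hp : opos h) (hc : is_res h c).

Let hs : sa h. Proof. by case: hp. Qed.
Let cE x : x = c x + h (c x). Proof. by rewrite (proj1 hc). Qed.

Lemma res_opos : opos c.
Proof.
split=> [x y|x].
  by rewrite {1}(cE y) {2}(cE x) ipDr ipDl hs.
rewrite {2}(cE x) ripDr addr_ge0 ?ripxx ?sqr_ge0//.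
by rewrite ripC; case: hp.
Qed.

Lemma res_le1 : opos (bop_id - c).
Proof.
split=> [|x]; first by apply: saB => //; case: res_opos.
rewrite bopBE bop_idE; have -> : x - c x = h (c x) by rewrite {1}(cE x) addrAC subrr add0r.
rewrite {2}(cE x) ripDr addr_ge0//; first by case: hp.
by rewrite ripxx sqr_ge0.
Qed.

Lemma res_compl_le : opos (h - (bop_id - c)).
Proof.
split=> [|x].
  apply: saB => //; apply: saB => //; by case: res_opos.
rewrite !bopBE bop_idE; have -> : x - c x = h (c x) by rewrite {1}(cE x) addrAC subrr add0r.
rewrite -linearB/=; have -> : x - c x = h (c x) by rewrite {1}(cE x) addrAC subrr add0r.
rewrite {2}(cE x) ripDr addr_ge0//; last by case: hp.
by rewrite sa_rip// ripxx sqr_ge0.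
Qed.

(** For scalars: h <= 2 h / (1 + h) when 0 <= h <= 1. *)
Lemma res_compl_ge : opos (bop_id - h) -> opos ((bop_id - c) + (bop_id - c) - h).
Proof.
move=> h1; split=> [|x].
  by have cs : sa c := proj1 res_opos; do !apply: saB || apply: saD => //.
rewrite bopBE bopDE !bopBE bop_idE.
have -> : x - c x = h (c x) by rewrite {1}(cE x) addrAC subrr add0r.
set z := c x; rewrite (cE x) -/z linearD/= opprD addrA addrK.
rewrite ripBl !ripDr subr_ge0.
have hz := ocontr_norm z hp h1; have := ocontr_le (h z) hp h1.
have : rip (h (h z)) z = hnorm (h z) ^+ 2 by rewrite sa_rip// ripxx.
have := ripxx (h z); lra.
Qed.

Lemma res_comm (X : bop E) : (forall x, X (h x) = h (X x)) -> forall x, X (c x) = c (X x).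
Proof. move=> Xh x; rewrite -[in RHS](proj1 hc x). by rewrite linearD/= Xh (proj2 hc). Qed.

End Facts.

(** With v = c y and u = d y, positivity of 1 + h at v - u gives <v, y> >= 2 <u, y> - <(1 + h) u,
    u>. Replacing h by the larger k on the right leaves exactly <u, y>. *)
Lemma res_anti h k c d : opos h -> opos k -> is_res h c -> is_res k d ->
  opos (k - h) -> opos (c - d).
Proof.
move=> hp kp hc kd kh; split=> [|y].
  by apply: saB; [case: (res_opos hp hc)|case: (res_opos kp kd)].
have hs : sa h by case: hp.
set v := c y; set u := d y.
rewrite bopBE -/v -/u ripBl subr_ge0.
have yv : y = v + h v by rewrite (proj1 hc).
have yu : y = u + k u by rewrite (proj1 kd).
have [_ /(_ u)] := kh; rewrite bopBE ripBl.
have : 0 <= rip (v - u) (v - u) by rewrite ripxx sqr_ge0.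
have [_ /(_ (v - u))] := hp.
rewrite linearB/= !ripBl !ripBr (ripC u v).
have e1 : rip u y = rip u u + rip (k u) u by rewrite yu ripDr (ripC u (k u)).
have e2 : rip v y = rip v v + rip (h v) v by rewrite yv ripDr (ripC v (h v)).
have e3 : rip u y = rip v u + rip (h v) u by rewrite yv ripDr (ripC u (h v)) (ripC v u).
have e4 : rip (h u) v = rip (h v) u by rewrite sa_rip// ripC.
lra.
Qed.

(** Let s be the least shift for which b + s is positive. If s > 0, then b + s is positive and has a
    left inverse, so it dominates some d > 0, against minimality. The hypothesis is algebraic, so an
    automorphism can transport it. *)
Lemma opos_inv b : sa b ->
  (forall t : R, 0 < t -> exists c, forall x, c (b x + (t%:C%C : Cx R) *: x) = x) ->
  opos b.
Proof.
move=> bs binv; split=> // x0.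
have [k k0 bk] := bop_bound b.
have bq x : `|rip (b x) x| <= k * hnorm x ^+ 2.
  rewrite (le_trans (rip_le _ _))// expr2 mulrA ler_wpM2r// ?hnorm_ge0//.
pose A := [set t : R | 0 <= t /\ forall x, 0 <= rip (b x) x + t * hnorm x ^+ 2].
have Ak : A k.
  by split=> // x; have := bq x; rewrite ler_norml => /andP[]; lra.
have Ai : has_inf A by split; [exists k|exists 0 => t []].
pose s := inf A; have s0 : 0 <= s by apply: lb_le_inf; [exists k|move=> t []].
have As x : 0 <= rip (b x) x + s * hnorm x ^+ 2.
  apply/ler_addgt0Pr => e e0.
  have e1 : 0 < e / (hnorm x ^+ 2 + 1) by rewrite divr_gt0// ltr_wpDl ?sqr_ge0.
  have [t [t0 At] ts] := inf_adherent e1 Ai; apply: le_trans (At x) _.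
  rewrite -addrA lerD2l -lerBlDl -mulrBl.
  have x2 := sqr_ge0 (hnorm x).
  apply: le_trans (_ : e / (hnorm x ^+ 2 + 1) * hnorm x ^+ 2 <= _).
    by rewrite ler_wpM2r// lerBlDl ltW.
  by rewrite -mulrA ler_piMr ?(ltW e0)// mulrC ler_pdivrMr ?mul1r ?lerDl// ltr_wpDl.
have [s0'|] := eqVneq s 0; first by have := As x0; rewrite s0' mul0r addr0.
move=> sn; have sp : 0 < s by rewrite lt_def sn.
exfalso; have [c cP] := binv _ sp; have [m m0 cm] := bop_bound c.
pose a := b + (s%:C%C : Cx R) *: bop_id.
have aE x : a x = b x + (s%:C%C : Cx R) *: x by [].
have ar x y : rip (a x) y = rip (b x) y + s * rip x y by rewrite aE ripDl ripZl.
have ap : opos a.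
  split=> [x y|x]; last by rewrite ar ripxx.
  by rewrite !aE ipDl ipDr ipZl ipZr conjRC bs.
have ak z : rip (a z) z <= (k + s) * hnorm z ^+ 2.
  by rewrite ar ripxx mulrDl lerD2r (le_trans (ler_norm _))// bq.
(* |x| <= m |a x| and |a x|^2 <= (k + s) <a x, x> combine to |x|^2 <= q <a x, x>. The lower bound d
   used below is (q + 1)^-1, which also covers q = 0. *)
pose q := m ^+ 2 * (k + s); have q0 : 0 <= q by rewrite mulr_ge0 ?sqr_ge0// addr_ge0.
have ax x : hnorm x ^+ 2 <= q * rip (a x) x.
  apply: le_trans (_ : (m * hnorm (a x)) ^+ 2 <= _).
    rewrite ler_pXn2r ?nnegrE ?hnorm_ge0// ?mulr_ge0 ?hnorm_ge0//.
    by rewrite -{1}(cP x); exact: cm.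
  rewrite exprMn /q -mulrA ler_wpM2l ?sqr_ge0//; exact: opos_norm_le.
pose d := (q + 1)^-1; have d0 : 0 < d by rewrite invr_gt0 ltr_wpDl.
pose t := Num.max 0 (s - d).
have ts : t < s by rewrite gt_max sp ltrBlDr ltrDl.
suff /(ge_inf Ai.2) : A t by rewrite leNgt -/s ts.
split=> [|x]; first by rewrite le_max lexx.
have tsd : s - d <= t by rewrite le_max lexx orbT.
have x2 := sqr_ge0 (hnorm x).
apply: le_trans (_ : rip (b x) x + (s - d) * hnorm x ^+ 2 <= _); last first.
  by rewrite lerD2l ler_wpM2r.
have : d * hnorm x ^+ 2 <= rip (a x) x.
  rewrite mulrC ler_pdivrMr; last by rewrite ltr_wpDl.
  rewrite mulrDr mulr1 mulrC (le_trans (ax x))// lerDl; by case: ap.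
by rewrite ar ripxx mulrBl; lra.
Qed.

End Resolvents.

Section VonNeumannTheory.
Variables (R : realType) (E : hilbertType R) (M : set (bop E)).
Hypothesis MvN : von_neumann M.
Implicit Types (S T X : bop E) (x : E).

Lemma vN_mem T : (forall X, commutant M X -> forall x, T (X x) = X (T x)) -> M T.
Proof.
move=> h; have [_ <-] := MvN => X MX; apply: bop_ext => x; exact: h.
Qed.

Lemma commutantP A T X : commutant A X -> A T -> forall x, X (T x) = T (X x).
Proof. by move=> AX AT x; have := AX T AT => /(congr1 (fun f : bop E => f x)). Qed.

Lemma vN_comm T X : M T -> commutant M X -> forall x, T (X x) = X (T x).
Proof. by move=> MT MX x; rewrite (commutantP MX MT). Qed.

Lemma vN1 : M bop_id.
Proof. by apply: vN_mem. Qed.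
Lemma vN0 : M 0.
Proof. by apply: vN_mem => X _ x; rewrite !bop0E linear0. Qed.
Lemma vND S T : M S -> M T -> M (S + T).
Proof.
by move=> MS MT; apply: vN_mem => X MX x; rewrite !bopDE linearD/= !(vN_comm _ MX).
Qed.
Lemma vNZ a T : M T -> M (a *: T).
Proof. by move=> MT; apply: vN_mem => X MX x; rewrite !bopZE linearZ/= (vN_comm _ MX). Qed.
Lemma vNN T : M T -> M (- T).
Proof. by rewrite -scaleN1r; exact: vNZ. Qed.
Lemma vNB S T : M S -> M T -> M (S - T).
Proof. by move=> MS MT; apply: vND => //; exact: vNN. Qed.
Lemma vNM S T : M S -> M T -> M (bop_comp S T).
Proof.
by move=> MS MT; apply: vN_mem => X MX x; rewrite !bop_compE !(vN_comm _ MX).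
Qed.
Lemma vN_adj T : M T -> M (adj T).
Proof. by move=> MT; have [h _] := MvN; apply: (h T) => // x y; exact: adjP. Qed.
Lemma vN_sum I (r : seq I) (P : pred I) (F : I -> bop E) :
  (forall i, P i -> M (F i)) -> M (\sum_(i <- r | P i) F i).
Proof. by move=> MF; elim/big_ind: _ => //; [exact: vN0|exact: vND]. Qed.

Lemma vN_lim (r : nat -> bop E) (s : bop E) : (forall n, M (r n)) ->
  (forall x, hlim (fun n => r n x) (s x)) -> M s.
Proof.
move=> Mr rs; apply: vN_mem => X MX x.
apply: (hlim_uniq (rs (X x))).
rewrite (_ : (fun n => _) = (fun n => X (r n x))); first exact: hlim_bop.
by apply/funext => n; rewrite (vN_comm _ MX).
Qed.

Lemma vN_res h c : M h -> is_res h c -> M c.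
Proof.
move=> Mh hc; apply: vN_mem => X MX x; symmetry.
by apply: (res_comm hc) => y; rewrite (vN_comm _ MX).
Qed.

End VonNeumannTheory.

Section GeneratedVonNeumann.
Variables (R : realType) (E : hilbertType R).
Implicit Types (A : set (bop E)) (S T X : bop E).

Lemma sub_bicommutant A : A `<=` bicommutant A.
Proof. by move=> T AT X AX; rewrite AX. Qed.

Lemma commutantS A B : A `<=` B -> commutant B `<=` commutant A.
Proof. by move=> AB X BX T /AB; exact: BX. Qed.

Lemma generated_vN_von_neumann A : von_neumann (generated_vN A).
Proof.
split=> [T S AT TS C [CvN AC]|].
  by have [h _] := CvN; apply: (h T) => //; apply: AT.
apply/seteqP; split; last exact: sub_bicommutant.
move=> T AT C [CvN AC]; have [_ <-] := CvN.
apply: commutantS AT; apply: commutantS => X; apply; split=> //.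
Qed.

Lemma sub_generated_vN A : A `<=` generated_vN A.
Proof. by move=> T AT C [_]; apply. Qed.

(** Self-adjointness of A makes its bicommutant a von Neumann algebra, which therefore contains the
    generated one. *)
Lemma generated_vN_comm A T X : (forall S, A S -> A (adj S)) ->
  generated_vN A T -> commutant A X -> forall x, T (X x) = X (T x).
Proof.
move=> Aadj AT AX; suff : bicommutant A T by move=> /(_ X AX) TX x; rewrite -!bop_compE TX.
apply: AT; split; last exact: sub_bicommutant.
have CA Y : commutant A Y -> commutant A (adj Y).
  move=> AY S AS; have := AY _ (Aadj _ AS) => /(congr1 (@adj R E)).
  by rewrite !adj_comp adjK.
split=> [S' S AS' /adj_uniq -> Y AY|].
  have := AS' _ (CA _ AY) => /(congr1 (@adj R E)).
  by rewrite !adj_comp adjK.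
apply/seteqP; split; last exact: sub_bicommutant.
by apply: commutantS; exact: sub_bicommutant.
Qed.

End GeneratedVonNeumann.

Lemma linear_on0 (R : realType) (E : hilbertType R) (B : set (bop E)) Phi :
  von_neumann B -> linear_on B Phi -> Phi 0 = 0.
Proof.
move=> BvN Pl; have B0 := vN0 BvN; have := Pl 1 0 0 B0 B0.
by rewrite scaler0 addr0 scale1r => h; apply: (addrI (Phi 0)); rewrite addr0.
Qed.

(** * Square-summable families *)

Section Isometries.
Variables (R : realType) (E F : hilbertType R).

Lemma isometry_ip (U : E -> F) : (forall x y, U (x + y) = U x + U y) ->
  (forall x, U ('i *: x) = 'i *: U x) -> (forall x, hnorm (U x) ^+ 2 = hnorm x ^+ 2) ->
  forall x y, ip (U x) (U y) = ip x y.
Proof.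
move=> UD Ui Un; have Urip x y : rip (U x) (U y) = rip x y.
  by have := hnorm_sqrD x y; rewrite -Un UD hnorm_sqrD !Un; lra.
move=> x y; have h1 := Urip x y; have h2 := Urip x ('i *: y).
move: h2; rewrite Ui -!ImE; move: h1; rewrite /rip.
by case: (ip x y) => a b; case: (ip _ _) => a' b' /= -> ->.
Qed.

End Isometries.

Section L2Theory.
Variables (R : realType) (E : hilbertType R) (I : choiceType).
Implicit Types (f g : l2 I E) (i j : I) (A : {fset I}).

Lemma l2DE f g i : (f + g) i = f i + g i. Proof. by []. Qed.
Lemma l2NE f i : (- f) i = - f i. Proof. by []. Qed.
Lemma l2BE f g i : (f - g) i = f i - g i. Proof. by []. Qed.
Lemma l2ZE (a : Cx R) f i : (a *: f) i = a *: f i. Proof. by []. Qed.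
Lemma l2_sumE J (r : seq J) (P : pred J) (F : J -> l2 I E) i :
  (\sum_(j <- r | P j) F j) i = \sum_(j <- r | P j) F j i.
Proof. by elim/big_rec2: _ => // k y1 y2 _ <-. Qed.

Lemma ip_l2E f g : ip f g = sum (fun i => ip (f i) (g i)).
Proof. by []. Qed.

Lemma sum_sqE f A :
  \sum_(i <- A) `|f i| ^+ 2 = (\sum_(i <- A) hnorm (f i) ^+ 2)%:C%C :> Cx R.
Proof. by rewrite rmorph_sum; apply: eq_bigr => i _; rewrite normE rmorphXn. Qed.

Lemma le_hnorm_l2 f A : \sum_(i <- A) hnorm (f i) ^+ 2 <= hnorm f ^+ 2.
Proof.
by have := (l2_sqP f).1 A; rewrite sum_sqE l2_ip_norm normE -rmorphXn ler_RC.
Qed.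

Lemma hnorm_l2_le f (c : R) : (forall A, \sum_(i <- A) hnorm (f i) ^+ 2 <= c) ->
  hnorm f ^+ 2 <= c.
Proof.
move=> h; rewrite -ler_RC rmorphXn/= -normE -l2_ip_norm.
by apply: (l2_sqP f).2 => A; rewrite sum_sqE ler_RC.
Qed.

Lemma l2_coord f i : hnorm (f i) <= hnorm f.
Proof. by rewrite -ler_RC -!normE; exact: l2_coord_le. Qed.

(** The bridge from bounded finite sums to [esum], whose Fubini and reindexing rules carry most norm
    computations below. *)
Lemma esum_fset_le (a : I -> R) (c : R) : (forall i, 0 <= a i) ->
  (forall A, \sum_(i <- A) a i <= c) <-> (\esum_(i in [set: I]) (a i)%:E <= c%:E)%E.
Proof.
move=> a0; split=> [h|h A].
  apply: ge_ereal_sup => _ [X [fX _] <-].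
  by rewrite fsbig_finite//= sumEFin lee_fin h.
rewrite -lee_fin (le_trans _ h)// -sumEFin; apply: ereal_sup_ubound.
exists [set` A] => //=.
by rewrite fsbig_finite//= set_fsetK.
Qed.

Lemma esum_l2 f : \esum_(i in [set: I]) (hnorm (f i) ^+ 2)%:E = (hnorm f ^+ 2)%:E.
Proof.
have a0 i : 0 <= hnorm (f i) ^+ 2 by rewrite sqr_ge0.
apply/eqP; rewrite eq_le; apply/andP; split.
  by apply/esum_fset_le => // A; exact: le_hnorm_l2.
have : (\esum_(i in [set: I]) (hnorm (f i) ^+ 2)%:E <= (hnorm f ^+ 2)%:E)%E.
  by apply/esum_fset_le => // A; exact: le_hnorm_l2.
have : (0 <= \esum_(i in [set: I]) (hnorm (f i) ^+ 2)%:E)%E.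
  by apply: esum_ge0 => i _; rewrite lee_fin.
case E1 : (\esum_(i in _) _)%E => [c| |] // _ _; rewrite lee_fin.
by apply: hnorm_l2_le; apply/esum_fset_le => //; rewrite E1.
Qed.

Lemma mkl2 (f : I -> E) (c : R) :
  (\esum_(i in [set: I]) (hnorm (f i) ^+ 2)%:E <= c%:E)%E ->
  exists g : l2 I E, (forall i, g i = f i) /\ hnorm g ^+ 2 <= c.
Proof.
have a0 i : 0 <= hnorm (f i) ^+ 2 by rewrite sqr_ge0.
move=> /(esum_fset_le _ a0) fc; have fl : f \in l2_pred.
  apply/asboolP; exists c%:C%C => A.
  rewrite (eq_bigr (fun i => (hnorm (f i) ^+ 2)%:C%C)); last first.
    by move=> i _; rewrite normE rmorphXn.
  by rewrite -rmorph_sum ler_RC.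
by exists (L2 fl); split=> //; exact: hnorm_l2_le.
Qed.

Definition dfun i (x : E) j : E := if j == i then x else 0.

Lemma dfun_l2 i x : dfun i x \in l2_pred.
Proof.
apply/asboolP; exists (`|x| ^+ 2) => A; rewrite /dfun.
have [iA|iA] := boolP (i \in A).
  rewrite (big_fsetD1 i)//= eqxx big1_seq ?addr0// => j /andP[_].
  by rewrite !inE => /andP[/negbTE -> _]; rewrite normr0 expr0n.
rewrite big1_seq ?exprn_ge0// => j /andP[_ jA].
by case: eqP => [ji|]; [rewrite -ji jA in iA|rewrite normr0 expr0n].
Qed.

Definition delta i (x : E) : l2 I E := L2 (dfun_l2 i x).

Arguments delta : simpl never.

Lemma deltaE i x j : delta i x j = if j == i then x else 0.
Proof. by []. Qed.

Lemma delta_linear i : linear (delta i).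
Proof.
move=> a x y; apply: l2_ext => j; rewrite l2DE l2ZE !deltaE.
by case: eqP => // _; rewrite scaler0 addr0.
Qed.

HB.instance Definition _ i := GRing.isLinear.Build (Cx R) E (l2 I E) *:%R
  (delta i) (delta_linear i).

Lemma ip_deltar f i x : ip f (delta i x) = ip (f i) x.
Proof.
rewrite ip_l2E; apply: cvg_sum; apply: cvg_near_cst.
exists [fset i]%fset => // A iA; rewrite partial_sumE.
have {}iA : i \in A by apply: (fsubsetP iA); rewrite inE.
rewrite (big_fsetD1 i)// deltaE eqxx big1_seq ?Monoid.mulm1// => j /andP[_].
by rewrite !inE deltaE => /andP[/negbTE -> _]; rewrite ip0r.
Qed.

Lemma ip_deltal f i x : ip (delta i x) f = ip x (f i).
Proof. by rewrite ipC ip_deltar -ipC. Qed.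

Lemma hnorm_delta i x : hnorm (delta i x) = hnorm x.
Proof.
apply/eqP; rewrite -(@eqrXn2 _ 2)// ?hnorm_ge0//; apply/eqP.
by rewrite -!ripxx /rip ip_deltar deltaE eqxx.
Qed.

Definition restr A f : l2 I E := \sum_(i <- A) delta i (f i).

Lemma restrE A f i : restr A f i = if i \in A then f i else 0.
Proof.
rewrite l2_sumE; case: ifPn => iA.
  rewrite (big_fsetD1 i)// deltaE eqxx big1_seq ?Monoid.mulm1// => j /andP[_].
  by rewrite !inE deltaE eq_sym => /andP[/negbTE -> _].
rewrite big1_seq// => j /andP[_ jA]; rewrite deltaE.
by case: eqP => // ij; rewrite ij jA in iA.
Qed.

Lemma hnorm_restr_sqr A f :
  hnorm (f - restr A f) ^+ 2 = hnorm f ^+ 2 - \sum_(i <- A) hnorm (f i) ^+ 2.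
Proof.
have rA g : rip g (restr A f) = \sum_(i <- A) rip (g i) (f i).
  by rewrite rip_sumr; apply: eq_bigr => i _; rewrite /rip ip_deltar.
have nr : hnorm (restr A f) ^+ 2 = \sum_(i <- A) hnorm (f i) ^+ 2.
  by rewrite -ripxx rA; apply: eq_big_seq => i iA; rewrite restrE iA ripxx.
have fr : rip f (restr A f) = \sum_(i <- A) hnorm (f i) ^+ 2.
  by rewrite rA; apply: eq_bigr => i _; rewrite ripxx.
by rewrite hnorm_sqrB fr nr; ring.
Qed.

Lemma l2_finite_approx f (e : R) : 0 < e -> exists A, forall B, (A `<=` B)%fset ->
  hnorm (f - restr B f) <= e.
Proof.
move=> e0; have e2 : 0 < e ^+ 2 by rewrite exprn_gt0.
have [A hA] : exists A, hnorm f ^+ 2 - e ^+ 2 <= \sum_(i <- A) hnorm (f i) ^+ 2.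
  apply: contrapT => /forallNP h.
  have : hnorm f ^+ 2 <= hnorm f ^+ 2 - e ^+ 2.
    by apply: hnorm_l2_le => A; have /negP := h A; rewrite -ltNge => /ltW.
  by rewrite lerBrDr gerDl leNgt e2.
exists A => B AB; rewrite -(@ler_pXn2r _ 2)// ?nnegrE ?hnorm_ge0 ?(ltW e0)//.
rewrite hnorm_restr_sqr lerBlDr -lerBlDl (le_trans hA)//.
rewrite -ler_RC !rmorph_sum; apply: sum_fset_le AB => i.
by rewrite ler_RC sqr_ge0.
Qed.

Lemma restr_hcl f (C : set (l2 I E)) : cx_subspace C ->
  (forall i, C (delta i (f i))) -> hcl C f.
Proof.
move=> [C0 CD _] Cf e e0; have [A hA] := l2_finite_approx f e0.
exists (restr A f); last exact: hA.
by elim/big_ind: (restr A f) => //.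
Qed.

Lemma bop_l2_ext (S T : bop (l2 I E)) :
  (forall i x, S (delta i x) = T (delta i x)) -> S = T.
Proof.
move=> ST; apply: bop_ext => f; apply: ip_ext => g; apply/eqP.
rewrite -subr_eq0 -ipBl; apply/eqP.
have [k k0 hk] := bop_bound (S - T).
apply: (hcl_eq0 (C := [set h | S h = T h])
  (f := fun h => ip (S h - T h) g) (k := k * hnorm g)) => [||h|].
- by rewrite mulr_ge0 ?hnorm_ge0.
- move=> x y; rewrite -ipBl -!bopBE -linearB (le_trans (cmod_ip _ _))//.
  by rewrite mulrAC ler_wpM2r ?hnorm_ge0 ?hk.
- by move=> /= ->; rewrite subrr ip0l.
- apply: restr_hcl => [|i]; last exact: ST.
  split=> /= [|x y hx hy|a x hx]; rewrite ?linear0// ?linearD/= ?linearZ/=.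
    by rewrite hx hy.
  by rewrite hx.
Qed.

Lemma mkbop_l2 (f : l2 I E -> I -> E) (c : R) : 0 <= c ->
  (forall a (x y : l2 I E) i, f (a *: x + y) i = a *: f x i + f y i) ->
  (forall x : l2 I E,
    (\esum_(i in [set: I]) (hnorm (f x i) ^+ 2)%:E <= ((c * hnorm x) ^+ 2)%:E)%E) ->
  exists T : bop (l2 I E), (forall (x : l2 I E) i, T x i = f x i) /\
    forall x : l2 I E, hnorm (T x) <= c * hnorm x.
Proof.
move=> c0 fl fb; have /choice[g gP] (x : l2 I E) := mkl2 (fb x).
have gl : linear g.
  by move=> a x y; apply: l2_ext => i; rewrite l2DE l2ZE !(proj1 (gP _)).
have gb (x : l2 I E) : hnorm (g x) <= c * hnorm x.
  by rewrite -(@ler_pXn2r _ 2)// ?nnegrE ?mulr_ge0 ?hnorm_ge0//; case: (gP x).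
have [T TE] := mkbop gl c0 gb.
by exists T; split=> x *; rewrite TE//; case: (gP x).
Qed.

(** Total in t, but specified by [diag_opE] only for uniformly bounded families. For a constant
    family it is the amplification of one operator to l2(I, E). *)
Definition diag_op (t : I -> bop E) : bop (l2 I E) :=
  get [set T : bop (l2 I E) | forall f i, T f i = t i (f i)].

Definition unif_bounded (t : I -> bop E) : Prop :=
  exists2 c : R, 0 <= c & forall i x, hnorm (t i x) <= c * hnorm x.

Lemma diag_op_exists (t : I -> bop E) (c : R) : 0 <= c -> (forall i x, hnorm (t i x) <= c * hnorm x) ->
  exists T : bop (l2 I E), (forall (x : l2 I E) i, T x i = t i (x i)) /\
    forall x : l2 I E, hnorm (T x) <= c * hnorm x.
Proof.
move=> c0 tc; apply: (mkbop_l2 (f := fun x i => t i (x i))) => //.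
  by move=> a x y i; rewrite l2DE l2ZE linearP.
move=> x; apply/esum_fset_le => [i|A]; first by rewrite sqr_ge0.
apply: (@le_trans _ _ (\sum_(i <- A) (c ^+ 2 * hnorm (x i) ^+ 2))).
  apply: ler_sum => i _; rewrite -exprMn ler_pXn2r ?nnegrE ?mulr_ge0 ?hnorm_ge0//.
by rewrite -mulr_sumr exprMn ler_wpM2l ?sqr_ge0// le_hnorm_l2.
Qed.

Lemma diag_opE (t : I -> bop E) : unif_bounded t -> forall f i, diag_op t f i = t i (f i).
Proof.
move=> [c c0 tc]; have [T [TE _]] := diag_op_exists c0 tc.
exact: (@getPex _ [set T : bop (l2 I E) | forall f i, T f i = t i (f i)]
  (ex_intro _ T TE)).
Qed.

Lemma diag_op_le (t : I -> bop E) (c : R) : 0 <= c -> (forall i x, hnorm (t i x) <= c * hnorm x) ->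
  forall f, hnorm (diag_op t f) <= c * hnorm f.
Proof.
move=> c0 tc f; have [T [TE Tc]] := diag_op_exists c0 tc.
rewrite (_ : diag_op t f = T f)//; apply: l2_ext => i.
by rewrite TE diag_opE//; exists c.
Qed.

Lemma unif_bounded_cst (T : bop E) : unif_bounded (fun=> T).
Proof. by have [c c0 Tc] := bop_bound T; exists c. Qed.

End L2Theory.

(** * Density theorem for diagonal representations *)

Section Density.
Variables (R : realType) (E : hilbertType R) (I : choiceType).
Variable AA : set (I -> bop E).
Hypotheses (AA1 : AA (fun=> bop_id))
  (AAD : forall r s, AA r -> AA s -> AA (fun i => r i + s i))
  (AAZ : forall (a : Cx R) r, AA r -> AA (fun i => a *: r i))
  (AAM : forall r s, AA r -> AA s -> AA (fun i => bop_comp (r i) (s i)))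
  (AAadj : forall r, AA r -> AA (fun i => adj (r i)))
  (AAb : forall r, AA r -> unif_bounded r).

(** The double commutant argument for the representation of AA on l2(I, E) by diagonal operators.
    The projection P onto the closure of the orbit of v commutes with AA, so its matrix entries
    intertwine the components of AA; the hypothesis on t says that t respects such entries, hence P
    commutes with the diagonal operator of t and fixes its value at v. *)
Lemma diag_density (t : I -> bop E) : unif_bounded t ->
  (forall i j (c : bop E), (forall r, AA r -> forall x, c (r j x) = r i (c x)) ->
     forall x, c (t j x) = t i (c x)) ->
  forall (v : l2 I E) (e : R), 0 < e ->
    exists2 r, AA r & hnorm (diag_op t v - diag_op r v) <= e.
Proof.
move=> tb tc v e e0.
pose C := [set diag_op r v | r in AA].
have CS : cx_subspace C.
  have AA0 : AA (fun=> 0 *: bop_id) by exact: AAZ.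
  split.
  - exists (fun=> 0 *: bop_id) => //; apply: l2_ext => i.
    by rewrite diag_opE; [rewrite bopZE scale0r|exact: AAb].
  - move=> _ _ [r Ar <-] [s As <-]; have Ars := AAD Ar As.
    exists (fun i => r i + s i) => //; apply: l2_ext => i.
    by rewrite l2DE !diag_opE//; exact: AAb.
  - move=> a _ [r Ar <-]; have Aar := AAZ a Ar.
    exists (fun i => a *: r i) => //; apply: l2_ext => i.
    by rewrite l2ZE !diag_opE//; exact: AAb.
have rC r : AA r -> forall w, hcl C w -> hcl C (diag_op r w).
  move=> Ar w Cw d d0; have [k k0 rk] := bop_bound (diag_op r).
  have k1 : 0 < k + 1 by rewrite ltr_wpDl.
  have [_ [s As <-] ws] := Cw _ (divr_gt0 d0 k1).
  exists (diag_op r (diag_op s v)).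
    exists (fun i => bop_comp (r i) (s i)); first exact: AAM.
    apply: l2_ext => i; rewrite !diag_opE//; try exact: AAb.
    by apply: AAb; exact: AAM.
  rewrite -linearB (le_trans (rk _))// (le_trans (ler_wpM2l k0 ws))//.
  by rewrite mulrCA ler_piMr ?(ltW d0)// ler_pdivrMr// mul1r lerDl.
have [P [P1 P2]] := projection CS.
have Padj r : AA r -> forall x y, ip (diag_op r x) y = ip x (diag_op (fun i => adj (r i)) y).
  move=> Ar x y; rewrite !ip_l2E; congr sum; apply/funext => i.
  by rewrite !diag_opE ?adjP//; [apply: AAb; exact: AAadj|exact: AAb].
have Pr r w : AA r -> P (diag_op r w) = diag_op r (P w).
  move=> Ar; apply: (proj_uniq CS P1 P2); first exact: rC.
  move=> c Cc; have -> : diag_op r w - diag_op r (P w) = diag_op r (w - P w) by rewrite linearB.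
  by rewrite (Padj r Ar); exact: (P2 _ _ (rC _ (AAadj Ar) _ Cc)).
have PT : bop_comp P (diag_op t) = bop_comp (diag_op t) P.
  apply: bop_l2_ext => j y; rewrite !bop_compE; apply: l2_ext => i.
  have dE r x : unif_bounded r -> diag_op r (delta j x) = delta j (r j x).
    move=> rb; apply: l2_ext => k; rewrite diag_opE// !deltaE.
    by case: eqP => [->//|_]; rewrite linear0.
  have [k k0 Pk] := bop_bound P.
  (* c is the (i, j) entry of P. *)
  have [|//|x|c cE] := @mkbop R E (fun x => P (delta j x) i) k.
  - by move=> a x z; rewrite !linearP.
  - by rewrite (le_trans (l2_coord _ _))// (le_trans (Pk _))// hnorm_delta.
  rewrite dE// diag_opE// -!cE; apply: tc => r Ar x.
  by rewrite !cE -dE; [rewrite Pr// diag_opE//|]; exact: AAb.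
have Cv : hcl C v.
  apply: sub_hcl; exists (fun=> bop_id) => //; apply: l2_ext => i.
  by rewrite diag_opE//; exact: AAb.
have Pv : P v = v by apply: (proj_uniq CS P1 P2) => // c _; rewrite subrr ip0l.
have : hcl C (diag_op t v).
  have := congr1 (fun T : bop _ => T v) PT; rewrite !bop_compE Pv => <-; exact: P1.
by move=> /(_ _ e0)[_ [r Ar <-] h]; exists r.
Qed.

End Density.

(** * Spatial implementation of automorphisms *)

Section Automorphisms.
Variables (R : realType) (E : hilbertType R) (M : set (bop E)).
Variable alpha : bop E -> bop E.
Hypotheses (MvN : von_neumann M) (Maut : star_automorphism M alpha).
Implicit Types (a b c S T : bop E) (x y : E).

Lemma opos_antisym S T : opos (S - T) -> opos (T - S) -> S = T.
Proof.
move=> ST [_ TS]; apply: bop_ext => x; apply/subr0_eq/hnorm_eq0/eqP.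
have ST0 : rip ((S - T) x) x = 0.
  apply/eqP; rewrite eq_le; case: (ST) => _ /(_ x) ->; rewrite andbT.
  by have := TS x; rewrite -opprB bopNE ripNl oppr_ge0.
have := opos_CS x ((S - T) x) ST; rewrite ST0 mul0r bopBE ripxx => h.
have : hnorm (S x - T x) ^+ 2 ^+ 2 == 0 by rewrite eq_le h sqr_ge0.
by rewrite !sqrf_eq0.
Qed.

Lemma aut_in a : M a -> M (alpha a).
Proof. by case: Maut => -[h _ _] _ _ _ => /h. Qed.

Lemma aut_surj b : M b -> exists2 a, M a & alpha a = b.
Proof. by case: Maut => -[_ _ h] _ _ _ => /h. Qed.

Lemma aut_inj a b : M a -> M b -> alpha a = alpha b -> a = b.
Proof. by case: Maut => -[_ h _] _ _ _ Ma Mb; apply: h; exact: mem_set. Qed.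

Lemma autP (k : Cx R) a b : M a -> M b -> alpha (k *: a + b) = k *: alpha a + alpha b.
Proof. by case: Maut => _ h _ _; exact: h. Qed.

Lemma autD a b : M a -> M b -> alpha (a + b) = alpha a + alpha b.
Proof. by move=> Ma Mb; have := autP 1 Ma Mb; rewrite !scale1r. Qed.

Lemma aut0 : alpha 0 = 0.
Proof.
have M0 := vN0 MvN; apply: (addrI (alpha 0)).
by rewrite -autD// !addr0.
Qed.

Lemma autZ (k : Cx R) a : M a -> alpha (k *: a) = k *: alpha a.
Proof. by move=> Ma; have := autP k Ma (vN0 MvN); rewrite aut0 !addr0. Qed.

Lemma autN a : M a -> alpha (- a) = - alpha a.
Proof. by move=> Ma; rewrite -scaleN1r autZ// scaleN1r. Qed.

Lemma autB a b : M a -> M b -> alpha (a - b) = alpha a - alpha b.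
Proof. by move=> Ma Mb; rewrite autD ?autN//; exact: vNN. Qed.

Lemma autM a b : M a -> M b -> alpha (bop_comp a b) = bop_comp (alpha a) (alpha b).
Proof. by case: Maut => _ _ h _; exact: h. Qed.

Lemma aut_adj a : M a -> alpha (adj a) = adj (alpha a).
Proof.
case: Maut => _ _ _ h Ma; apply: adj_uniq; apply: h => //; first exact: vN_adj.
exact: adjP.
Qed.

Lemma aut1 : alpha bop_id = bop_id.
Proof.
have [e Me ae] := aut_surj (vN1 MvN); have M1 := vN1 MvN.
by rewrite -[LHS]bop_comp1r -[X in bop_comp _ X]ae -autM// bop_comp1l.
Qed.

Lemma sa_adj a : sa a <-> adj a = a.
Proof. by split=> [/adj_uniq <-|h x y]//; rewrite adjP h. Qed.

Lemma aut_sa a : M a -> sa a <-> sa (alpha a).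
Proof.
move=> Ma; rewrite !sa_adj -aut_adj//; split=> [->//|].
by apply: aut_inj => //; exact: vN_adj.
Qed.

Lemma opos_scale (k : R) a : 0 <= k -> opos a -> opos ((k%:C%C : Cx R) *: a).
Proof.
move=> k0 [as_ a0]; split=> [x y|x].
  by rewrite !bopZE ipZl ipZr conjRC as_.
by rewrite bopZE ripZl mulr_ge0.
Qed.

(** For t > 0 the resolvent of a / t lies in M, and its image divided by t inverts alpha(a) + t, so
    [opos_inv] applies. *)
Lemma aut_opos a : M a -> opos a -> opos (alpha a).
Proof.
move=> Ma ap; apply: opos_inv; first by apply/(aut_sa Ma); case: ap.
move=> t t0; have ti : 0 <= t^-1 by rewrite invr_ge0 ltW.
have hp := opos_scale ti ap; have [c cr] := res_exists hp.
have Mh := vNZ MvN (t^-1)%:C%C Ma; have Mc := vN_res MvN Mh cr.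
have E1 : bop_comp c (bop_id + ((t^-1)%:C%C : Cx R) *: a) = bop_id.
  by apply: bop_ext => x; rewrite bop_compE bopDE (proj2 cr).
have M1 := vN1 MvN.
have := congr1 alpha E1; rewrite autM ?autD ?autZ ?aut1//; last exact: vND.
move=> E2; exists (((t^-1)%:C%C : Cx R) *: alpha c) => x.
rewrite -[RHS](_ : (bop_comp (alpha c) (bop_id + ((t^-1)%:C%C : Cx R) *: alpha a)) x = x).
  rewrite bop_compE bopZE bopDE bopZE bop_idE -linearZ/= scalerDr scalerA.
  by rewrite -rmorphM/= mulVf ?gt_eqF// scale1r addrC.
by rewrite E2.
Qed.

Lemma aut_opos_inv a : M a -> opos (alpha a) -> opos a.
Proof.
move=> Ma ap; apply: opos_inv; first by apply/(aut_sa Ma); case: ap.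
move=> t t0; have ti : 0 <= t^-1 by rewrite invr_ge0 ltW.
have hp := opos_scale ti ap; have [c' cr] := res_exists hp.
have Mh := vNZ MvN (t^-1)%:C%C (aut_in Ma); have Mc' := vN_res MvN Mh cr.
have [c Mc ac] := aut_surj Mc'.
have E1 : bop_comp c' (bop_id + ((t^-1)%:C%C : Cx R) *: alpha a) = bop_id.
  by apply: bop_ext => x; rewrite bop_compE bopDE (proj2 cr).
have M1 := vN1 MvN; have Ma' := vNZ MvN (t^-1)%:C%C Ma; have MD := vND MvN M1 Ma'.
have E2 : bop_comp c (bop_id + ((t^-1)%:C%C : Cx R) *: a) = bop_id.
  apply: aut_inj => //; first exact: vNM.
  by rewrite autM ?autD ?autZ ?aut1// ac.
exists (((t^-1)%:C%C : Cx R) *: c) => x.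
rewrite -[RHS](_ : (bop_comp c (bop_id + ((t^-1)%:C%C : Cx R) *: a)) x = x).
  rewrite bop_compE bopZE bopDE bopZE bop_idE -linearZ/= scalerDr scalerA.
  by rewrite -rmorphM/= mulVf ?gt_eqF// scale1r addrC.
by rewrite E2.
Qed.

(** Positivity of k^2 - a^* a is transported by alpha. For k < 0 the space is zero. *)
Lemma aut_contr a (k : R) : M a -> (forall x, hnorm (a x) <= k * hnorm x) ->
  forall x, hnorm (alpha a x) <= k * hnorm x.
Proof.
move=> Ma ak x.
have [k0|k0] := leP 0 k; last first.
  have E0 y : y = 0.
    apply: hnorm_eq0; apply/eqP; rewrite eq_le hnorm_ge0 andbT.
    by rewrite -(nmulr_rge0 _ k0) (le_trans (hnorm_ge0 (a y))).
  by rewrite (E0 (alpha a x)) (E0 x) hnorm0 mulr0.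
have M1 := vN1 MvN.
pose d := (((k ^+ 2)%:C%C : Cx R) *: bop_id) - bop_comp (adj a) a.
have Md : M d by apply: vNB => //; [exact: vNZ|apply: vNM => //; exact: vN_adj].
have dp : opos d.
  split=> [y z|y].
    rewrite !bopBE !bopZE ipBl ipBr ipZl ipZr conjRC; congr (_ - _).
    exact: (sa_adjMl a).
  rewrite bopBE bopZE ripBl ripZl bop_idE ripxx bop_compE ripC /rip -adjP -/(rip _ _).
  rewrite ripxx subr_ge0 -exprMn ler_pXn2r ?nnegrE ?mulr_ge0 ?hnorm_ge0//.
have [_ /(_ x)] := aut_opos Md dp.
have Maa : M (bop_comp (adj a) a) by apply: vNM => //; exact: vN_adj.
rewrite autB ?autZ ?aut1 ?autM ?aut_adj//; [|exact: vN_adj|exact: vNZ].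
rewrite bopBE bopZE ripBl ripZl bop_idE ripxx bop_compE ripC /rip -adjP -/(rip _ _).
rewrite ripxx subr_ge0 -exprMn ler_pXn2r ?nnegrE ?mulr_ge0 ?hnorm_ge0//.
Qed.

End Automorphisms.

(** * Continuity of automorphisms along summable sequences *)

Section Normality.
Variables (R : realType) (E : hilbertType R) (M : set (bop E)).
Variable alpha : bop E -> bop E.
Hypotheses (MvN : von_neumann M) (Maut : star_automorphism M alpha).
Variables (xi : nat -> E).
Hypothesis xi_total : forall s : bop E, (forall n, s (xi n) = 0) -> s = 0.
Implicit Types (a c S T : bop E) (x y : E).

(* The sums of the [b k] may diverge, so they are replaced by the bounded
   monotone quantities [1 - (1 + sum b k)^-1], which dominate [b k] up to a factor 2. *)
Lemma aut_vanish (b : nat -> bop E) : (forall k, M (b k)) -> (forall k, opos (b k)) ->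
  (forall k, opos (bop_id - b k)) ->
  (forall n, exists C : R, forall L, \sum_(k < L) rip (b k (xi n)) (xi n) <= C) ->
  forall x, rip (alpha (b k) x) x @[k --> \oo] --> (0 : R).
Proof.
move=> Mb b0 b1 bsum.
pose h K L : bop E := \sum_(K <= k < L) b k.
have hp K L : opos (h K L).
  by rewrite /h; elim/big_ind: _ => //; [exact: opos0|exact: oposD].
have Mh K L : M (h K L) by apply: vN_sum.
have /choice[c cP] (p : nat * nat) : exists c, is_res (h p.1 p.2) c by exact: res_exists.
pose r K L := bop_id - c (K, L).
have cr K L : is_res (h K L) (c (K, L)) by exact: (cP (K, L)).
have r0 K L : opos (r K L) := res_le1 (hp K L) (cr K L).
have r1 K L : opos (bop_id - r K L).
  by rewrite subKr; exact: res_opos (hp K L) (cr K L).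
have Mc K L : M (c (K, L)) := vN_res MvN (Mh K L) (cr K L).
have Mr K L : M (r K L) by apply: vNB => //; exact: vN1.
have rmono K K' L L' : opos (h K L - h K' L') -> opos (r K L - r K' L').
  move=> hh; have -> : bop_id - c (K, L) - (bop_id - c (K', L')) = c (K', L') - c (K, L).
    by rewrite opprB [LHS]addrC addrA subrK.
  exact: (res_anti (hp K' L') (hp K L) (cr K' L') (cr K L) hh).
have hcat K L L' : (L <= L')%N -> opos (h K L' - h K L).
  move=> LL; have [KL|/ltnW LK] := leqP K L.
    by rewrite /h (big_cat_nat (n := L))//= addrAC subrr add0r; exact: hp.
  by rewrite /h [X in _ - X]big_geq// subr0; exact: hp.
have hcatl K K' L : (K <= K')%N -> opos (h K L - h K' L).
  move=> KK; have [KL|/ltnW LK] := leqP K' L.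
    by rewrite /h (big_cat_nat (n := K'))//= addrK; exact: hp.
  by rewrite /h [X in _ - X]big_geq// subr0; exact: hp.
have /choice[s sP] K : exists s : bop E, [/\ forall x, hlim (fun n => r K n x) (s x),
    opos s, opos (bop_id - s) & forall n, opos (s - r K n)].
  by apply: mono_limit => // m n mn; apply: rmono; exact: hcat.
have Ms K : M (s K) by case: (sP K) => h1 _ _ _; exact: (vN_lim MvN (Mr K) h1).
have sle K (t : bop E) : sa t -> (forall L, opos (t - r K L)) -> opos (t - s K).
  move=> ts tr; have [sl [ss _] _ _] := sP K; split=> [|x]; first exact: saB.
  rewrite bopBE ripBl subr_ge0; apply: (cvgr_to_le (hlim_rip (y := x) (sl x))).
  by apply: nearW => L; have [_ /(_ x)] := tr L; rewrite bopBE ripBl subr_ge0.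
have smono K K' : (K <= K')%N -> opos (s K - s K').
  move=> KK; apply: sle => [|L]; first by case: (sP K) => _ [].
  apply: opos_trans (_ : opos (r K L - r K' L)) _; first by apply: rmono; exact: hcatl.
  by case: (sP K).
pose d K := bop_id - s K.
have [d0 d1] : (forall K, opos (d K)) /\ (forall K, opos (bop_id - d K)).
  by split=> K; case: (sP K) => _ h0 h1 _ //; rewrite subKr.
have dmono m n : (m <= n)%N -> opos (d n - d m).
  move=> mn; rewrite /d opprB addrC addrA subrK; exact: smono.
have Md K : M (d K) by apply: vNB => //; exact: vN1.
have [t [tl tp t1 tge]] := mono_limit d0 d1 dmono.
(* At each [xi n] the form of s K is at most the K-th tail of a convergent series, so 1 - t vanishes
   on a total sequence. *)
have t_id : t = bop_id.
  apply/eqP; rewrite -subr_eq0; apply/eqP/xi_total => n.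
  have [C bC] := bsum n; pose q k := rip (b k (xi n)) (xi n).
  pose Sq L := \sum_(k < L) q k.
  have q0 k : 0 <= q k by case: (b0 k) => _; apply.
  have Sm : nondecreasing_seq Sq.
    apply/nondecreasing_seqP => L; by rewrite /Sq big_ord_recr/= lerDl.
  have Sb : has_ubound (range Sq) by exists C => _ [L _ <-]; exact: bC.
  have Scv := nondecreasing_is_cvgn Sm Sb.
  have sbound K : rip (s K (xi n)) (xi n) <= lim (Sq @ \oo) - Sq K.
    have [sl _ _ _] := sP K.
    apply: (cvgr_to_le (hlim_rip (y := xi n) (sl (xi n)))).
    exists K => // L /= KL.
    apply: (@le_trans _ _ (rip (h K L (xi n)) (xi n))).
      have [_ /(_ (xi n))] := res_compl_le (hp K L) (cr K L).
      by rewrite bopBE ripBl subr_ge0.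
    rewrite /h bop_sumE rip_suml lerBrDr.
    apply: (@le_trans _ _ (Sq L)); last exact: nondecreasing_cvgn_le.
    by rewrite addrC /Sq -!(big_mkord xpredT q) [leRHS](big_cat_nat (n := K)).
  have : rip (t (xi n)) (xi n) = hnorm (xi n) ^+ 2.
    apply: (cvgR_uniq (hlim_rip (y := xi n) (tl (xi n)))).
    apply: (cvg_dist0 (g := fun K => lim (Sq @ \oo) - Sq K)).
      move=> K; rewrite /d bopBE bop_idE ripBl ripxx addrAC subrr add0r normrN.
      by rewrite ger0_norm ?sbound//; case: (sP K) => _ [].
    by have := cvgB (cvg_cst (lim (Sq @ \oo))) Scv; rewrite subrr; apply.
  have -> : rip (t (xi n)) (xi n) = hnorm (xi n) ^+ 2 - rip ((bop_id - t) (xi n)) (xi n).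
    by rewrite bopBE bop_idE ripBl ripxx subKr.
  move=> h0; have := ocontr_norm (xi n) t1; rewrite subKr => /(_ tp).
  rewrite (_ : rip _ _ = 0); last by apply: oppr_inj; rewrite oppr0; move: h0; lra.
  move=> h2; apply: hnorm_eq0; apply/eqP; rewrite -sqrf_eq0 eq_le sqr_ge0 andbT.
  by rewrite -opprB bopNE hnormN.
have M1 := vN1 MvN.
have [|||u [ul up u1 uge]] := @mono_limit R E (fun K => alpha (d K)).
- by move=> K; exact: (aut_opos MvN Maut (Md K) (d0 K)).
- move=> K; rewrite -(aut1 MvN Maut) -(autB MvN Maut M1 (Md K)).
  exact: (aut_opos MvN Maut (vNB MvN M1 (Md K)) (d1 K)).
- move=> m n mn; rewrite -(autB MvN Maut (Md n) (Md m)).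
  exact: (aut_opos MvN Maut (vNB MvN (Md n) (Md m)) (dmono m n mn)).
have Mu : M u := vN_lim MvN (fun K => aut_in Maut (Md K)) ul.
(* An order isomorphism preserves suprema: the supremum u of the alpha (d K) lies in M, its preimage
   u' dominates every d K, hence their supremum 1, and therefore u = 1. *)
have [u' Mu' u'E] := aut_surj Maut Mu.
have u'_id : u' = bop_id.
  apply: opos_antisym.
    rewrite -t_id; split=> [|x].
      by apply: saB; [apply/(aut_sa MvN Maut Mu'); rewrite u'E; case: up|case: tp].
    rewrite bopBE ripBl subr_ge0; apply: (cvgr_to_le (hlim_rip (y := x) (tl x))).
    apply: nearW => K; have : opos (u' - d K).
      apply: (aut_opos_inv MvN Maut); first exact: (vNB MvN Mu' (Md K)).
      by rewrite (autB MvN Maut Mu' (Md K)) u'E; exact: uge.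
    by case=> _ /(_ x); rewrite bopBE ripBl subr_ge0.
  apply: (aut_opos_inv MvN Maut); first exact: (vNB MvN M1 Mu').
  by rewrite (autB MvN Maut M1 Mu') (aut1 MvN Maut) u'E.
have {u'_id u'E}u_id : u = bop_id by rewrite -u'E u'_id (aut1 MvN Maut).
move=> x; have lim0 : 2 * (hnorm x ^+ 2 - rip (alpha (d k) x) x) @[k --> \oo] --> (0 : R).
  apply: cvg0M; rewrite -[X in _ --> X](subrr (hnorm x ^+ 2)); apply: cvgB.
    exact: cvg_cst.
  by have := hlim_rip (y := x) (ul x); rewrite u_id bop_idE ripxx; apply.
apply: (squeeze_cvgr _ (cvg_cst 0) lim0); apply: nearW => k; apply/andP; split.
  by have [_] := aut_opos MvN Maut (Mb k) (b0 k); apply.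
have bk2 : opos (s k + s k - b k).
  have h1 : h k k.+1 = b k by rewrite /h big_nat1.
  have := res_compl_ge (hp k k.+1) (cr k k.+1); rewrite h1 => /(_ (b1 k)) h2.
  have [_ _ _ /(_ k.+1) h3] := sP k.
  apply: opos_trans h2 _; rewrite opprD addrACA; exact: oposD.
have Mss : M (s k + s k) := vND MvN (Ms k) (Ms k).
have := aut_opos MvN Maut (vNB MvN Mss (Mb k)) bk2.
rewrite (autB MvN Maut Mss (Mb k)) (autD Maut (Ms k) (Ms k)) => -[_ /(_ x)]; rewrite bopBE bopDE ripBl ripDl.
rewrite /d (autB MvN Maut M1 (Ms k)) (aut1 MvN Maut) bopBE bop_idE ripBl ripxx; lra.
Qed.

End Normality.

Section L2Constructions.
Variables (R : realType) (E : hilbertType R).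

Lemma esum_nat_le (a : nat -> R) (c : R) : (forall n, 0 <= a n) ->
  (forall N, \sum_(n < N) a n <= c) ->
  (\esum_(n in [set: nat]) (a n)%:E <= c%:E)%E.
Proof.
move=> a0 ac; rewrite -nneseries_esumT; last by move=> n; rewrite lee_fin.
apply: lime_le; first by apply: is_cvg_nneseries => n _ _; rewrite lee_fin.
by apply: nearW => N; rewrite sumEFin lee_fin big_mkord.
Qed.

Lemma geometric_le2 N : \sum_(n < N) (2^-1 ^+ n : R) <= 2.
Proof.
suff -> : \sum_(n < N) (2^-1 ^+ n : R) = 2 - 2 * 2^-1 ^+ N.
  by rewrite gerBl mulr_ge0// exprn_ge0// invr_ge0.
elim: N => [|N IHN]; first by rewrite big_ord0 expr0 mulr1 subrr.
by rewrite big_ord_recr/= IHN exprS; field.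
Qed.

(** Finitely many vectors become one, so a single use of the density theorem approximates on all of
    them simultaneously. *)
Lemma l2_stack (I : choiceType) (K : finType) (w : K -> l2 I E) :
  exists v : l2 (I * K)%type E, (forall i k, v (i, k) = w k i) /\
    hnorm v ^+ 2 = \sum_k hnorm (w k) ^+ 2.
Proof.
have a0 (p : I * K) : (0 <= (hnorm (w p.2 p.1) ^+ 2)%:E)%E by rewrite lee_fin sqr_ge0.
have sE : (\esum_(p in [set: I * K]) (hnorm (w p.2 p.1) ^+ 2)%:E =
    (\sum_k hnorm (w k) ^+ 2)%:E)%E.
  transitivity (\esum_(i in [set: I]) \esum_(k in [set: K]) (hnorm (w k i) ^+ 2)%:E)%E.
    rewrite esum_esum; last by move=> i k _ _; rewrite lee_fin sqr_ge0.
    by congr esum; apply/seteqP; split.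
  transitivity (\esum_(i in [set: I]) \sum_k (hnorm (w k i) ^+ 2)%:E)%E.
    have fK : finite_set [set: K] by exact: finite_finset.
    apply: eq_esum => i _; rewrite (esum_fset fK); last first.
      by move=> k _; rewrite lee_fin sqr_ge0.
    have -> : [set: K] = [set` enum K].
      by apply/seteqP; split=> // k _ /=; rewrite mem_enum.
    by rewrite -fsbig_seq ?enum_uniq// big_enum.
  rewrite esum_sum; last by move=> i k _ _; rewrite lee_fin sqr_ge0.
  by rewrite -sumEFin; apply: eq_bigr => k _; rewrite esum_l2.
have [|v [vE _]] := @mkl2 R E (I * K)%type (fun p => w p.2 p.1) (\sum_k hnorm (w k) ^+ 2).
  by rewrite sE.
exists v; split=> [i k|]; first by rewrite vE.
apply: EFin_inj; rewrite -sE -esum_l2; apply: eq_esum => p _.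
by rewrite vE.
Qed.

Lemma l2_map (F : hilbertType R) (I : choiceType) (f : I -> E -> F) :
  (forall i z, hnorm (f i z) = hnorm z) ->
  forall x : l2 I E, exists y : l2 I F, forall i, y i = f i (x i).
Proof.
move=> fn x; have [|y [yE _]] := @mkl2 R F I (fun i => f i (x i)) (hnorm x ^+ 2).
  by rewrite -esum_l2; apply: le_esum => i _; rewrite fn.
by exists y.
Qed.

Lemma dense_sequence : (exists2 D : set E, countable D & dense D) ->
  exists d : nat -> E, forall x (e : R), 0 < e -> exists n, hnorm (x - d n) <= e.
Proof.
move=> [D /countable_injP[f fi] Dd].
(* Indices not attained by f on D take the default value 0, which does no harm to density. *)
exists (fun n => xget 0 [set x | D x /\ f x = n]) => x e e0.
have e0C : 0 < (e%:C%C : Cx R) by rewrite ltr_RC.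
have [||y [Oy Dy]] := Dd (interior (ball x (e%:C%C : Cx R))); last 1 first.
- exists (f y); case: xgetP => [z _ [Dz fz]|/(_ y)]; last by case.
  have -> : z = y := fi z y (mem_set Dz) (mem_set Dy) fz.
  have := interior_subset Oy; rewrite -ball_normE /= normE ltr_RC; exact: ltW.
- exists x; exact: nbhsx_ballx.
- exact: open_interior.
Qed.

(** A dense sequence is rescaled to be square-summable, so that all of it fits into one vector of
    l2(nat, E) to which the density theorem applies. *)
Lemma total_sequence : (exists2 D : set E, countable D & dense D) ->
  exists xi : nat -> E, (forall n, hnorm (xi n) ^+ 2 <= 2^-1 ^+ n) /\
    forall s : bop E, (forall n, s (xi n) = 0) -> s = 0.
Proof.
move=> /dense_sequence[d dd].
pose k n : R := 2^-1 ^+ n / (1 + hnorm (d n)).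
have d1 n : 0 < 1 + hnorm (d n) by rewrite ltr_wpDr ?hnorm_ge0.
have p0 n : 0 < (2^-1 ^+ n : R) by rewrite exprn_gt0// invr_gt0.
have k0 n : 0 < k n by rewrite divr_gt0.
exists (fun n => ((k n)%:C%C : Cx R) *: d n); split=> [n|s sk].
  have h1 : hnorm (((k n)%:C%C : Cx R) *: d n) <= 2^-1 ^+ n.
    rewrite hnormZR gtr0_norm// /k -mulrA ler_piMr ?(ltW (p0 n))//.
    by rewrite mulrC ler_pdivrMr// mul1r lerDr.
  apply: (@le_trans _ _ ((2^-1 ^+ n) ^+ 2)).
    by rewrite ler_pXn2r ?nnegrE ?hnorm_ge0// ltW.
  by rewrite expr2 ler_piMr ?(ltW (p0 n))// exprn_ile1 ?invr_ge0 ?invf_le1 ?ler1n.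
have sd n : s (d n) = 0.
  have := sk n; rewrite linearZ/= => /eqP; rewrite scaler_eq0 => /orP[|/eqP//].
  by move=> /eqP[] h; move: (k0 n); rewrite h ltxx.
apply: bop_ext => x; apply: hnorm_eq0; apply/eqP; rewrite eq_le hnorm_ge0 andbT.
have [c c0 sc] := bop_bound s.
apply/ler_addgt0Pr => e e0; rewrite add0r.
have c1 : 0 < c + 1 by rewrite ltr_wpDl.
have [n hn] := dd x _ (divr_gt0 e0 c1).
rewrite -[s x]subr0 -(sd n) -linearB (le_trans (sc _))//.
rewrite (le_trans (ler_wpM2l c0 hn))//.
by rewrite mulrCA ler_piMr ?(ltW e0)// ler_pdivrMr// mul1r lerDl.
Qed.

End L2Constructions.

(** * Intertwiners of an automorphism with the identity representation *)

Section Intertwiners.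
Variables (R : realType) (E : hilbertType R) (M : set (bop E)).
Variable alpha : bop E -> bop E.
Hypotheses (MvN : von_neumann M) (Maut : star_automorphism M alpha).
Variables (xi : nat -> E).
Hypothesis xi_small : forall n, hnorm (xi n) ^+ 2 <= 2^-1 ^+ n.
Hypothesis xi_total : forall s : bop E, (forall n, s (xi n) = 0) -> s = 0.
Implicit Types (a c S T : bop E) (x y : E).

Definition intertwines c : Prop :=
  forall a, M a -> forall x, c (alpha a x) = a (c x).

Let Z : set E := [set x | forall c, intertwines c -> c x = 0].

Let Zcx : cx_subspace Z.
Proof.
split=> [c _|x y Zx Zy c cJ|k x Zx c cJ]; first exact: linear0.
  by rewrite linearD/= Zx// Zy// addr0.
by rewrite linearZ/= Zx// scaler0.
Qed.

Let hcl_Z (F : hilbertType R) (T : {linear F -> E}) (C : set F) (k : R) : 0 <= k ->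
  (forall v, hnorm (T v) <= k * hnorm v) -> (forall v, C v -> Z (T v)) ->
  forall v, hcl C v -> Z (T v).
Proof.
move=> k0 Tk TC v Cv c cJ; have [m m0 cm] := bop_bound c.
apply: hnorm_eq0; apply/eqP; rewrite eq_le hnorm_ge0 andbT.
apply: (hcl_le (f := fun v => hnorm (c (T v))) (mulr_ge0 m0 k0) _ _ Cv) => [u w|u Cu] /=.
  rewrite -lerBlDl (le_trans (ler_norm _))// (le_trans (hnorm_dist _ _))//.
  by rewrite -!linearB (le_trans (cm _))// -mulrA ler_wpM2l.
by rewrite TC// hnorm0.
Qed.

Let Zcl : hcl Z `<=` Z.
Proof.
apply: (hcl_Z (T := GRing.Linear.clone _ _ _ _ idfun _) ler01) => v //.
by rewrite mul1r.
Qed.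

Let aut_Z a x : M a -> Z x -> Z (alpha a x).
Proof. by move=> Ma Zx c cJ; rewrite cJ// Zx// linear0. Qed.

(* [nat] indexes one copy of E (index 0) on which M acts through [alpha] and
   infinitely many copies on which it acts identically. *)
Let rho a (n : nat) : bop E := if n is _.+1 then a else alpha a.

Let rho_bdd a : unif_bounded (rho a).
Proof.
have [k k0 ak] := bop_bound a; have [m m0 am] := bop_bound (alpha a).
exists (k + m) => [|n x]; first exact: addr_ge0.
by case: n => [|n] /=; [apply: le_trans (am x) _|apply: le_trans (ak x) _];
  rewrite ler_wpM2r ?hnorm_ge0// (lerDl, lerDr).
Qed.

(* Otherwise self-adjoint elements of M converge to 0 on the [xi n] and to 1 at
   [x]; then 1 - (1 + a^2)^-1 contradicts [aut_vanish]. *)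
Let approx_eq0 x (w : l2 nat E) : (forall n, w n = if n is n'.+1 then xi n' else x) ->
  hcl [set diag_op (rho a) w | a in [set a | M a /\ sa a]] (delta 0%N x) -> x = 0.
Proof.
move=> wE Cx'.
have p0 n : 0 < (2^-1 ^+ n : R) by rewrite exprn_gt0// invr_gt0.
have /choice[a aP] (k : nat) : exists a, [/\ M a, sa a,
    hnorm (x - alpha a x) <= 2^-1 ^+ k & forall n, hnorm (a (xi n)) <= 2^-1 ^+ k].
  have [_ [a [Ma as_] <-] h] := Cx' _ (p0 k); exists a; split=> //.
    apply: le_trans h; have := l2_coord (delta 0%N x - diag_op (rho a) w) 0%N.
    by rewrite l2BE deltaE diag_opE// wE.
  move=> n; apply: le_trans h; have := l2_coord (delta 0%N x - diag_op (rho a) w) n.+1.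
  by rewrite l2BE deltaE diag_opE// wE sub0r hnormN.
pose a2 k := bop_comp (a k) (a k).
have a2p k : opos (a2 k).
  by have [_ /sa_adj as_ _ _] := aP k; rewrite /a2 -{1}as_; exact: opos_adjMl.
have Ma2 k : M (a2 k) by have [Ma _ _ _] := aP k; exact: (vNM MvN Ma Ma).
have /choice[G GP] k : exists c, is_res (a2 k) c by exact: res_exists.
have G0 k := res_opos (a2p k) (GP k); have G1 k := res_le1 (a2p k) (GP k).
have MG k : M (G k) := vN_res MvN (Ma2 k) (GP k).
have M1 := vN1 MvN.
have lim0 : rip (alpha (bop_id - G k) x) x @[k --> \oo] --> (0 : R).
  apply: (aut_vanish MvN Maut xi_total) => [k|//|k|n].
  - exact: vNB.
  - by rewrite subKr.
  - exists 2 => L; apply: le_trans (geometric_le2 R L).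
    apply: ler_sum => k _; have [_ /(_ (xi n))] := res_compl_le (a2p k) (GP k).
    rewrite bopBE ripBl subr_ge0 => /le_trans; apply.
    have [_ as_ _ an] := aP k; rewrite /a2 bop_compE /rip as_ -/(rip _ _) ripxx.
    apply: (@le_trans _ _ ((2^-1 ^+ k) ^+ 2)).
      by rewrite ler_pXn2r ?nnegrE ?hnorm_ge0// ltW.
    by rewrite expr2 ler_piMr ?(ltW (p0 k))// exprn_ile1 ?invr_ge0 ?invf_le1 ?ler1n.
(* y = (1 + b^2)^-1 x satisfies <x - y, x> = |x - y|^2 + |b y|^2, and the left side tends to 0. So y
   -> x and b y -> 0, whereas b x -> x; computing the limit of <x, b y> = <b x, y> in both ways
   gives |x|^2 = 0. *)
pose b k := alpha (a k); pose y k := alpha (G k) x.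
have bs k : sa (b k) by have [Ma as_ _ _] := aP k; exact: (proj1 (aut_sa MvN Maut Ma) as_).
have yE k : y k + b k (b k (y k)) = x.
  have [Ma as_ _ _] := aP k.
  have : bop_comp (bop_id + a2 k) (G k) = bop_id.
    by apply: bop_ext => z; rewrite bop_compE bopDE (proj1 (GP k)).
  move=> /(congr1 alpha); rewrite (autM Maut (vND MvN M1 (Ma2 k)) (MG k)).
  rewrite (autD Maut M1 (Ma2 k)) (aut1 MvN Maut) (autM Maut Ma Ma).
  by move=> /(congr1 (fun f : bop E => f x)); rewrite bop_compE bopDE bop_compE.
have limE : rip (x - y k) x @[k --> \oo] --> (0 : R).
  apply: cvg_trans lim0; apply: near_eq_cvg; apply: nearW => k.
  by rewrite (autB MvN Maut M1 (MG k)) (aut1 MvN Maut).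
have y_le k : hnorm (y k) <= hnorm x.
  have Gk z : hnorm (G k z) <= 1 * hnorm z by rewrite mul1r; exact: ocontr_contr.
  by have := aut_contr MvN Maut (MG k) Gk x; rewrite mul1r.
have sq_lim (f : nat -> E) (m : E) : hnorm (f k - m) ^+ 2 @[k --> \oo] --> (0 : R) ->
    hlim f m.
  move=> fm; apply/hlimP => e e0; have e2 : 0 < e ^+ 2 by rewrite exprn_gt0.
  move/cvgrPdist_le : fm => /(_ _ e2)[N _ hN]; exists N => n Nn.
  have := hN n Nn; rewrite /= sub0r normrN ger0_norm ?sqr_ge0// ler_pXn2r// nnegrE.
    exact: hnorm_ge0.
  exact: ltW.
have xyE k : rip (x - y k) (y k) = hnorm (b k (y k)) ^+ 2.
  by rewrite -{1}(yE k) addrAC subrr add0r sa_rip// ripxx.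
have xyE2 k : rip (x - y k) x = hnorm (x - y k) ^+ 2 + hnorm (b k (y k)) ^+ 2.
  by rewrite -xyE -{2}(subrK (y k) x) ripDr ripxx.
have y_lim : hlim y x.
  apply: sq_lim; apply: (squeeze_cvgr _ (cvg_cst 0) limE); apply: nearW => k.
  by rewrite sqr_ge0 hnormBC xyE2 lerDl sqr_ge0.
have by_lim : hlim (fun k => b k (y k)) 0.
  apply: sq_lim; apply: (squeeze_cvgr _ (cvg_cst 0) limE); apply: nearW => k.
  by rewrite sqr_ge0 subr0 xyE2 lerDr sqr_ge0.
have bx_lim : hlim (fun k => b k x) x.
  apply: (@hlim_squeeze _ _ _ _ (fun k => 2^-1 ^+ k)).
    by move=> k; rewrite hnormBC; case: (aP k).
  by apply: cvg_expr; rewrite ger0_norm ?invr_ge0// invf_lt1// ltr1n.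
have l1 : rip x (b k (y k)) @[k --> \oo] --> (0 : R).
  have := hlim_rip (y := x) by_lim; rewrite rip0l; apply: cvg_trans.
  by apply: near_eq_cvg; apply: nearW => k /=; rewrite ripC.
have l2 : rip x (b k (y k)) @[k --> \oo] --> rip x x.
  apply: (cvg_dist0 (g := fun k => hnorm x * hnorm (b k x - x) + hnorm x * hnorm (y k - x))).
    move=> k; rewrite -(sa_rip (bs k)).
    have -> : rip (b k x) (y k) - rip x x = rip (b k x - x) (y k) + rip x (y k - x).
      by rewrite ripBl ripBr addrA subrK.
    rewrite (le_trans (ler_normD _ _))// lerD//; last exact: rip_le.
    by rewrite (le_trans (rip_le _ _))// mulrC ler_wpM2r ?hnorm_ge0.
  have := cvgD (cvg0M (hnorm x) bx_lim) (cvg0M (hnorm x) y_lim); by rewrite addr0; apply.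
apply: hnorm_eq0; apply/eqP; rewrite -sqrf_eq0 -ripxx; apply/eqP.
exact: cvgR_uniq l2 l1.
Qed.

(** By [approx_eq0] it is enough that [delta 0 x] lies in the closure of the orbit of w = (x, xi 0,
    xi 1, ...) under self-adjoint elements. [diag_density] speaks of all of M rather than its
    self-adjoint part, so the difference p from the nearest point of that closure is tested with a
    functional that is complex-linear on M. *)
Lemma intertwiner_kernel x : (forall c, intertwines c -> c x = 0) -> x = 0.
Proof.
move=> Zx.
have [w [wE _]] : exists w : l2 nat E,
    (forall n, w n = if n is n'.+1 then xi n' else x) /\ hnorm w ^+ 2 <= hnorm x ^+ 2 + 2.
  apply: mkl2; apply: esum_nat_le => [n|[|N]]; first by rewrite sqr_ge0.
    by rewrite big_ord0 addr_ge0 ?sqr_ge0.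
  rewrite big_ord_recl lerD2l (le_trans _ (geometric_le2 R N))//.
  by apply: ler_sum => i _; exact: xi_small.
apply: (approx_eq0 wE).
have M1 := vN1 MvN; have M0 := vN0 MvN.
pose C : set (l2 nat E) := [set diag_op (rho a) w | a in [set a | M a /\ sa a]].
have rhoP (k : Cx R) a b v : M a -> M b ->
    diag_op (rho (k *: a + b)) v = k *: diag_op (rho a) v + diag_op (rho b) v.
  move=> Ma Mb; apply: l2_ext => n; rewrite l2DE l2ZE !diag_opE//.
  by case: n => [|n] /=; rewrite ?(autP Maut).
have rho_adj a u v : M a -> ip (diag_op (rho a) u) v = ip u (diag_op (rho (adj a)) v).
  move=> Ma; rewrite !ip_l2E; congr sum; apply/funext => n; rewrite !diag_opE//.
  by case: n => [|n] /=; rewrite ?(aut_adj MvN Maut)// adjP.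
have rho0 v : diag_op (rho 0) v = 0.
  by apply: l2_ext => -[|n]; rewrite diag_opE//= ?(aut0 MvN Maut) bop0E.
have CR : real_subspace C.
  split.
  - by exists 0; [split; [|exact: sa0]|exact: rho0].
  - move=> _ _ [a [Ma as_] <-] [b [Mb bs] <-]; exists (a + b).
      by split; [exact: vND|exact: saD].
    by have := rhoP 1 a b w Ma Mb; rewrite !scale1r.
  - move=> r _ [a [Ma as_] <-]; exists ((r%:C%C : Cx R) *: a).
      split; first exact: vNZ.
      by move=> u v; rewrite !bopZE ipZl ipZr conjRC as_.
    by have := rhoP r%:C%C a 0 w Ma M0; rewrite rho0 !addr0.
have [z Cz zP] := nearest_point (delta 0%N x) CR.
pose p := delta 0%N x - z; pose q := p 0%N.
have Zq : Z q.
  have Zz : Z (z 0%N).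
    have cl : linear (fun v : l2 nat E => v 0%N) by move=> k u v.
    pose ev := HB.pack_for {linear l2 nat E -> E} (fun v : l2 nat E => v 0%N)
      (GRing.isLinear.Build _ _ _ _ _ cl).
    apply: (hcl_Z (T := ev) ler01 _ _ Cz) => [v|_ [a [Ma _] <-]] /=.
      by rewrite mul1r l2_coord.
    by rewrite /ev /= diag_opE// wE; exact: aut_Z.
  have [_ ZD ZZ] := Zcx; rewrite /q /p l2BE deltaE eqxx -scaleN1r.
  by apply: ZD => //; exact: ZZ.
(* For self-adjoint a the second term is the conjugate of the first, whose real part vanishes since
   p is orthogonal to C. Being complex-linear, g then vanishes on M. *)
pose g a := ip (diag_op (rho a) w) p + ip (diag_op (rho a) p) w.
have gP (k : Cx R) a b : M a -> M b -> g (k *: a + b) = k * g a + g b.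
  by move=> Ma Mb; rewrite /g !rhoP// !ipDl !ipZl; ring.
have gs a : M a -> sa a -> g a = 0.
  move=> Ma as_; have aC : C (diag_op (rho a) w) by exists a.
  have h : rip (diag_op (rho a) w) p = 0 by rewrite ripC; exact: zP.
  rewrite /g [X in _ + X]rho_adj// (proj1 (sa_adj _) as_) [X in _ + X]ipC.
  by move: h; rewrite /rip; case: (ip _ p) => s t /= ->; apply/eqP; rewrite eq_complex /= addr0 subrr !eqxx.
have g0 a : M a -> g a = 0.
  move=> Ma; have Ma' := vN_adj MvN Ma.
  have i2 : ('i * 'i : Cx R) = -1 by rewrite -expr2 sqrCi.
  pose a1 := a + adj a; pose a2 := 'i *: (adj a - a).
  have Ma1 : M a1 by exact: vND.
  have Ma2 : M a2 by apply: vNZ => //; exact: vNB.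
  have s1 : sa a1 by apply/sa_adj; rewrite adjD adjK addrC.
  have s2 : sa a2.
    by apply/sa_adj; rewrite adjZ conjCi adjD adjK adjN scaleNr -scalerN opprB.
  have : a = (2^-1 : Cx R) *: a1 + ((2^-1 * 'i) *: a2 + 0).
    rewrite addr0 /a1 /a2 scalerA -mulrA i2 mulrN1 scaleNr -scalerN -scalerDr opprB.
    rewrite addrACA subrr addr0 -mulr2n (_ : a *+ 2 = (2 : Cx R) *: a); last by rewrite scaler_nat.
    by rewrite scalerA mulVf ?scale1r// pnatr_eq0.
  have h1 := gs _ Ma1 s1; have h2 := gs _ Ma2 s2; have h3 := gs _ M0 (@sa0 _ _).
  move=> ->; rewrite gP//; first by rewrite gP// h1 h2 h3 !mulr0 !addr0.
  by rewrite addr0; exact: vNZ.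
have [e [e1 e2]] := projection Zcx.
have eZ u : Z (e u) by apply: Zcl.
have eid u : Z u -> e u = u.
  move=> Zu; apply: (proj_uniq Zcx e1 e2); first exact: sub_hcl.
  by move=> c _; rewrite subrr ip0l.
have adj_inter (r s : bop E -> bop E) c :
    (forall a, M a -> adj (r a) = r (adj a)) -> (forall a, M a -> adj (s a) = s (adj a)) ->
    (forall a, M a -> forall u, c (r a u) = s a (c u)) ->
    forall a, M a -> forall u, adj c (s a u) = r a (adj c u).
  move=> ra sa_ h a Ma u; apply: ip_ext => v.
  have h' := h _ (vN_adj MvN Ma) (v).
  by rewrite -adjPr adjP sa_// -h' adjPr -ra// -adjP.
have alpha_adj a : M a -> adj (alpha a) = alpha (adj a).
  by move=> Ma; rewrite (aut_adj MvN Maut).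
pose AA := [set r : nat * bool -> bop E | exists2 a, M a & r = fun k => rho a k.1].
(* The projection e onto the common kernel Z in slot 0, and 0 in the other slots. Entries from slot
   0 to another slot vanish on Z, those in the reverse direction have range orthogonal to Z, and
   those within slot 0 leave Z and its complement invariant; hence [htau]. The booleans provide two
   copies, for the vectors w and p occurring in g. *)
pose tau (k : nat * bool) : bop E := if k.1 is _.+1 then 0 else e.
have AAb r : AA r -> unif_bounded r.
  by move=> [a _ ->]; have [k k0 h] := rho_bdd a; exists k.
have taub : unif_bounded tau.
  have [k k0 ek] := bop_bound e; exists k => // -[[|n] b] u //.
  by rewrite bop0E hnorm0 mulr_ge0 ?hnorm_ge0.
have rhoD a b n : M a -> M b -> rho (a + b) n = rho a n + rho b n.
  by case: n => [|n] //= Ma Mb; rewrite (autD Maut).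
have AA1 : AA (fun=> bop_id).
  by exists bop_id => //; apply/funext => -[[|n] b] /=; rewrite ?(aut1 MvN Maut).
have AAD r s : AA r -> AA s -> AA (fun i => r i + s i).
  move=> [a Ma ->] [b Mb ->]; exists (a + b); first exact: vND.
  by apply/funext => k; rewrite rhoD.
have AAZ (k : Cx R) r : AA r -> AA (fun i => k *: r i).
  move=> [a Ma ->]; exists (k *: a); first exact: vNZ.
  by apply/funext => -[[|n] b] /=; rewrite ?(autZ MvN Maut).
have AAM r s : AA r -> AA s -> AA (fun i => bop_comp (r i) (s i)).
  move=> [a Ma ->] [b Mb ->]; exists (bop_comp a b); first exact: vNM.
  by apply/funext => -[[|n] k] /=; rewrite ?(autM Maut).
have AAadj r : AA r -> AA (fun i => adj (r i)).
  move=> [a Ma ->]; exists (adj a); first exact: vN_adj.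
  by apply/funext => -[[|n] k] /=; rewrite ?(aut_adj MvN Maut).
have htau i j c : (forall r, AA r -> forall u, c (r j u) = r i (c u)) ->
    forall u, c (tau j u) = tau i (c u).
  move=> hc; have {}hc a (Ma : M a) u : c (rho a j.1 u) = rho a i.1 (c u).
    by apply: (hc (fun k => rho a k.1)); exists a.
  move: i j hc => [[|i] bi] [[|j] bj] /= hc u; rewrite /tau /= ?bop0E ?linear0//.
  - have cZ y : Z y -> Z (c y).
      move=> Zy d dJ; apply: (Zy (bop_comp d c)) => a Ma y'.
      by rewrite !bop_compE hc// dJ.
    have acZ y : Z y -> Z (adj c y).
      move=> Zy d dJ; apply: (Zy (bop_comp d (adj c))) => a Ma y'.
      by rewrite !bop_compE (adj_inter alpha alpha c)// dJ.
    symmetry; apply: (proj_uniq Zcx e1 e2); first by apply: sub_hcl; exact: cZ.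
    by move=> y /Zcl Zy; rewrite -linearB adjP e2//; apply: sub_hcl; exact: acZ.
  - symmetry; apply: (proj_uniq Zcx e1 e2); first by apply: sub_hcl; case: Zcx.
    move=> y /Zcl Zy; rewrite subr0 adjP Zy ?ip0r// => a Ma y'.
    by rewrite (adj_inter id alpha c).
  - by rewrite (eZ u).
have [v [vE _]] := @l2_stack R E nat bool (fun b => if b then p else w).
have dens := diag_density AA1 AAD AAZ AAM AAadj AAb taub htau v.
(* The vanishing of g passes by density to tau, which sends w to [delta 0 x] and p to [delta 0 q]
   because x and q lie in Z. The real part is 2 [rip x q], so p is orthogonal to [delta 0 x] as well
   as to z, hence to itself. *)
have gtau : ip (delta 0%N x) p + ip (delta 0%N q) w = 0.
  apply: cmod_eq0; apply/eqP; rewrite eq_le cmod_ge0 andbT.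
  apply/ler_addgt0Pr => d d0; rewrite add0r.
  pose k := hnorm p + hnorm w + 1.
  have k0 : 0 < k by rewrite ltr_wpDl// addr_ge0 ?hnorm_ge0.
  have [_ [a Ma ->] h] := dens _ (divr_gt0 d0 k0).
  pose T b := delta 0%N (if b then q else x) - diag_op (rho a) (if b then p else w).
  have [v' [v'E v'n]] := l2_stack T.
  have v'D : v' = diag_op tau v - diag_op (fun k => rho a k.1) v.
    apply: l2_ext => -[n b]; rewrite v'E /T !l2BE !diag_opE//; last by apply: AAb; exists a.
    rewrite vE deltaE /tau; case: n => [|n] /=; last by rewrite ?bop0E; case: b.
    by case: b => /=; rewrite ?wE eid.
  rewrite -v'D in h.
  have Td b : hnorm (T b) <= d / k.
    apply: le_trans h; rewrite -(@ler_pXn2r _ 2)// ?nnegrE ?hnorm_ge0// v'n.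
    by rewrite big_bool; case: b; rewrite (lerDl, lerDr) sqr_ge0.
  have -> : ip (delta 0%N x) p + ip (delta 0%N q) w = ip (T false) p + ip (T true) w.
    rewrite /T !ipBl addrACA -opprD; apply/eqP; rewrite -subr_eq0 opprB addrC.
    by rewrite addrA addrAC subrr add0r; apply/eqP; have := g0 a Ma; rewrite /g.
  apply: le_trans (cmodD _ _) _.
  apply: (@le_trans _ _ (d / k * hnorm p + d / k * hnorm w)).
    by apply: lerD; apply: le_trans (cmod_ip _ _) _; rewrite ler_wpM2r ?hnorm_ge0.
  rewrite -mulrDr -mulrA ler_piMr ?(ltW d0)// mulrC ler_pdivrMr// mul1r.
  by rewrite /k lerDl.
rewrite !ip_deltal wE in gtau.
have xq : rip x q = 0.
  have := congr1 (@complex.Re R) gtau; rewrite ReD -!/(rip _ _) (ripC q x) /= => h.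
  by lra.
have pz : rip p z = 0.
  apply/eqP; rewrite -normr_eq0 eq_le normr_ge0 andbT.
  apply: (hcl_le (f := fun u => `|rip p u|) (hnorm_ge0 p) _ _ Cz) => [u u'|u Cu] /=.
    rewrite -lerBlDl (le_trans _ (rip_le _ _))// ripBr.
    exact: lerB_dist.
  by rewrite zP// normr0.
have p0 : p = 0.
  apply: hnorm_eq0; apply/eqP; rewrite -sqrf_eq0 -ripxx.
  by rewrite {2}/p ripBr pz subr0 ripC /rip ip_deltal -/(rip _ _) xq.
by rewrite -/C (subr0_eq p0).
Qed.

End Intertwiners.

(** * Assembling the implementing isometry *)

Section SpatialImplementation.
Variables (R : realType) (E : hilbertType R) (M : set (bop E)).
Variable alpha : bop E -> bop E.
Hypotheses (MvN : von_neumann M) (Maut : star_automorphism M alpha).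
Hypothesis separable : exists2 D : set E, countable D & dense D.

Let J (c : bop E) : Prop := intertwines M alpha c.

Let J0 : J 0.
Proof. by move=> a Ma x; rewrite !bop0E linear0. Qed.

Let JZ (k : Cx R) c : J c -> J (k *: c).
Proof. by move=> Jc a Ma x; rewrite !bopZE Jc// linearZ. Qed.

(* Lindelof: the open sets [c x != 0] cover the complement of 0. *)
Let countable_intertwiners : exists c : nat -> bop E,
  [/\ forall k, J (c k), forall k x, hnorm (c k x) <= hnorm x &
      forall x, hlim (fun k => c k x) 0 -> x = 0].
Proof.
have [xi [xi_small xi_total]] := total_sequence separable.
have ker x := @intertwiner_kernel R E M alpha MvN Maut xi xi_small xi_total x.
have [d dd] := dense_sequence separable.
(* A pair p codes the ball of radius 1 / (p.2 + 1) about [d p.1]; one contractive intertwiner is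
   chosen for each ball on which some such operator has no zero. *)
pose good (p : nat * nat) (c : bop E) := [/\ J c, forall x, hnorm (c x) <= hnorm x &
  forall y, hnorm (y - d p.1) <= p.2.+1%:R^-1 -> c y <> 0].
have /choice[c cP] p : exists c, (J c /\ forall x, hnorm (c x) <= hnorm x) /\
    ((exists c', good p c') -> good p c).
  have [[c gc]|ngc] := pselect (exists c, good p c).
    by exists c; case: (gc).
  by exists 0; split=> //; split=> [|x]; [exact: J0|rewrite bop0E hnorm0 hnorm_ge0].
have cover x : x <> 0 -> exists p, c p x <> 0.
  move=> x0; have [c0 Jc0 cx0] : exists2 c0, J c0 & c0 x <> 0.
    apply: contrapT => h; apply: x0; apply: ker => c0 Jc0.
    by apply: contrapT => h'; apply: h; exists c0.
  have [k k0 ck] := bop_bound c0.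
  have k1 : 0 < k + 1 by rewrite ltr_wpDl.
  pose c1 := (((k + 1)^-1)%:C%C : Cx R) *: c0.
  have c1_contr y : hnorm (c1 y) <= hnorm y.
    rewrite bopZE hnormZR gtr0_norm ?invr_gt0// mulrC ler_pdivrMr//.
    rewrite (le_trans (ck y))// mulrC ler_wpM2l ?hnorm_ge0// lerDl//.
  have c1x : 0 < hnorm (c1 x).
    rewrite lt_def hnorm_ge0 andbT; apply/eqP => /hnorm_eq0/eqP.
    rewrite bopZE scaler_eq0 => /orP[/eqP[] h|/eqP//].
    by move: k1; rewrite -invr_gt0 h ltxx.
  (* A zero y of c1 in a ball of this radius containing x would give |c1 x| <= |x - y| <= (2/3) |c1
     x|. *)
  have c1x3 : 0 < hnorm (c1 x) / 3 by rewrite divr_gt0.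
  have [N hN] := inv_succ_small c1x3.
  have eN : 0 < (N.+1%:R^-1 : R) by rewrite invr_gt0.
  have [n hn] := dd x _ eN.
  exists (n, N); have [_] := cP (n, N); case.
    exists c1; split=> //; first exact: JZ.
    move=> y /= yd cy0; have : hnorm (c1 x) <= hnorm (x - y).
      by rewrite -[c1 x]subr0 -cy0 -linearB; exact: c1_contr.
    have := hnorm_trib x (d n) y; rewrite (hnormBC (d n)) => t1.
    have hs := hN N (leqnn N).
    have := c1x; move: hs yd hn t1; set s := hnorm (c1 x).
    by move: (N.+1%:R^-1) => z; lra.
  by move=> _ _; apply.
(* The last component of the decoded triple is dropped, so each [c p] recurs infinitely often, and
   convergence to 0 along the sequence forces c p x = 0 for every p. *)
pose ix (k : nat) : nat * nat :=
  if @choice.unpickle (nat * nat * nat)%type k is Some q then q.1 else (0, 0)%N.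
exists (fun k => c (ix k)); split=> [k|k x|x /hlimP cx0].
- by case: (cP (ix k)) => -[].
- by case: (cP (ix k)) => -[].
- apply: contrapT => /cover[p]; apply.
  apply: hnorm_eq0; apply/eqP; rewrite eq_le hnorm_ge0 andbT.
  apply/ler_addgt0Pr => e e0; rewrite add0r; have [m mx] := cx0 _ e0.
  have [q mq] : exists q : nat, (m <= choice.pickle (p, q))%N.
    apply: contrapT => /forallNP h.
    have lt_m (q : 'I_m.+1) : (choice.pickle (p, q : nat) < m)%N.
      by rewrite ltnNge; apply/negP; exact: h.
    have : injective (fun q => Ordinal (lt_m q)).
      move=> q q' /(congr1 val) /= /(pcan_inj choice.pickleK)[] qq; exact: val_inj.
    by move=> /leq_card; rewrite !card_ord ltnn.
  by have := mx _ mq; rewrite /ix choice.pickleK /= subr0.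
Qed.

(* [D 0 = 1] and [D k.+1 = D k - D k c_k^* c_k D k] decrease to 0, so the
   operators [c_k D k] are the components of an isometry. *)
Theorem spatial_implementation : exists u : nat -> bop E,
  (forall n a x, M a -> u n (alpha a x) = a (u n x)) /\
  exists U : E -> l2 nat E, (forall x n, U x n = u n x) /\
    forall x y, ip (U x) (U y) = ip x y.
Proof.
have [c [cJ c1 cker]] := countable_intertwiners.
pose D := fix D k := if k is k'.+1 then
  D k' - bop_comp (D k') (bop_comp (adj (c k')) (bop_comp (c k') (D k'))) else bop_id.
have DS k x : D k.+1 x = D k x - D k (adj (c k) (c k (D k x))) by [].
have [D0 D1] : (forall k, opos (D k)) /\ (forall k, opos (bop_id - D k)).
  suff H k : opos (D k) /\ opos (bop_id - D k) by split=> k; case: (H k).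
  elim: k => [|k [Dp Dq]]; first by split; [exact: opos1|rewrite subrr; exact: opos0].
  have Ds : sa (D k) by case: Dp.
  have ripS x : rip (D k.+1 x) x = rip (D k x) x - hnorm (c k (D k x)) ^+ 2.
    rewrite DS ripBl; congr (_ - _); rewrite (sa_rip Ds).
    by rewrite /rip -adjPr -/(rip _ _) ripxx.
  have DSs : sa (D k.+1).
    move=> x y; rewrite !DS ipBl ipBr Ds; congr (_ - _).
    by rewrite Ds -adjPr adjP Ds.
  split; split; [exact: DSs|move=> x|by apply: saB|move=> x].
    rewrite ripS subr_ge0 (le_trans _ (ocontr_norm x Dp Dq))//.
    by rewrite ler_pXn2r ?nnegrE ?hnorm_ge0.
  rewrite bopBE bop_idE ripBl ripS opprB addrCA addr_ge0 ?sqr_ge0//.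
  by case: Dq => _ /(_ x); rewrite bopBE bop_idE ripBl.
have Ds k : sa (D k) by case: (D0 k).
have ripS k x : rip (D k.+1 x) x = rip (D k x) x - hnorm (c k (D k x)) ^+ 2.
  rewrite DS ripBl; congr (_ - _); rewrite (sa_rip (Ds k)).
  by rewrite /rip -adjPr -/(rip _ _) ripxx.
have sumE n x : \sum_(k < n) hnorm (c k (D k x)) ^+ 2 = hnorm x ^+ 2 - rip (D n x) x.
  elim: n => [|n IHn]; first by rewrite big_ord0 /= ripxx subrr.
  by rewrite big_ord_recr IHn ripS /=; ring.
have Dmono m n : (m <= n)%N -> opos ((bop_id - D n) - (bop_id - D m)).
  move=> mn; rewrite opprB addrC addrA subrK; split=> [|x]; first exact: saB.
  rewrite bopBE ripBl subr_ge0; elim: n mn => [|n IHn]; first by rewrite leqn0 => /eqP ->.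
  rewrite leq_eqVlt => /orP[/eqP <-//|/IHn h].
  by rewrite ripS (le_trans _ h)// gerBl sqr_ge0.
have [||s [sl sp s1 _]] := @mono_limit R E (fun k => bop_id - D k) _ _ Dmono => //.
  by move=> k; rewrite subKr.
have Dl x : hlim (fun k => D k x) (x - s x).
  apply: hlim_squeeze (sl x) => k.
  by rewrite bopBE bop_idE -hnormN opprB addrAC.
(* D k x tends to x - s x, and c k (D k x) tends to 0 because its squared norms are increments of a
   convergent sequence. By the choice of the c k the limit x - s x is then 0. *)
have u0 x : hlim (fun k => c k (x - s x)) 0.
  apply: (@hlim_squeeze _ _ _ _
      (fun k => hnorm (D k x - (x - s x)) + hnorm (c k (D k x)))) => [k|].
    rewrite subr0 -[x - s x in leLHS](subKr (D k x)) linearB.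
    rewrite (le_trans (hnormD _ _))// hnormN addrC lerD2r; exact: c1.
  rewrite -[X in _ --> X](addr0 0); apply: cvgD; first exact: Dl.
  suff : hlim (fun k => c k (D k x)) 0 by rewrite /hlim; under eq_fun do rewrite subr0.
  have q0 : rip (D k x) x - rip (D k.+1 x) x @[k --> \oo] --> (0 : R).
    have lim := hlim_rip (y := x) (Dl x).
    rewrite -[X in _ --> X](subrr (rip (x - s x) x)); apply: cvgB => //.
    by rewrite (cvg_shiftS (fun k => rip (D k x) x)).
  apply/hlimP => e e0; have e2 : 0 < e ^+ 2 by rewrite exprn_gt0.
  move/cvgrPdist_le : q0 => /(_ _ e2)[N _ hN]; exists N => k Nk.
  have := hN k Nk; rewrite /= sub0r normrN ripS subKr ger0_norm ?sqr_ge0//.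
  by rewrite subr0 ler_pXn2r ?nnegrE ?hnorm_ge0// ltW.
have s_id x : s x = x by apply/esym/subr0_eq/cker.
have Dlim x : rip (D k x) x @[k --> \oo] --> (0 : R).
  by have := hlim_rip (y := x) (Dl x); rewrite s_id subrr rip0l.
pose u k := bop_comp (c k) (D k); exists u; split.
  have DM k a x : M a -> D k (alpha a x) = alpha a (D k x).
    elim: k x => [//|k IHk] x Ma; rewrite !DS linearB/= !IHk// cJ//.
    congr (_ - _); rewrite -IHk//; congr (D k _).
    apply: ip_ext => y; rewrite -adjPr (adjP a) -(cJ k _ (vN_adj MvN Ma)).
    by rewrite adjPr (aut_adj MvN Maut)// -adjP.
  by move=> n a x Ma; rewrite !bop_compE DM// cJ.
have /choice[U UP] x : exists v : l2 nat E,
    (forall n, v n = u n x) /\ hnorm v ^+ 2 <= hnorm x ^+ 2.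
  apply: mkl2; apply: esum_nat_le => [n|N]; first by rewrite sqr_ge0.
  by rewrite sumE gerBl; case: (D0 N).
have UE x n : U x n = u n x by case: (UP x).
have UD x y : U (x + y) = U x + U y.
  by apply: l2_ext => n; rewrite l2DE !UE linearD.
have UZ (k : Cx R) x : U (k *: x) = k *: U x.
  by apply: l2_ext => n; rewrite l2ZE !UE linearZ.
have Un x : hnorm (U x) ^+ 2 = hnorm x ^+ 2.
  apply/eqP; rewrite eq_le; case: (UP x) => _ -> /=.
  have lim : hnorm x ^+ 2 - rip (D k x) x @[k --> \oo] --> hnorm x ^+ 2.
    rewrite -[X in _ --> X](subr0 (hnorm x ^+ 2)); apply: cvgB => //; exact: cvg_cst.
  apply: (cvgr_to_le lim); apply: nearW => N.
  rewrite -sumE -lee_fin -esum_l2 -nneseries_esumT; last first.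
    by move=> n; rewrite lee_fin sqr_ge0.
  rewrite -sumEFin -(big_mkord xpredT (fun k => (hnorm (c k (D k x)) ^+ 2)%:E)).
  rewrite (eq_bigr (fun k => (hnorm (U x k) ^+ 2)%:E)) => [|k _]; last by rewrite UE.
  by apply: nneseries_lim_ge => k _; rewrite lee_fin sqr_ge0.
by exists U; split=> // x y; apply: isometry_ip.
Qed.

End SpatialImplementation.

(** * Fourier coefficients in the crossed product *)

Section CrossedProduct.
Variables (R : realType) (G : groupType) (H : hilbertType R).
Variables (M : set (bop H)) (beta : G -> bop H -> bop H).
Hypothesis sys : Wstar_dynamical_system M beta.
Hypothesis separable : exists2 D : set H, countable D & dense D.
Implicit Types (a b : bop H) (s t r : G) (T S : bop (l2 G H)) (xi : l2 G H) (x y : H).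

Lemma sys_vN : von_neumann M. Proof. by case: sys. Qed.
Lemma sys_aut t : star_automorphism M (beta t).
Proof. by case: sys => _ h _; exact: h. Qed.
Lemma betaM s t a : M a -> beta (s * t)%g a = beta s (beta t a).
Proof. by move=> Ma; case: sys => _ _ h; exact: h. Qed.
Lemma beta_in t a : M a -> M (beta t a). Proof. exact: (aut_in (sys_aut t)). Qed.
Lemma beta_1 a : M a -> beta 1%g a = a.
Proof.
move=> Ma; apply: (aut_inj (sys_aut 1%g)) => //; first exact: beta_in.
by rewrite -betaM// mulg1.
Qed.

Local Notation pi := (pi_rep beta).
Local Notation lam := (@lambda_op R G H).
Local Notation N := (crossed_product M beta).

Lemma piE a xi s : M a -> pi a xi s = beta s^-1%g a (xi s).
Proof.
move=> Ma; apply: pi_repE; have [c c0 ac] := bop_bound a.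
exists c%:C%C; first by rewrite ler_RC.
move=> t x; rewrite !normE -rmorphM/= ler_RC.
exact: (aut_contr sys_vN (sys_aut t^-1%g) Ma ac).
Qed.

Lemma laE t xi s : lam t xi s = xi (t^-1 * s)%g.
Proof. exact: lambda_opE. Qed.

Lemma crossed_product_vN : von_neumann N.
Proof. exact: generated_vN_von_neumann. Qed.

Lemma pi_in a : M a -> N (pi a).
Proof. by move=> Ma; apply: sub_generated_vN; left; exists a. Qed.

Lemma lam_in t : N (lam t).
Proof. by apply: sub_generated_vN; right; exists t. Qed.

Lemma esum_bij (I J : choiceType) (f : I -> J) (g : J -> I) (c : J -> \bar R) :
  cancel f g -> cancel g f ->
  \esum_(i in [set: I]) c (f i) = \esum_(j in [set: J]) c j.
Proof.
move=> fg gf; rewrite -(@reindex_esum _ _ _ [set: I] [set: J] f c)//.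
split=> [//|i j _ _ /(congr1 g)|j _]; first by rewrite !fg.
by exists (g j) => //; rewrite gf.
Qed.

Lemma lam_adj t : adj (lam t) = lam t^-1%g.
Proof.
symmetry; apply: adj_uniq => xi eta.
have lamK s zeta : lam s (lam s^-1%g zeta) = zeta.
  by apply: l2_ext => u; rewrite !laE invgK mulVKg.
rewrite -[in LHS](lamK t eta); apply: isometry_ip => [||z].
- exact: linearD.
- by move=> z; rewrite linearZ.
apply: EFin_inj; rewrite -!esum_l2.
rewrite -(@esum_bij _ _ (fun s => (t^-1 * s)%g) (fun s => (t * s)%g)
  (fun s => (hnorm (z s) ^+ 2)%:E)).
- by apply: eq_esum => s _; rewrite laE.
- by move=> s; rewrite mulVKg.
- by move=> s; rewrite mulKg.
Qed.

Lemma pi_adj a : M a -> adj (pi a) = pi (adj a).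
Proof.
move=> Ma; symmetry; apply: adj_uniq => xi eta; rewrite !ip_l2E; congr sum.
apply/funext => s; have Ma' := vN_adj sys_vN Ma.
by rewrite !piE// (aut_adj sys_vN (sys_aut _))// adjP.
Qed.

Lemma crossed_product_comm T (X : bop (l2 G H)) : N T ->
  (forall a, M a -> forall xi, X (pi a xi) = pi a (X xi)) ->
  (forall t xi, X (lam t xi) = lam t (X xi)) ->
  forall xi, T (X xi) = X (T xi).
Proof.
move=> NT Xp Xl; apply: (@generated_vN_comm R _ (pi @` M `|` range lam) T X _ NT).
  move=> S [[a Ma <-]|[t _ <-]].
    by left; exists (adj a); [exact: (vN_adj sys_vN Ma)|rewrite pi_adj].
  by right; exists t^-1%g => //; rewrite lam_adj.
by move=> S [[a Ma <-]|[t _ <-]]; apply: bop_ext => xi; rewrite !bop_compE ?Xp ?Xl.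
Qed.

(** The matrix entry of T at row 1 and column t^-1; at row 1 the twist by beta disappears, so for T
    = pi(a) lambda_t it is a itself. *)
Definition coef T t : bop H :=
  get [set S : bop H | forall x, S x = T (delta t^-1%g x) 1%g].

Lemma coefE T t x : coef T t x = T (delta t^-1%g x) 1%g.
Proof.
have [c c0 Tc] := bop_bound T.
have [|//|y|S SE] := @mkbop R H (fun x => T (delta t^-1%g x) 1%g) c.
- by move=> k y z; rewrite !linearP.
- by rewrite (le_trans (l2_coord _ _))// (le_trans (Tc _))// hnorm_delta.
exact: (@getPex _ [set S : bop H | forall x, S x = T (delta t^-1%g x) 1%g]
  (ex_intro _ S SE)).
Qed.

(** For X in the commutant of M, the amplification of X to l2(G, H) commutes with pi(M) and with the
    translations, hence with T and with its matrix entries. *)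
Lemma coef_in T t : N T -> M (coef T t).
Proof.
move=> NT; apply: (vN_mem sys_vN) => X MX x.
have dX := @diag_opE R H G (fun=> X) (unif_bounded_cst G X).
have := crossed_product_comm (X := diag_op (fun=> X)) NT.
move=> /(_ _ _ (delta t^-1%g x)) h; rewrite !coefE -dX -h.
- congr ((T _ : l2 G H) _); apply: l2_ext => s; rewrite dX !deltaE.
  by case: eqP; rewrite ?linear0.
- move=> a Ma xi; apply: l2_ext => s; rewrite dX !piE// dX.
  by rewrite (vN_comm (beta_in _ Ma) MX).
- by move=> r xi; apply: l2_ext => s; rewrite dX !laE dX.
Qed.

(* If u intertwines beta_{r^-1} with the identity representation, then
   (C xi)(s) = u (xi (s r)) commutes with the crossed product. *)
Lemma entryE T r s x : N T ->
  T (delta s x) r = beta r^-1%g (coef T (r * s^-1)%g) x.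
Proof.
move=> NT; set a := coef T _; have Ma : M a by exact: coef_in.
have [u [uP [U [UE Uip]]]] := spatial_implementation sys_vN (sys_aut r^-1%g) separable.
suff h : U (T (delta s x) r) = U (beta r^-1%g a x).
  apply/subr0_eq/hnorm_eq0/eqP; rewrite -sqrf_eq0 -ripxx /rip.
  by rewrite !(ipBl, ipBr) -!Uip h !subrr.
apply: l2_ext => n; rewrite !UE uP//.
have [c c0 uc] := bop_bound (u n).
have [|k xi eta p|xi|C [CE _]] := @mkbop_l2 R H G (fun xi p => u n (xi (p * r)%g)) c.
- by [].
- by rewrite l2DE l2ZE linearP.
- apply: (@le_trans _ _ (\esum_(p in [set: G]) (c ^+ 2 * hnorm (xi (p * r)%g) ^+ 2)%:E)).
    apply: le_esum => p _; rewrite lee_fin -exprMn.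
    by rewrite ler_pXn2r ?nnegrE ?mulr_ge0 ?hnorm_ge0.
  apply/(esum_fset_le _ _) => [p|A]; first by rewrite mulr_ge0 ?sqr_ge0.
  rewrite -mulr_sumr exprMn ler_wpM2l ?sqr_ge0//; move: A.
  apply/(esum_fset_le _ _) => [p|]; first by rewrite sqr_ge0.
  rewrite (@esum_bij _ _ (fun p => (p * r)%g) (fun p => (p * r^-1)%g)
    (fun p => (hnorm (xi p) ^+ 2)%:E)) ?esum_l2//.
    by move=> p; rewrite mulgK.
  by move=> p; rewrite mulgVK.
have TC := crossed_product_comm (X := C) NT.
have {}TC := TC _ _ (delta s x).
have Cd : C (delta s x) = delta (s * r^-1)%g (u n x).
  apply: l2_ext => p; rewrite CE !deltaE (can2_eq (mulgK r) (mulgVK r)).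
  by case: eqP; rewrite ?linear0.
rewrite /a coefE invgM invgK -Cd TC.
- by rewrite CE mul1g.
- move=> b Mb xi; apply: l2_ext => p; rewrite CE !piE// CE -uP; last exact: beta_in.
  by rewrite -betaM// invgM.
- by move=> t xi; apply: l2_ext => p; rewrite !CE !laE CE mulgA.
Qed.

Lemma crossed_product_ext T S : N T -> N S -> (forall t, coef T t = coef S t) -> T = S.
Proof.
move=> NT NS TS; apply: bop_l2_ext => s x; apply: l2_ext => r.
by rewrite !entryE// TS.
Qed.

Definition pl a t := bop_comp (pi a) (lam t).

Lemma plE a t xi s : M a -> pl a t xi s = beta s^-1%g a (xi (t^-1 * s)%g).
Proof. by move=> Ma; rewrite /pl bop_compE piE// laE. Qed.

Lemma pl_in a t : M a -> N (pl a t).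
Proof.
by move=> Ma; apply: (vNM crossed_product_vN); [exact: pi_in|exact: lam_in].
Qed.

Lemma coef_pl a t t' : M a -> coef (pl a t) t' = if t' == t then a else 0.
Proof.
move=> Ma; apply: bop_ext => x; rewrite coefE plE// mulg1 deltaE invg1 beta_1//.
by rewrite (inj_eq invg_inj) eq_sym; case: eqP => // _; rewrite linear0.
Qed.

Lemma coefP (k : Cx R) T S t : coef (k *: T + S) t = k *: coef T t + coef S t.
Proof. by apply: bop_ext => x; rewrite bopDE bopZE !coefE bopDE bopZE. Qed.

(** The t-th Fourier term of T: it retains the matrix entries at (r, s) with r s^-1 = t and puts 0
    elsewhere. *)
Definition fc T t := pl (coef T t) t.

Lemma fcE T t xi s : N T ->
  fc T t xi s = T (delta (t^-1 * s)%g (xi (t^-1 * s)%g)) s.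
Proof.
move=> NT; rewrite /fc plE; last exact: coef_in.
by rewrite entryE// invgM invgK mulVKg.
Qed.

Lemma fc_in T t : N T -> N (fc T t).
Proof. by move=> NT; apply: pl_in; exact: coef_in. Qed.

Lemma plP (k : Cx R) a b t : M a -> M b -> pl (k *: a + b) t = k *: pl a t + pl b t.
Proof.
move=> Ma Mb; apply: bop_ext => xi; apply: l2_ext => s.
rewrite bopDE bopZE l2DE l2ZE !plE//; last by apply: (vND sys_vN) => //; exact: (vNZ sys_vN).
by rewrite (autP (sys_aut _)).
Qed.

Lemma pl0 t : pl 0 t = 0.
Proof.
have M0 := vN0 sys_vN; have := plP 1 t M0 M0.
by rewrite scaler0 addr0 scale1r => h; apply: (addrI (pl 0 t)); rewrite addr0.
Qed.

Lemma plZ (k : Cx R) a t : M a -> pl (k *: a) t = k *: pl a t.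
Proof. by move=> Ma; have := plP k t Ma (vN0 sys_vN); rewrite pl0 !addr0. Qed.

(** The algebraic crossed product, a unital *-algebra by the lemmas that follow. *)
Inductive span_pl : bop (l2 G H) -> Prop :=
  | span_pl0 : span_pl 0
  | span_plS a t T : M a -> span_pl T -> span_pl (pl a t + T).

Lemma span_plN T : span_pl T -> N T.
Proof.
elim=> [|a t S Ma _ NS]; first exact: (vN0 crossed_product_vN).
by apply: (vND crossed_product_vN) => //; exact: pl_in.
Qed.

Lemma span_plD T S : span_pl T -> span_pl S -> span_pl (T + S).
Proof.
by move=> sT sS; elim: sT => [|a t T' Ma _ h]; rewrite ?add0r// -addrA; constructor.
Qed.

Lemma span_pl1 a t : M a -> span_pl (pl a t).
Proof. by move=> Ma; rewrite -[pl a t]addr0; apply: span_plS => //; exact: span_pl0. Qed.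

Lemma span_plZ (k : Cx R) T : span_pl T -> span_pl (k *: T).
Proof.
elim=> [|a t T' Ma _ h]; first by rewrite scaler0; exact: span_pl0.
rewrite scalerDr; apply: span_plD => //.
by rewrite -plZ//; apply: span_pl1; exact: (vNZ sys_vN _ Ma).
Qed.

Lemma pl_comp a b s t : M a -> M b ->
  bop_comp (pl a s) (pl b t) = pl (bop_comp a (beta s b)) (s * t)%g.
Proof.
move=> Ma Mb; have Mb' := beta_in s Mb.
apply: bop_ext => xi; apply: l2_ext => r; rewrite bop_compE !plE//; last first.
  exact: (vNM sys_vN).
rewrite (autM (sys_aut _))// bop_compE -betaM//.
by rewrite !invgM invgK mulgA.
Qed.

Lemma pl_adj a t : M a -> adj (pl a t) = pl (beta t^-1%g (adj a)) t^-1%g.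
Proof.
move=> Ma; have Ma' := vN_adj sys_vN Ma.
rewrite /pl adj_comp lam_adj pi_adj//.
apply: bop_ext => xi; apply: l2_ext => s; rewrite !bop_compE laE !piE//; last exact: beta_in.
by rewrite laE -betaM// invgM invgK.
Qed.

Lemma span_plM T S : span_pl T -> span_pl S -> span_pl (bop_comp T S).
Proof.
move=> sT sS; elim: sT => [|a t T' Ma _ h].
  by rewrite (_ : bop_comp 0 S = 0); [exact: span_pl0|exact: bop_ext].
rewrite bop_compDl; apply: span_plD => //.
elim: sS => [|b s S' Mb _ h'].
  rewrite (_ : bop_comp _ 0 = 0); first exact: span_pl0.
  by apply: bop_ext => x; rewrite bop_compE bop0E linear0.
rewrite bop_compDr; apply: span_plD => //; rewrite pl_comp//.
by apply: span_pl1; apply: (vNM sys_vN) => //; exact: beta_in.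
Qed.

Lemma span_pl_adj T : span_pl T -> span_pl (adj T).
Proof.
elim=> [|a t T' Ma _ h]; first by rewrite adj0; exact: span_pl0.
rewrite adjD; apply: span_plD => //; rewrite pl_adj//.
by apply: span_pl1; apply: beta_in; exact: (vN_adj sys_vN).
Qed.

Lemma pl_1 a : pl a 1%g = pi a.
Proof.
apply: bop_ext => xi; rewrite /pl bop_compE; congr (pi a _).
by apply: l2_ext => s; rewrite laE invg1 mul1g.
Qed.

Lemma pl_lam t : pl bop_id t = lam t.
Proof.
apply: bop_ext => xi; apply: l2_ext => s; rewrite plE ?laE; last exact: (vN1 sys_vN).
by rewrite (aut1 sys_vN (sys_aut _)).
Qed.

Lemma pl_id : pl bop_id 1%g = bop_id.
Proof.
apply: bop_ext => xi; apply: l2_ext => s; rewrite plE; last exact: (vN1 sys_vN).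
by rewrite (aut1 sys_vN (sys_aut _)) invg1 mul1g.
Qed.

(** Strong density in the amplification by I, which is the form that ultraweakly continuous
    functionals can use. It is [diag_density] for constant families. *)
Lemma span_pl_dense T (I : choiceType) (v : l2 I (l2 G H)) (e : R) : N T -> 0 < e ->
  exists2 S, span_pl S & hnorm (diag_op (fun=> T) v - diag_op (fun=> S) v) <= e.
Proof.
move=> NT e0.
pose AA := [set r : I -> bop (l2 G H) | exists2 S, span_pl S & r = fun=> S].
have [|r s|k r|r s|r|r|||_ [S sS ->] h] := @diag_density R (l2 G H) I AA _ _ _ _ _ _ (fun=> T) _ _ v e e0.
- by exists bop_id => //; rewrite -pl_id; apply: span_pl1; exact: (vN1 sys_vN).
- by move=> [A sA ->] [B sB ->]; exists (A + B) => //; exact: span_plD.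
- by move=> [A sA ->]; exists (k *: A) => //; exact: span_plZ.
- by move=> [A sA ->] [B sB ->]; exists (bop_comp A B) => //; exact: span_plM.
- by move=> [A sA ->]; exists (adj A) => //; exact: span_pl_adj.
- by move=> [A sA ->]; exact: unif_bounded_cst.
- exact: unif_bounded_cst.
- move=> i j c hc x; symmetry.
  have key S : span_pl S -> forall z, c (S z) = S (c z).
    by move=> sS z; apply: (hc (fun=> S)); exists S.
  apply: (crossed_product_comm NT) => [a Ma z|t z].
    by rewrite -pl_1 key//; exact: span_pl1.
  by rewrite -pl_lam key//; apply: span_pl1; exact: (vN1 sys_vN).
by exists S.
Qed.

End CrossedProduct.

(** * Ultraweakly continuous functionals *)

Section UltraweakTheory.
Variables (R : realType).

Lemma cvgCP (J : Type) (F : set_system J) (FF : Filter F) (f : J -> Cx R) (l : Cx R) :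
  f @ F --> l <-> forall e : R, 0 < e -> \forall n \near F, cmod (f n - l) <= e.
Proof.
split=> [/cvgrPdist_le fl e e0|fl].
  have e0C : 0 < (e%:C%C : Cx R) by rewrite ltr_RC.
  by apply: filterS (fl _ e0C) => n; rewrite cmodE ler_RC -cmodN opprB.
apply/cvgrPdist_le => e e0; apply: filterS (fl _ (Re_gt0 e0)) => n.
by rewrite cmodE (Cx_realE (ltW e0)) ler_RC -cmodN opprB.
Qed.

Section OneSpace.
Variable E : hilbertType R.
Implicit Types (T S : bop E) (N : set (bop E)).

Local Notation ufun := (@ultraweak_functional R E).

Lemma dcstE (I : choiceType) T (v : l2 I E) i : diag_op (fun=> T) v i = T (v i).
Proof. by rewrite diag_opE//; exact: unif_bounded_cst. Qed.

Lemma ufunE p T : ufun p T = ip (diag_op (fun=> T) p.1) p.2.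
Proof.
rewrite /ultraweak_functional ip_l2E; congr sum; apply/funext => n.
by rewrite dcstE.
Qed.

Lemma dcstP (I : choiceType) (k : Cx R) T S (v : l2 I E) :
  diag_op (fun=> k *: T + S) v = k *: diag_op (fun=> T) v + diag_op (fun=> S) v.
Proof. by apply: l2_ext => i; rewrite l2DE l2ZE !dcstE. Qed.

Lemma ufunP p (k : Cx R) T S : ufun p (k *: T + S) = k * ufun p T + ufun p S.
Proof. by rewrite !ufunE dcstP ipDl ipZl. Qed.

Lemma ufun0 p : ufun p 0 = 0.
Proof. by have := ufunP p (-1) 0 0; rewrite scaler0 addr0 mulN1r addNr. Qed.

Lemma ufunZ p (k : Cx R) T : ufun p (k *: T) = k * ufun p T.
Proof. by have := ufunP p k T 0; rewrite ufun0 !addr0. Qed.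

Lemma ufunB p T S : ufun p (T - S) = ufun p T - ufun p S.
Proof. by rewrite addrC -scaleN1r ufunP mulN1r addrC. Qed.

(** The filter generated by finitely many conditions on functionals converges to T by
    [ultraweak_cvgP], so it contains every neighbourhood of T. *)
Lemma nbhs_ultraweak T (A : set (bop E)) : nbhs T A ->
  exists (ps : seq (l2 nat E * l2 nat E)) (e : R), 0 < e /\
    forall S, (forall p, p \in ps -> cmod (ufun p S - ufun p T) <= e) -> A S.
Proof.
pose B (q : seq (l2 nat E * l2 nat E) * R) : set (bop E) :=
  [set S | forall p, p \in q.1 -> cmod (ufun p S - ufun p T) <= q.2].
pose F := filter_from [set q : seq (l2 nat E * l2 nat E) * R | 0 < q.2] B.
have FF : Filter F.
  apply: filter_from_filter; first by exists ([::], 1) => /=.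
  move=> q q' /= q0 q'0; exists (q.1 ++ q'.1, Num.min q.2 q'.2) => /=.
    by rewrite lt_min q0.
  move=> S BS; split=> p pq; apply: (le_trans (BS p _)); rewrite /= ?mem_cat ?pq ?orbT//.
    by rewrite ge_min lexx.
  by rewrite ge_min lexx orbT.
have FT : F --> T.
  apply/ultraweak_cvgP => p; apply/cvgCP => e e0.
  by exists ([:: p], e) => //= S; apply; rewrite inE.
move=> /FT[[ps e] /= e0 BA]; exists ps, e; split=> // S pS; exact: BA.
Qed.

Record wcont N (f : bop E -> Cx R) : Prop := Wcont {
  wcontP : forall T, N T -> f S @[S --> within N (nbhs T)] --> f T }.

Lemma wcont_ufun N p : wcont N (ufun p).
Proof.
split=> T _; apply: cvg_trans (_ : ufun p @ nbhs T --> _); last first.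
  by have /ultraweak_cvgP := @cvg_id _ (nbhs T); apply.
by apply: cvg_app; exact: cvg_within.
Qed.

Lemma wcont_eq N f g : (forall T, N T -> f T = g T) -> wcont N f -> wcont N g.
Proof.
move=> fg fc_; split=> T NT; rewrite -fg//; apply: cvg_trans (wcontP fc_ NT).
apply: near_eq_cvg; have : within N (nbhs T) N by exact: withinT.
by apply: filterS => S /fg.
Qed.

Lemma wcontD N f g : wcont N f -> wcont N g -> wcont N (fun T => f T + g T).
Proof.
by move=> fc_ gc; split=> T NT; apply: cvgD; [exact: (wcontP fc_ NT)|exact: (wcontP gc NT)].
Qed.

Lemma wcontZ N (k : Cx R) f : wcont N f -> wcont N (fun T => k * f T).
Proof.
by move=> fc_; split=> T NT; apply: cvgM; [exact: cvg_cst|exact: (wcontP fc_ NT)].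
Qed.

Lemma wcont0 N : wcont N (fun=> 0).
Proof. by split=> T _; exact: cvg_cst. Qed.

Lemma wcont_sum N I (r : seq I) (f : I -> bop E -> Cx R) :
  (forall i, wcont N (f i)) -> wcont N (fun T => \sum_(i <- r) f i T).
Proof.
move=> fc_; elim: r => [|i r IHr].
  have e T : N T -> 0 = \sum_(j <- [::]) f j T by move=> _; rewrite big_nil.
  exact: wcont_eq e (wcont0 N).
have e T : N T -> f i T + \sum_(j <- r) f j T = \sum_(j <- i :: r) f j T.
  by move=> _; rewrite big_cons.
exact: wcont_eq e (wcontD (fc_ i) IHr).
Qed.

End OneSpace.

Lemma within_contP (E F : hilbertType R) (N : set (bop E)) (Phi : bop E -> bop F) :
  {within N, continuous Phi} <->
  forall p, wcont N (fun T => ultraweak_functional p (Phi T)).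
Proof.
rewrite subspace_continuousP; split=> [h p|h T NT]; first split=> T NT.
  by have /ultraweak_cvgP := h T NT; apply.
by apply/ultraweak_cvgP => p; exact: (wcontP (h p) NT).
Qed.

Lemma wcont_comp (E F : hilbertType R) (N : set (bop E)) (N2 : set (bop F))
    (Phi : bop E -> bop F) (f : bop F -> Cx R) :
  (forall T, N T -> N2 (Phi T)) -> {within N, continuous Phi} -> wcont N2 f ->
  wcont N (fun T => f (Phi T)).
Proof.
move=> PN /subspace_continuousP Pc fc_; split=> T NT.
have h := wcontP fc_ (PN _ NT).
apply: (cvg_comp Phi f _ h) => A /= wA.
have : nbhs T [set S | N S -> N2 (Phi S) -> A (Phi S)] := Pc T NT _ wA.
suff : nbhs T [set S | N S -> N2 (Phi S) -> A (Phi S)] ->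
    nbhs T [set S | N S -> A (Phi S)] by apply.
by apply: filterS => S h' NS; apply: h' => //; exact: PN.
Qed.

Lemma l2_embed (E : hilbertType R) (I J : choiceType) (f : I -> J) : injective f ->
  exists V : l2 I E -> l2 J E, [/\ forall x i, V x (f i) = x i,
    forall x j, (forall i, f i <> j) -> V x j = 0 &
    forall x y, ip (V x) (V y) = ip x y].
Proof.
move=> fi.
pose g (x : l2 I E) j : E := if pselect (exists i, f i = j) is left h then x (projT1 (cid h)) else 0.
have gf x i : g x (f i) = x i.
  rewrite /g; case: pselect => [h|[]]; last by exists i.
  by congr (x _); apply: fi; exact: projT2 (cid h).
have g0 x j : (forall i, f i <> j) -> g x j = 0.
  by rewrite /g; case: pselect => // -[i fij] /(_ i).
have gE x : \esum_(j in [set: J]) (hnorm (g x j) ^+ 2)%:E = (hnorm x ^+ 2)%:E.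
  rewrite -esum_l2 -(eq_esum (a := fun i => (hnorm (g x (f i)) ^+ 2)%:E)); last first.
    by move=> i _; rewrite gf.
  rewrite -(@esum_image _ _ _ [set: I] f (fun j => (hnorm (g x j) ^+ 2)%:E)); last first.
    by move=> ? ? _ _ /fi.
  rewrite [RHS]esum_mkcond; apply: eq_esum => j _; case: ifPn => // /negP jf.
  rewrite g0 ?hnorm0 ?expr0n// => i fij; apply: jf; apply/mem_set; by exists i.
have /choice[V VP] (x : l2 I E) : exists v : l2 J E,
    (forall j, v j = g x j) /\ hnorm v ^+ 2 <= hnorm x ^+ 2.
  by apply: mkl2; rewrite gE.
have VE x j : V x j = g x j by case: (VP x).
exists V; split=> [x i|x j h|]; [by rewrite VE gf|by rewrite VE g0|].
have Vext (v : l2 J E) (x : l2 I E) : (forall i, v (f i) = x i) ->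
    (forall j, (forall i, f i <> j) -> v j = 0) -> V x = v.
  move=> vf v0; apply: l2_ext => j; rewrite VE.
  have [[i <-]|h] := pselect (exists i, f i = j); first by rewrite gf vf.
  have h' i : f i <> j by move=> ij; apply: h; exists i.
  by rewrite g0// v0.
apply: isometry_ip => [x y|x|x].
- by apply: Vext => [i|j h]; rewrite l2DE !VE ?gf// !g0// addr0.
- by apply: Vext => [i|j h]; rewrite l2ZE !VE ?gf// !g0// scaler0.
- by apply: EFin_inj; rewrite -gE -esum_l2; apply: eq_esum => j _; rewrite VE.
Qed.

(** Ultraweak functionals are sums over nat; extension by zero along f admits any countable index
    set. *)
Lemma wcont_ip (E : hilbertType R) (N : set (bop E)) (I : choiceType) (f : I -> nat)
    (x y : l2 I E) : injective f -> wcont N (fun T => ip (diag_op (fun=> T) x) y).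
Proof.
move=> /(l2_embed E)[V [Vf V0 Vip]].
apply: wcont_eq (wcont_ufun N (V x, V y)) => T NT; rewrite ufunE /= -Vip.
congr (ip _ _); apply: l2_ext => n; rewrite dcstE.
have [[i <-]|h] := pselect (exists i, f i = n); first by rewrite !Vf dcstE.
have h' i : f i <> n by move=> ij; apply: h; exists i.
by rewrite !V0// linear0.
Qed.

Lemma wcont_vec (E : hilbertType R) (N : set (bop E)) (x y : E) :
  wcont N (fun T => ip (T x) y).
Proof.
have fi : injective (fun _ : unit => 0%N) by move=> [] [].
apply: wcont_eq (wcont_ip N (delta tt x) (delta tt y) fi) => T NT.
by rewrite ip_deltar dcstE deltaE eqxx.
Qed.

(** * Ultraweak convergence of bounded nets *)

Section BoundedNets.
Variables (J : Type) (F : set_system J).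
Context {FF : Filter F}.

Lemma cvgC_sub0 (f g : J -> Cx R) (l : Cx R) : (forall n, g n = f n - l) ->
  f @ F --> l <-> g @ F --> (0 : Cx R).
Proof.
by move=> gE; rewrite !cvgCP; split=> h e e0; apply: filterS (h e e0) => n;
  rewrite gE subr0.
Qed.

Lemma cvg0_add (f g h : J -> Cx R) : f @ F --> (0 : Cx R) -> g @ F --> (0 : Cx R) ->
  (forall n, h n = f n + g n) -> h @ F --> (0 : Cx R).
Proof.
move=> /cvgCP f0 /cvgCP g0 hE; apply/cvgCP => e e0.
have e2 : 0 < e / 2 by rewrite divr_gt0.
apply: filterS2 (f0 _ e2) (g0 _ e2) => n; rewrite !subr0 hE => h1 h2.
by rewrite (le_trans (cmodD _ _))// [leRHS]splitr lerD.
Qed.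

Lemma cvg0_scale (a : Cx R) (f h : J -> Cx R) : f @ F --> (0 : Cx R) ->
  (forall n, h n = a * f n) -> h @ F --> (0 : Cx R).
Proof.
move=> /cvgCP f0 hE; apply/cvgCP => e e0.
have a1 : 0 < cmod a + 1 by rewrite ltr_wpDl ?cmod_ge0.
apply: filterS (f0 _ (divr_gt0 e0 a1)) => n; rewrite !subr0 hE cmodM => h1.
rewrite (le_trans (ler_wpM2l (cmod_ge0 _) h1))// mulrCA ler_piMr ?(ltW e0)//.
by rewrite ler_pdivrMr// mul1r lerDl.
Qed.

Lemma bounded_lim0 (E : hilbertType R) (B : J -> bop E) (k : R) (C : set E) y :
  0 <= k -> (forall n x, hnorm (B n x) <= k * hnorm x) ->
  (forall c, C c -> ip (B n c) y @[n --> F] --> (0 : Cx R)) ->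
  forall x, hcl C x -> ip (B n x) y @[n --> F] --> (0 : Cx R).
Proof.
move=> k0 Bk BC x Cx'; apply/cvgCP => e e0.
pose m := k * hnorm y + 1; have m0 : 0 < m by rewrite ltr_wpDl// mulr_ge0 ?hnorm_ge0.
have em : 0 < e / 2 / m by rewrite !divr_gt0.
have [c Cc xc] := Cx' _ em; have e2 : 0 < e / 2 by rewrite divr_gt0.
move/cvgCP : (BC c Cc) => /(_ _ e2); apply: filterS => n; rewrite !subr0 => hc.
have -> : ip (B n x) y = ip (B n (x - c)) y + ip (B n c) y.
  by rewrite -ipDl -linearD subrK.
rewrite (le_trans (cmodD _ _))// [leRHS]splitr lerD//.
rewrite (le_trans (cmod_ip _ _))// (le_trans (ler_wpM2r (hnorm_ge0 _) (Bk _ _)))//.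
rewrite mulrAC (le_trans (ler_wpM2l _ xc)) ?mulr_ge0 ?hnorm_ge0//.
by rewrite mulrCA ler_piMr ?(ltW e2)// ler_pdivrMr// mul1r lerDl.
Qed.

Lemma ip_adj0 (E : hilbertType R) (B : J -> bop E) x y :
  ip (B n x) y @[n --> F] --> (0 : Cx R) ->
  ip (adj (B n) y) x @[n --> F] --> (0 : Cx R).
Proof.
move=> /cvgCP h; apply/cvgCP => e e0; apply: filterS (h _ e0) => n.
by rewrite !subr0 -adjPr ipC cmodJ.
Qed.

Lemma adj_contr (E : hilbertType R) (B : bop E) (k : R) : 0 <= k ->
  (forall x, hnorm (B x) <= k * hnorm x) -> forall x, hnorm (adj B x) <= k * hnorm x.
Proof.
move=> k0 Bk x; have [->|x0] := eqVneq (hnorm (adj B x)) 0.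
  by rewrite mulr_ge0 ?hnorm_ge0.
have xp : 0 < hnorm (adj B x) by rewrite lt_def x0 hnorm_ge0.
rewrite -(ler_pM2r xp) -expr2 -ripxx /rip -adjPr -/(rip _ _) ripC.
rewrite (le_trans (ler_norm _))// (le_trans (rip_le _ _))// mulrAC.
by rewrite ler_wpM2r ?hnorm_ge0.
Qed.

(** The uniform bound extends convergence from the vectors [delta i x] to their closed span in the
    first slot; the second slot is the first slot of the adjoints. *)
Lemma bounded_lim_l2 (E : hilbertType R) (I : choiceType) (B : J -> bop (l2 I E)) (k : R) :
  0 <= k -> (forall n x, hnorm (B n x) <= k * hnorm x) ->
  (forall i j (x y : E), ip (B n (delta i x)) (delta j y) @[n --> F] --> (0 : Cx R)) ->
  forall v w, ip (B n v) w @[n --> F] --> (0 : Cx R).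
Proof.
move=> k0 Bk Bd.
have sub (D : J -> bop (l2 I E)) w : (forall n x, hnorm (D n x) <= k * hnorm x) ->
    (forall i x, ip (D n (delta i x)) w @[n --> F] --> (0 : Cx R)) ->
    forall v, ip (D n v) w @[n --> F] --> (0 : Cx R).
  move=> Dk Dd v; pose C := [set v | ip (D n v) w @[n --> F] --> (0 : Cx R)].
  suff Cv : hcl C v by exact: (bounded_lim0 k0 Dk (fun c Cc => Cc) Cv).
  apply: restr_hcl => [|i]; last exact: Dd.
  split=> [|x y Cx' Cy|a x Cx'].
  - apply/cvgCP => e e0; apply: (@filterE _ F FF) => n.
    by rewrite linear0 ip0l subrr cmod0 ltW.
  - by apply: (cvg0_add Cx' Cy) => n; rewrite linearD ipDl.
  - apply: (@cvg0_scale a (fun n => ip (D n x) w) (fun n => ip (D n (a *: x)) w) Cx').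
    by move=> n; rewrite linearZ/= ipZl.
have adjb n x : hnorm (adj (B n) x) <= k * hnorm x by apply: adj_contr.
move=> v w; apply: (sub _ w Bk) => i x.
have := ip_adj0 (B := fun n => adj (B n)) (x := w) (y := delta i x).
have -> : (fun n => ip (adj (adj (B n)) (delta i x)) w) = (fun n => ip (B n (delta i x)) w).
  by apply/funext => n; rewrite adjK.
apply; apply: (sub (fun n => adj (B n))) => // j y.
exact: ip_adj0.
Qed.

(** An ultraweak functional is a vector functional of the amplification, whose off-diagonal entries
    vanish and whose diagonal entries converge weakly. *)
Lemma bounded_net_cvg (E : hilbertType R) (T : J -> bop E) (T0 : bop E) (k : R) :
  0 <= k -> (forall n x, hnorm (T n x) <= k * hnorm x) ->
  (forall x y, ip (T n x) y @[n --> F] --> ip (T0 x) y) -> T @ F --> T0.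
Proof.
move=> k0 Tk Tl; have [m m0 T0m] := bop_bound T0.
apply/ultraweak_cvgP => p.
have h n : ip (diag_op (fun=> T n - T0) p.1) p.2 =
    ultraweak_functional p (T n) - ultraweak_functional p T0 by rewrite -ufunB ufunE.
apply: (proj2 (cvgC_sub0 h)).
apply: (@bounded_lim_l2 _ _ (fun n => diag_op (fun=> T n - T0)) (k + m)).
- exact: addr_ge0.
- move=> n v; apply: diag_op_le; first exact: addr_ge0.
  move=> _ x; rewrite bopBE (le_trans (hnormD _ _))// hnormN mulrDl lerD//.
- move=> i j x y.
  have [ij|ij] := eqVneq i j.
    have h' n : ip (diag_op (fun=> T n - T0) (delta i x)) (delta j y) =
        ip (T n x) y - ip (T0 x) y.
      by rewrite ip_deltar dcstE deltaE ij eqxx bopBE ipBl.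
    exact: (proj1 (cvgC_sub0 h') (Tl x y)).
  apply/cvgCP => e e0; apply: (@filterE _ F FF) => n.
  by rewrite ip_deltar dcstE deltaE eq_sym (negbTE ij) linear0 ip0l subrr cmod0 ltW.
Qed.

Lemma bounded_net_cvg_l2 (E : hilbertType R) (I : choiceType)
    (T : J -> bop (l2 I E)) (T0 : bop (l2 I E)) (k : R) :
  0 <= k -> (forall n x, hnorm (T n x) <= k * hnorm x) ->
  (forall i j (x y : E), ip (T n (delta i x) j) y @[n --> F] --> ip (T0 (delta i x) j) y) ->
  T @ F --> T0.
Proof.
move=> k0 Tk Tl; apply: (bounded_net_cvg k0 Tk) => v w.
have [m m0 T0m] := bop_bound T0.
have h n : ip ((T n - T0) v) w = ip (T n v) w - ip (T0 v) w by rewrite bopBE ipBl.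
apply: (proj2 (cvgC_sub0 h)).
apply: (@bounded_lim_l2 _ _ (fun n => T n - T0) (k + m)).
- exact: addr_ge0.
- by move=> n x; rewrite bopBE (le_trans (hnormD _ _))// hnormN mulrDl lerD.
- move=> i j x y; have h' n : ip ((T n - T0) (delta i x)) (delta j y) =
      ip (T n (delta i x) j) y - ip (T0 (delta i x) j) y.
    by rewrite ip_deltar bopBE l2BE ipBl.
  exact: (proj1 (cvgC_sub0 h') (Tl i j x y)).
Qed.

End BoundedNets.
End UltraweakTheory.

(** * Matrix norms and finite rank *)

Section MatrixNorms.
Variables (R : realType) (E : hilbertType R).

(** For k >= 0: the operator matrix T has norm at most k. Arbitrary finite index types allow block
    indices such as [A * J]; [cbnorm_mxle] reduces them to ordinals. *)
Definition mxle (I : finType) (T : I -> I -> bop E) (k : R) : Prop :=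
  forall x : I -> E, \sum_i hnorm (\sum_j T i j (x j)) ^+ 2 <=
    k ^+ 2 * \sum_j hnorm (x j) ^+ 2.

Lemma mx_opnorm_le n (T : 'M[bop E]_n) (k : R) : 0 <= k ->
  (mx_opnorm T <= k%:E)%E <-> mxle (fun i j => T i j) k.
Proof.
move=> k0; split=> [h x|h].
  set s := \sum_j hnorm (x j) ^+ 2; have s0 : 0 <= s by apply: sumr_ge0 => j _; rewrite sqr_ge0.
  have [sz|sn] := eqVneq s 0.
    rewrite big1 ?sz ?mulr0// => i _.
    rewrite (_ : \sum_j T i j (x j) = 0) ?hnorm0 ?expr0n//; apply: big1 => j _.
    have /eqP : hnorm (x j) ^+ 2 = 0.
      apply/eqP; rewrite eq_le sqr_ge0 andbT -sz /s (bigD1 j)//= lerDl.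
      by apply: sumr_ge0 => i' _; rewrite sqr_ge0.
    by rewrite sqrf_eq0 => /eqP/hnorm_eq0 ->; rewrite linear0.
  have sp : 0 < s by rewrite lt_def sn.
  pose q := Num.sqrt s; have q0 : 0 < q by rewrite sqrtr_gt0.
  have q2 : q ^+ 2 = s by rewrite sqr_sqrtr.
  pose y j := ((q^-1)%:C%C : Cx R) *: x j.
  have qi : `|q^-1| = q^-1 by rewrite ger0_norm// invr_ge0 ltW.
  have y1 : \sum_j hnorm (y j) ^+ 2 <= 1.
    rewrite (eq_bigr (fun j => q^-1 ^+ 2 * hnorm (x j) ^+ 2)) => [|j _].
      by rewrite -mulr_sumr -/s exprVn q2 mulVf.
    by rewrite hnormZR qi exprMn.
  have : ((Num.sqrt (\sum_i hnorm (\sum_j T i j (y j)) ^+ 2))%:E <= k%:E)%E.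
    by apply: le_trans h; apply: ereal_sup_ubound; exists y.
  rewrite lee_fin => h1.
  have h2 : \sum_i hnorm (\sum_j T i j (y j)) ^+ 2 <= k ^+ 2.
    have L0 : 0 <= \sum_i hnorm (\sum_j T i j (y j)) ^+ 2.
      by apply: sumr_ge0 => i _; rewrite sqr_ge0.
    by rewrite -(sqr_sqrtr L0) ler_pXn2r ?nnegrE ?sqrtr_ge0.
  rewrite -ler_pdivrMr// mulrC -q2 -exprVn mulr_sumr.
  apply: le_trans h2; rewrite le_eqVlt; apply/orP; left; apply/eqP.
  apply: eq_bigr => i _.
  rewrite [X in _ = hnorm X ^+ 2](eq_bigr (fun j => ((q^-1)%:C%C : Cx R) *: T i j (x j))).
    by rewrite -scaler_sumr hnormZR qi exprMn.
  by move=> j _; rewrite linearZ.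
apply: ge_ereal_sup => _ [x /= x1 <-]; rewrite lee_fin.
rewrite -[leRHS]ger0_norm// -sqrtr_sqr ler_wsqrtr// (le_trans (h x))//.
by rewrite ler_piMr ?sqr_ge0.
Qed.

Lemma cbnorm_leP (B : set (bop E)) (Phi : bop E -> bop E) (K : R) : 0 <= K ->
  (cbnorm B Phi <= K%:E)%E <-> forall n (T : 'M[bop E]_n), (forall i j, B (T i j)) ->
    mxle (fun i j => T i j) 1 -> mxle (fun i j => Phi (T i j)) K.
Proof.
move=> K0; split=> [h n T BT T1|h].
  have -> : (fun i j => Phi (T i j)) = (fun i j => map_mx Phi T i j).
    by apply/funext => i; apply/funext => j; rewrite mxE.
  apply/(mx_opnorm_le _ K0); apply: le_trans h; apply: ereal_sup_ubound.
  by exists n, T; split=> //; apply/(mx_opnorm_le _ ler01).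
apply: ge_ereal_sup => _ [n [T [BT T1 ->]]]; apply/(mx_opnorm_le _ K0).
move/(mx_opnorm_le _ ler01) : T1 => T1.
have <- : (fun i j => Phi (T i j)) = (fun i j => map_mx Phi T i j).
  by apply/funext => i; apply/funext => j; rewrite mxE.
exact: h.
Qed.

Lemma sum_enum_val (V : nmodType) (I : finType) (f : I -> V) :
  \sum_i f i = \sum_(k < #|I|) f (enum_val k).
Proof. by rewrite (reindex _ (onW_bij _ (@enum_val_bij I))). Qed.

Lemma cbnorm_mxle (B : set (bop E)) (Phi : bop E -> bop E) (K : R) : 0 <= K ->
  (cbnorm B Phi <= K%:E)%E -> forall (I : finType) (T : I -> I -> bop E),
  (forall i j, B (T i j)) -> mxle T 1 -> mxle (fun i j => Phi (T i j)) K.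
Proof.
move=> K0 /(cbnorm_leP B Phi K0) h I T BT T1 x.
pose Tm : 'M[bop E]_#|I| := \matrix_(i, j) T (enum_val i) (enum_val j).
have E1 (y : 'I_#|I| -> E) i : \sum_j T (enum_val i) j (y (enum_rank j)) =
    \sum_j Tm i j (y j).
  by rewrite sum_enum_val; apply: eq_bigr => j _; rewrite enum_valK mxE.
have := h _ Tm _ _ (fun i => x (enum_val i)); rewrite -(sum_enum_val (fun i => hnorm (x i) ^+ 2)).
have -> : \sum_i hnorm (\sum_j Phi (Tm i j) (x (enum_val j))) ^+ 2 =
    \sum_i hnorm (\sum_j Phi (T i j) (x j)) ^+ 2.
  rewrite [RHS]sum_enum_val; apply: eq_bigr => i _; congr (hnorm _ ^+ 2).
  by rewrite [RHS]sum_enum_val; apply: eq_bigr => j _; rewrite mxE.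
apply=> [i j|y]; first by rewrite mxE.
have := T1 (fun i => y (enum_rank i)).
rewrite (@sum_enum_val _ I (fun i => hnorm (\sum_j T i j (y (enum_rank j))) ^+ 2)).
rewrite (@sum_enum_val _ I (fun i => hnorm (y (enum_rank i)) ^+ 2)).
rewrite (eq_bigr (fun i => hnorm (\sum_j Tm i j (y j)) ^+ 2)) => [|i _]; last by rewrite E1.
rewrite [X in _ <= _ * X -> _](eq_bigr (fun i => hnorm (y i) ^+ 2)) => [//|i _].
by rewrite enum_valK.
Qed.

Lemma cbnorm_bound (B : set (bop E)) (Phi : bop E -> bop E) (K m : R) (T : bop E) :
  (forall (a : Cx R) S, B S -> B (a *: S)) ->
  (forall (a : Cx R) S, B S -> Phi (a *: S) = a *: Phi S) ->
  0 <= K -> 0 < m -> (cbnorm B Phi <= K%:E)%E -> B T ->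
  (forall x, hnorm (T x) <= m * hnorm x) -> forall x, hnorm (Phi T x) <= K * m * hnorm x.
Proof.
move=> BZ PZ K0 m0 PK BT Tm x; have mi : 0 < m^-1 by rewrite invr_gt0.
have T1 : mxle (fun _ _ : 'I_1 => ((m^-1)%:C%C : Cx R) *: T) 1.
  move=> y; rewrite !big_ord1 bopZE hnormZR gtr0_norm// expr1n mul1r.
  rewrite ler_pXn2r ?nnegrE ?mulr_ge0 ?hnorm_ge0 ?(ltW mi)//.
  by rewrite ler_pdivrMl.
have := cbnorm_mxle K0 PK (fun _ _ => BZ _ _ BT) T1 (fun=> x).
rewrite !big_ord1 PZ// bopZE hnormZR gtr0_norm// -exprMn.
rewrite ler_pXn2r ?nnegrE ?mulr_ge0 ?hnorm_ge0 ?(ltW mi)// ler_pdivrMl//.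
by rewrite mulrA [m * K]mulrC.
Qed.

End MatrixNorms.

Section FiniteRank.
Variables (R : realType) (E : hilbertType R).
Implicit Types (N : set (bop E)).

(** The b i need not lie in P. Elimination on the first coordinate: if some v in P has a nonzero
    coefficient there, v becomes a generator and is subtracted from the others. *)
Lemma subspace_gens (V : lmodType (Cx R)) n (P : set V) (b : 'I_n -> V) :
  P 0 -> (forall (a : Cx R) u v, P u -> P v -> P (a *: u + v)) ->
  (forall v, P v -> exists c : 'I_n -> Cx R, v = \sum_i c i *: b i) ->
  exists m (g : 'I_m -> V), (forall k, P (g k)) /\
    forall v, P v -> exists c : 'I_m -> Cx R, v = \sum_i c i *: g i.
Proof.
elim: n P b => [|n IHn] P b P0 PD Pb.
  by exists 0%N, b; split=> [[]//|v /Pb].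
have [[v [Pv [c [vE c0]]]]|h] := pselect (exists v, P v /\ exists c : 'I_n.+1 -> Cx R,
    v = \sum_i c i *: b i /\ c ord0 != 0); last first.
  apply: (IHn P (fun i => b (lift ord0 i)) P0 PD) => v Pv.
  have [c vE] := Pb v Pv; exists (fun i => c (lift ord0 i)).
  have c0 : c ord0 = 0.
    by apply: contrapT => /eqP c0; apply: h; exists v; split=> //; exists c.
  by rewrite vE big_ord_recl c0 scale0r add0r.
pose P' : set V := [set w | P w /\ exists d : 'I_n -> Cx R,
  w = \sum_i d i *: b (lift ord0 i)].
have [|k u w [Pu [d uE]] [Pw [e wE]]|w [_ //]|m [g [Pg gP]]] :=
    IHn P' (fun i => b (lift ord0 i)).
- by split=> //; exists (fun=> 0); rewrite big1// => i _; rewrite scale0r.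
- split; first exact: PD.
  exists (fun i => k * d i + e i); rewrite uE wE scaler_sumr -big_split.
  by apply: eq_bigr => i _; rewrite scalerA scalerDl.
exists m.+1, (fun i => if unlift ord0 i is Some j then g j else v); split.
  by move=> i; case: unlift => [j|//]; case: (Pg j).
move=> w Pw; have [d wE] := Pb w Pw.
have [|e weq] := gP (w - (d ord0 / c ord0) *: v).
  split; first by rewrite addrC -scaleNr; exact: PD.
  exists (fun i => d (lift ord0 i) - d ord0 / c ord0 * c (lift ord0 i)).
  rewrite wE vE !big_ord_recl scalerDr scalerA divfK// opprD addrACA subrr add0r.
  rewrite scaler_sumr -sumrB; apply: eq_bigr => i _.
  by rewrite scalerBl scalerA.
exists (fun i => if unlift ord0 i is Some j then e j else d ord0 / c ord0).
rewrite big_ord_recl unlift_none -[LHS](subrK ((d ord0 / c ord0) *: v)) weq addrC.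
by congr (_ + _); apply: eq_bigr => i _; rewrite liftK.
Qed.

Lemma finite_rankD N (Phi Psi : bop E -> bop E) :
  finite_rank N Phi -> finite_rank N Psi -> finite_rank N (fun T => Phi T + Psi T).
Proof.
move=> [n [b hb]] [m [d hd]].
exists (n + m)%N, (fun k => match fintype.split k with inl i => b i | inr j => d j end) => T NT.
have [c ->] := hb T NT; have [e ->] := hd T NT.
exists (fun k => match fintype.split k with inl i => c i | inr j => e j end).
rewrite big_split_ord /=; congr (_ + _); apply: eq_bigr => i _.
  by rewrite (unsplitK (inl i)).
by rewrite (unsplitK (inr i)).
Qed.

Lemma finite_rank_sum N I (r : seq I) (Phi : I -> bop E -> bop E) :
  (forall i, finite_rank N (Phi i)) -> finite_rank N (fun T => \sum_(i <- r) Phi i T).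
Proof.
move=> h; elim: r => [|i r IHr].
  exists 0%N, (fun=> 0) => T _; exists (fun=> 0); by rewrite big_nil big_ord0.
have [n [b hb]] := finite_rankD (h i) IHr.
by exists n, b => T NT; rewrite big_cons; exact: hb.
Qed.

End FiniteRank.

Lemma tails_filter (I : Type) (le : I -> I -> Prop) : directed_set le -> Filter (tails le).
Proof.
move=> [[i0] refl trans dir]; apply: filter_fromT_filter; first by exists i0.
move=> i j; have [k [ik jk]] := dir i j; exists k => l kl.
by split; [exact: trans ik kl|exact: trans jk kl].
Qed.

(** * From weak amenability to the approximation property *)

Section Coefficients.
Variables (R : realType) (G : groupType) (H : hilbertType R).
Variables (M : set (bop H)) (beta : G -> bop H -> bop H).
Hypothesis sys : Wstar_dynamical_system M beta.
Hypothesis separable : exists2 D : set H, countable D & dense D.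
Implicit Types (a b : bop H) (s t r : G) (T S : bop (l2 G H)).

Local Notation N := (crossed_product M beta).

Let MvN : von_neumann M := sys_vN sys.
Let NvN : von_neumann N := crossed_product_vN M beta.

Lemma coef_ufun t p : exists q, forall T,
  ultraweak_functional p (coef T t) = ultraweak_functional q T.
Proof.
case: p => x y.
have [x' x'E] := l2_map (fun=> hnorm_delta (t^-1%g : G)) x.
have [y' y'E] := l2_map (fun=> hnorm_delta (1%g : G)) y.
exists (x', y') => T; congr sum; apply/funext => n /=.
by rewrite x'E y'E coefE ip_deltar.
Qed.

Lemma coef_continuous (B : set (bop (l2 G H))) t : {within B, continuous (fun T => coef T t)}.
Proof.
apply/within_contP => p; have [q qE] := coef_ufun t p.
exact: wcont_eq (fun T _ => esym (qE T)) (wcont_ufun B q).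
Qed.

(** A neighbourhood of T involves finitely many functionals; their first vectors are stacked into
    one, and [span_pl_dense] finds an element of the span in that neighbourhood. *)
Lemma span_ext (f : bop (l2 G H) -> Cx R) : wcont N f ->
  (forall (k : Cx R) T S, N T -> N S -> f (k *: T + S) = k * f T + f S) ->
  (forall a t, M a -> f (pl beta a t) = 0) -> forall T, N T -> f T = 0.
Proof.
move=> fc_ fl f0 T NT; have N0 := vN0 NvN.
have fS S : span_pl M beta S -> f S = 0.
  have fz : f 0 = 0.
    have := fl 1 0 0 N0 N0; rewrite scaler0 addr0 mul1r => h.
    by apply: (addrI (f 0)); rewrite addr0.
  elim=> [//|a t S' Ma sS' h].
  have := fl 1 _ _ (pl_in t Ma) (span_plN sS').
  by rewrite scale1r mul1r => ->; rewrite h f0// addr0.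
apply: cmod_eq0; apply/eqP; rewrite eq_le cmod_ge0 andbT.
apply/ler_addgt0Pr => e e0; rewrite add0r.
have /cvgCP/(_ e e0) := wcontP fc_ NT.
move=> /nbhs_ultraweak[ps [d [d0 hd]]].
pose w (k : 'I_(size ps)) := (nth (0, 0) ps k).1.
have [v [vE vn]] := l2_stack w.
(* c dominates the second vector of every functional in ps, so approximating within d / c suffices
   for all of them; the [+ 1] keeps c positive. *)
pose c := \sum_(k < size ps) hnorm (nth (0, 0) ps k).2 + 1.
have c0 : 0 < c by rewrite ltr_wpDl// sumr_ge0// => k _; exact: hnorm_ge0.
have [S sS hS] := span_pl_dense sys v NT (divr_gt0 d0 c0).
have -> : cmod (f T) = cmod (f S - f T) by rewrite (fS S sS) sub0r cmodN.
apply: (hd S _ (span_plN sS)).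
move=> p pps; have kps : (index p ps < size ps)%N by rewrite index_mem.
pose k := Ordinal kps; have pE : nth (0, 0) ps k = p by rewrite nth_index.
rewrite -cmodN opprB -ufunB ufunE.
have [v' [v'E v'n]] := l2_stack (fun k => diag_op (fun=> T - S) (w k)).
have v'D : v' = diag_op (fun=> T) v - diag_op (fun=> S) v.
  by apply: l2_ext => -[n i]; rewrite v'E l2BE !dcstE vE.
have wk : hnorm (diag_op (fun=> T - S) p.1) <= d / c.
  apply: le_trans hS; rewrite -v'D -(@ler_pXn2r _ 2)// ?nnegrE ?hnorm_ge0// v'n.
  rewrite (bigD1 k)//= /w pE lerDl sumr_ge0// => i _; exact: sqr_ge0.
rewrite (le_trans (cmod_ip _ _))// (le_trans (ler_wpM2r (hnorm_ge0 _) wk))//.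
rewrite mulrAC ler_pdivrMr// ler_wpM2l ?(ltW d0)// /c -pE.
rewrite (bigD1 k)//= -addrA lerDl addr_ge0// sumr_ge0// => i _; exact: hnorm_ge0.
Qed.

(** The spatial implementation gives <beta_t(a) x, y> = sum_n <a (u_n x), u_n y>. *)
Lemma beta_ufun t x y : exists p, forall a, M a ->
  ip (beta t a x) y = ultraweak_functional p a.
Proof.
have [u [uP [U [UE Uip]]]] := spatial_implementation MvN (sys_aut sys t) separable.
exists (U x, U y) => a Ma; rewrite -Uip ip_l2E; congr sum; apply/funext => n /=.
by rewrite !UE uP.
Qed.

End Coefficients.

Section SystemToCBAP.
Variables (R : realType) (G : groupType) (H : hilbertType R).
Variables (M : set (bop H)) (beta : G -> bop H -> bop H).
Hypothesis sys : Wstar_dynamical_system M beta.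
Hypothesis separable : exists2 D : set H, countable D & dense D.

Local Notation N := (crossed_product M beta).
Let MvN : von_neumann M := sys_vN sys.
Let NvN : von_neumann N := crossed_product_vN M beta.

(** Multiplier norms are infima over extensions; the [+ 1] stands in for attainment, since only a
    uniform bound is wanted. *)
Lemma ereal_inf_approx (A : set (\bar R)) (c : R) :
  (ereal_inf A <= c%:E)%E -> exists2 x, A x & (x <= (c + 1)%:E)%E.
Proof.
move=> h; have : (ereal_inf A < (c + 1)%:E)%E.
  by rewrite (le_lt_trans h)// lte_fin ltrDl.
by move=> /ereal_inf_lt[x Ax xc]; exists x => //; exact: ltW.
Qed.

(** Matrix coefficients of both sides are weak*-continuous in T, on the right because [CB_sigma]
    extends F t continuously to M'' = M. They agree on the monomials pi(a) lambda_s, so [span_ext]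
    applies to the difference. *)
Lemma HS_extension_coef F S t T : HS_extension M beta F S ->
  (forall t, CB_sigma (M_beta M beta) (F t)) -> N T -> coef (S T) t = F t (coef T t).
Proof.
move=> [[SN Sl Scb] Sc Spl] Fcb NT.
have [Psi [Pcb Pc PF]] := (Fcb t).2; rewrite M_betaE in Pcb Pc PF.
have [_ MM] := MvN; rewrite MM in Pcb Pc.
case: Pcb => PM Pl _.
have FM s a : M a -> M (F s a).
  by have [[h _ _] _] := Fcb s; rewrite M_betaE in h; exact: h.
have NTt : M (coef T t) := coef_in sys t NT.
rewrite -PF//; apply: bop_ext => x; apply: ip_ext => y; apply/eqP.
rewrite -subr_eq0 -mulN1r; apply/eqP.
pose f T := ip (coef (S T) t x) y + -1 * ip (Psi (coef T t) x) y.
apply: (@span_ext _ _ _ _ _ sys f) => // [|k T1 T2 NT1 NT2|a s Ma].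
- apply: wcontD; last apply: wcontZ.
    apply: (wcont_eq (f := fun T => ip (S T (delta t^-1%g x)) (delta 1%g y))).
      by move=> T' _; rewrite coefE ip_deltar.
    exact: (wcont_comp SN Sc (wcont_vec N (delta t^-1%g x) (delta 1%g y))).
  apply: (wcont_comp (N2 := M) (Phi := fun T => coef T t)
    (f := fun b => ip (Psi b x) y)) => [T' NT'||].
  - exact: (coef_in sys).
  - exact: coef_continuous.
  - exact: (wcont_comp PM Pc (wcont_vec M x y)).
- rewrite /f Sl// !coefP Pl//; try exact: (coef_in sys).
  by rewrite !bopDE !bopZE !ipDl !ipZl; ring.
have Psi0 := linear_on0 MvN Pl.
rewrite /f {1}/pl Spl ?M_betaE// -/(pl _ _ _) !(coef_pl sys)//; last exact: FM.
case: eqP => [ts|_]; first by rewrite PF// ts mulN1r subrr.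
by rewrite Psi0 !bop0E !ip0l mulr0 addr0.
Qed.

(** [pl] is known to be linear on M only, while the vectors witnessing finite rank may lie outside
    M; [subspace_gens] moves them into the range of Phi. *)
Lemma finite_rank_pl (Phi : bop H -> bop H) t :
  (forall a, M a -> M (Phi a)) -> linear_on M Phi -> finite_rank M Phi ->
  finite_rank N (fun T => pl beta (Phi (coef T t)) t).
Proof.
move=> PM Pl [n [b hb]].
have [|k u v [a Ma <-] [a' Ma' <-]|v [a Ma <-]|m [g [gP hg]]] :=
    @subspace_gens R (bop H) n (Phi @` M) b.
- by exists 0; [exact: vN0|exact: linear_on0 Pl].
- exists (k *: a + a'); last exact: Pl.
  by apply: (vND MvN) => //; exact: (vNZ MvN).
- exact: hb.
have Mg k : M (g k) by case: (gP k) => a Ma <-; exact: PM.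
exists m, (fun k => pl beta (g k) t) => T NT.
have [|c hc] := hg (Phi (coef T t)).
  by exists (coef T t) => //; exact: (coef_in sys).
exists c; rewrite hc.
suff h (r : seq 'I_m) : M (\sum_(i <- r) c i *: g i) /\
    pl beta (\sum_(i <- r) c i *: g i) t = \sum_(i <- r) c i *: pl beta (g i) t.
  by case: (h (index_enum 'I_m)).
elim: r => [|i r [Mr IHr]].
  by rewrite !big_nil (pl0 sys); split=> //; exact: vN0.
rewrite !big_cons -IHr (plP sys)//; split=> //.
by apply: (vND MvN) => //; exact: (vNZ MvN).
Qed.

Lemma weakly_amenable_system_CBAP : weakly_amenable_system M beta -> weakstar_CBAP N.
Proof.
move=> [I [le [F [dir Fms Fcb Fcvg [c0 Fc]]]]].
pose c := Num.max c0 0 + 1.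
have cp : 0 <= c by rewrite addr_ge0// le_max lexx orbT.
have /choice[S SP] i : exists S, HS_extension M beta (F i) S /\ (cbnorm N S <= c%:E)%E.
  have [_ [S FS <-] Sc] := ereal_inf_approx (Fc i); exists S; split=> //.
  by apply: le_trans Sc _; rewrite lee_fin lerD2r le_max lexx.
have Sco i t T : N T -> coef (S i T) t = F i t (coef T t).
  move=> NT; apply: HS_extension_coef => //; first by case: (SP i).
  by move=> s; case: (Fcb i s).
have FM i t a : M a -> M (F i t a).
  by have [[[h _ _] _] _] := Fcb i t; rewrite M_betaE in h; exact: h.
have Fl i t : linear_on M (F i t).
  by have [[[_ h _] _] _] := Fcb i t; rewrite M_betaE in h.
have NS i T : N T -> N (S i T) by have [[[h _ _] _ _] _] := SP i; exact: h.
have /choice[supp suppP] i : exists A : seq G, uniq A /\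
    forall t, t \notin A -> forall a, M a -> F i t a = 0.
  have [_ /finite_seqP[A hA]] := Fms i; exists (undup A); split; first exact: undup_uniq.
  move=> t tA a Ma; apply: contrapT => Fa; move: tA; rewrite mem_undup => /negP; apply.
  have : [set` A] t by rewrite -hA; exists a; rewrite ?M_betaE//; apply/eqP.
  by [].
have SE i T : N T -> S i T = \sum_(t <- supp i) pl beta (F i t (coef T t)) t.
  move=> NT; have MF t : M (F i t (coef T t)) by apply: FM; exact: (coef_in sys).
  have [Au Az] := suppP i.
  apply: (crossed_product_ext sys separable); first exact: NS.
    by apply: (vN_sum NvN) => t _; exact: (pl_in t (MF t)).
  move=> t; rewrite Sco//.
  have -> : coef (\sum_(s <- supp i) pl beta (F i s (coef T s)) s) t =
      \sum_(s <- supp i) (if t == s then F i s (coef T s) else 0).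
    elim: (supp i) => [|s A IHA].
      by rewrite !big_nil; apply: bop_ext => x; rewrite coefE.
    rewrite !big_cons -IHA -[pl _ _ _]scale1r coefP scale1r; congr (_ + _).
    by rewrite (coef_pl sys).
  have [tA|tA] := boolP (t \in supp i).
    rewrite (bigD1_seq t)//= eqxx big1 ?addr0// => s; rewrite eq_sym.
    by move=> /negbTE ->.
  rewrite big1_seq; first by rewrite Az//; exact: (coef_in sys).
  move=> s /andP[_ sA]; case: eqP => // ts; by rewrite ts sA in tA.
have Sfr i : finite_rank N (S i).
  have [n [b hb]] : finite_rank N (fun T => \sum_(t <- supp i) pl beta (F i t (coef T t)) t).
    apply: finite_rank_sum => t; apply: (finite_rank_pl _ (FM i t) (Fl i t)).
    have [_ [Psi [_ Pfr PF]]] := Fcb i t; case: Pfr => n [b hb]; exists n, b => T MT.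
    by rewrite -PF ?M_betaE//; exact: hb.
  by exists n, b => T NT; rewrite SE//; exact: hb.
exists I, le, S; split=> // [i|T NT|].
- by have [[h1 h2 _] _] := SP i; split.
- have FF := tails_filter dir.
  have [m0 m0p Tm0] := bop_bound T; pose m := m0 + 1.
  have mp : 0 < m by rewrite ltr_wpDl.
  have Tm x : hnorm (T x) <= m * hnorm x.
    by rewrite (le_trans (Tm0 x))// ler_wpM2r ?hnorm_ge0// lerDl.
  apply: (@bounded_net_cvg_l2 R I (tails le) FF H G (fun i => S i T) T (c * m)).
  + by rewrite mulr_ge0// ltW.
  + move=> i; have [[[_ Sl _] _ _] Sc] := SP i.
    apply: (cbnorm_bound (B := N)) => //; first by move=> a S' NS'; exact: (vNZ NvN).
    move=> a S' NS'; have := Sl a S' 0 NS' (vN0 NvN).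
    by rewrite (linear_on0 NvN Sl) !addr0.
  + move=> s r x y; rewrite (entryE sys separable)//.
    set t := (r * s^-1)%g; set a := coef T t.
    have Ma : M a by exact: (coef_in sys).
    have [p pP] := beta_ufun sys separable r^-1%g x y.
    have F1 : Filter ((fun i => F i t a) @ tails le) by exact: fmap_filter.
    have F2 := proj1 (ultraweak_cvgP a F1) (Fcvg t a Ma) p.
    rewrite pP//; have h := proj1 (cvgCP FF _ _) F2.
    apply/cvgCP => e e0; apply: filterS (h e e0) => i.
    rewrite (entryE sys separable); last exact: NS.
    by rewrite Sco// pP//; exact: FM.
- by exists c => i; case: (SP i).
Qed.

End SystemToCBAP.

(** * Schur multipliers *)

Section FiniteL2.
Variables (R : realType) (E : hilbertType R) (I : choiceType) (A : finType).

Lemma le_hnorm_inj (g : A -> I) (v : l2 I E) : injective g ->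
  \sum_r hnorm (v (g r)) ^+ 2 <= hnorm v ^+ 2.
Proof.
move=> gi; apply: le_trans (le_hnorm_l2 v [fset g r | r in A]%fset).
by rewrite big_imfset /=; [rewrite big_enum|move=> ? ? _ _ /gi].
Qed.

Lemma hnorm_sum_delta (g : A -> I) (y : A -> E) : injective g ->
  hnorm (\sum_s delta (g s) (y s)) ^+ 2 = \sum_s hnorm (y s) ^+ 2.
Proof.
move=> gi; rewrite -ripxx rip_suml; apply: eq_bigr => s _.
rewrite rip_sumr (bigD1 s)//= big1 ?addr0 => [|s' s's].
  by rewrite /rip ip_deltar deltaE eqxx -/(rip _ _) ripxx.
by rewrite /rip ip_deltar deltaE (inj_eq gi) (negbTE s's) ip0l.
Qed.

Lemma rip_amgm (u w : E) : 2 * rip u w <= hnorm u ^+ 2 + hnorm w ^+ 2.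
Proof. by have := sqr_ge0 (hnorm (u - w)); rewrite hnorm_sqrB subr_ge0. Qed.

End FiniteL2.

Section SchurMultipliers.
Variables (R : realType).

Definition scle (A : finType) (z : A -> A -> Cx R) (k : R) : Prop :=
  forall a : A -> Cx R, \sum_r cmod (\sum_s z r s * a s) ^+ 2 <=
    k ^+ 2 * \sum_s cmod (a s) ^+ 2.

Lemma Re_mul_amgm (u w : Cx R) : 2 * complex.Re (u * w) <= cmod u ^+ 2 + cmod w ^+ 2.
Proof.
have h : complex.Re (u * w) <= cmod u * cmod w.
  by rewrite -cmodM (le_trans (ler_norm _))// Re_cmod.
have := sqr_ge0 (cmod u - cmod w); rewrite sqrrB; lra.
Qed.

(* The block entries are normalised to unit vectors, which reduces the bound for
   operator blocks to the scalar one. *)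
Lemma schur_block (E : hilbertType R) (A J : finType) (psi : A -> A -> Cx R) (K1 K2 : R)
    (P : A * J -> A * J -> bop E) (x w : A * J -> E) : 0 <= K1 -> 0 <= K2 ->
  (forall z, scle z K1 -> scle (fun r s => psi r s * z r s) (K2 * K1)) ->
  mxle P K1 ->
  2 * complex.Re (\sum_r \sum_s psi r s *
    \sum_i \sum_j ip (P (r, i) (s, j) (x (s, j))) (w (r, i))) <=
  (K2 * K1) ^+ 2 * \sum_q hnorm (x q) ^+ 2 + \sum_q hnorm (w q) ^+ 2.
Proof.
move=> K10 K20 Psi PK.
pose X s := Num.sqrt (\sum_j hnorm (x (s, j)) ^+ 2).
pose Y r := Num.sqrt (\sum_i hnorm (w (r, i)) ^+ 2).
have sum0 (f : J -> R) : 0 <= \sum_j f j ^+ 2 by apply: sumr_ge0 => j _; exact: sqr_ge0.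
have X2 s : X s ^+ 2 = \sum_j hnorm (x (s, j)) ^+ 2 by rewrite sqr_sqrtr.
have Y2 r : Y r ^+ 2 = \sum_j hnorm (w (r, j)) ^+ 2 by rewrite sqr_sqrtr.
have zero (f : J -> R) : \sum_j f j ^+ 2 = 0 -> forall j, f j = 0.
  move=> f0 j; apply/eqP; rewrite -sqrf_eq0 eq_le sqr_ge0 andbT -f0.
  by rewrite (bigD1 j)//= lerDl sumr_ge0// => i _; exact: sqr_ge0.
have X0 s : X s = 0 -> forall j, x (s, j) = 0.
  move=> Xs j; apply: hnorm_eq0; apply: (zero (fun j => hnorm (x (s, j)))).
  by rewrite -X2 Xs expr0n.
have Y0 r : Y r = 0 -> forall j, w (r, j) = 0.
  move=> Xs j; apply: hnorm_eq0; apply: (zero (fun j => hnorm (w (r, j)))).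
  by rewrite -Y2 Xs expr0n.
pose z r s := \sum_i \sum_j ip (P (r, i) (s, j) (x (s, j))) (w (r, i)).
(* If X s = 0 the inverse is 0 by convention and the block of x at s vanishes, so x = X xh holds in
   every case. *)
have [xh xhE] : exists xh, forall q, xh q = (((X q.1)^-1)%:C%C : Cx R) *: x q by eexists.
have [wh whE] : exists wh, forall q, wh q = (((Y q.1)^-1)%:C%C : Cx R) *: w q by eexists.
pose zh r s := \sum_i \sum_j ip (P (r, i) (s, j) (xh (s, j))) (wh (r, i)).
have xE q : x q = ((X q.1)%:C%C : Cx R) *: xh q.
  case: q => s j; rewrite xhE scalerA -rmorphM /=.
  have [Xs|Xs] := eqVneq (X s) 0; first by rewrite (X0 s Xs) scaler0.
  by rewrite divff// scale1r.
have wE q : w q = ((Y q.1)%:C%C : Cx R) *: wh q.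
  case: q => s j; rewrite whE scalerA -rmorphM /=.
  have [Xs|Xs] := eqVneq (Y s) 0; first by rewrite (Y0 s Xs) scaler0.
  by rewrite divff// scale1r.
have zE r s : z r s = (Y r)%:C%C * (zh r s * (X s)%:C%C).
  rewrite /z /zh mulr_suml mulr_sumr; apply: eq_bigr => i _.
  rewrite mulr_suml mulr_sumr; apply: eq_bigr => j _.
  by rewrite xE wE linearZ/= ipZl ipZr conjRC /=; ring.
have unit_le (f : J -> E) (a : Cx R) (m : R) : m ^+ 2 = \sum_j hnorm (f j) ^+ 2 ->
    \sum_j hnorm (a *: ((m^-1)%:C%C *: f j)) ^+ 2 <= cmod a ^+ 2.
  move=> m2; rewrite (eq_bigr (fun j => cmod a ^+ 2 * m^-1 ^+ 2 * hnorm (f j) ^+ 2)); last first.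
    by move=> j _; rewrite hnormZ hnormZR !exprMn real_normK ?num_real// mulrA.
  rewrite -mulr_sumr -m2 -mulrA ler_piMr ?sqr_ge0// -exprMn.
  by have [->|m0] := eqVneq m 0; rewrite ?mulr0 ?expr0n ?ler01// mulVf// expr1n.
have xh1 s (a : Cx R) : \sum_j hnorm (a *: xh (s, j)) ^+ 2 <= cmod a ^+ 2.
  apply: le_trans (unit_le (fun j => x (s, j)) a (X s) (X2 s)).
  by apply: ler_sum => j _; rewrite xhE.
have wh1 s (a : Cx R) : \sum_j hnorm (a *: wh (s, j)) ^+ 2 <= cmod a ^+ 2.
  apply: le_trans (unit_le (fun j => w (s, j)) a (Y s) (Y2 s)).
  by apply: ler_sum => j _; rewrite whE.
have pairs (V : nmodType) (f : A * J -> V) : \sum_q f q = \sum_r \sum_i f (r, i).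
  by rewrite pair_bigA /=; apply: eq_bigr => -[].
(* zh compresses P along block vectors of norm at most 1. Pairing P applied to a xh with b wh
   recovers |b|^2, and 2 |b|^2 <= |u|^2 + |b|^2 leaves |b|^2 <= |u|^2. *)
have zhK : scle zh K1.
  move=> a; pose b r := \sum_s zh r s * a s.
  pose u q := \sum_q' P q q' (a q'.1 *: xh q').
  have uK : \sum_q hnorm (u q) ^+ 2 <= K1 ^+ 2 * \sum_s cmod (a s) ^+ 2.
    rewrite (le_trans (PK (fun q => a q.1 *: xh q)))// ler_wpM2l ?sqr_ge0//.
    by rewrite pairs; apply: ler_sum => s _ /=; exact: (xh1 s (a s)).
  have bE : \sum_r cmod (b r) ^+ 2 = \sum_q rip (u q) (b q.1 *: wh q).
    rewrite pairs; apply: eq_bigr => r _.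
    have -> : cmod (b r) ^+ 2 = complex.Re ((b r)^* * b r) by rewrite mulJ.
    rewrite {2}/b /rip -Re_sum mulr_sumr; congr complex.Re.
    rewrite (eq_bigr (fun s => \sum_i \sum_j
        ip (P (r, i) (s, j) (a s *: xh (s, j))) (b r *: wh (r, i)))) => [|s _]; last first.
      rewrite /zh mulr_suml mulr_sumr; apply: eq_bigr => i _.
      rewrite mulr_suml mulr_sumr; apply: eq_bigr => j _.
      by rewrite linearZ/= ipZl ipZr; ring.
    rewrite exchange_big; apply: eq_bigr => i _ /=.
    by rewrite /u ip_suml pairs.
  have : 2 * \sum_r cmod (b r) ^+ 2 <=
      \sum_q hnorm (u q) ^+ 2 + \sum_r cmod (b r) ^+ 2.
    rewrite {1}bE mulr_sumr.
    apply: (@le_trans _ _ (\sum_q (hnorm (u q) ^+ 2 + hnorm (b q.1 *: wh q) ^+ 2))).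
      by apply: ler_sum => q _; exact: rip_amgm.
    rewrite big_split lerD2l /= pairs; apply: ler_sum => r _; exact: (wh1 r (b r)).
  move: uK; rewrite /b; lra.
have := Psi zh zhK (fun s => (X s)%:C%C).
rewrite [X in _ <= _ * X](eq_bigr (fun s => X s ^+ 2)) => [|s _]; last first.
  by rewrite cmodR real_normK ?num_real.
pose g r := \sum_s psi r s * zh r s * (X s)%:C%C.
rewrite -/(g _) => gK.
have -> : \sum_r \sum_s psi r s * z r s = \sum_r (Y r)%:C%C * g r.
  apply: eq_bigr => r _; rewrite /g mulr_sumr; apply: eq_bigr => s _.
  by rewrite zE; ring.
rewrite Re_sum.
apply: (@le_trans _ _ (\sum_r (cmod (g r) ^+ 2 + Y r ^+ 2))).
  rewrite mulr_sumr; apply: ler_sum => r _.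
  have := Re_mul_amgm (g r) (Y r)%:C%C; rewrite cmodR real_normK ?num_real//.
  by rewrite [g r * _]mulrC.
rewrite big_split /= lerD//; last by rewrite pairs; apply: ler_sum => r _; rewrite Y2.
apply: le_trans gK _; rewrite ler_wpM2l ?sqr_ge0// pairs.
by apply: ler_sum => r _; rewrite X2.
Qed.

End SchurMultipliers.

(** * From multipliers of the Fourier algebra to Schur multipliers *)

Section GroupMultipliers.
Variables (R : realType) (G : groupType).
Local Notation lam := (@lambda_op R G (scal R)).
Local Notation VN := (@group_vN R G).

Lemma esum_l2_mulg (E : hilbertType R) (v : l2 G E) h : (hnorm v ^+ 2)%:E =
  \esum_(w in [set: G]) (hnorm (v (h * w)%g) ^+ 2)%:E.
Proof.
rewrite -esum_l2 -(@esum_bij _ _ _ (fun w => (h * w)%g) (fun w => (h^-1 * w)%g)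
  (fun w => (hnorm (v w) ^+ 2)%:E))//.
  by move=> w; rewrite mulKg.
by move=> w; rewrite mulVKg.
Qed.

Lemma lam_delta (E : hilbertType R) (t s : G) (x : E) :
  lambda_op E t (delta s x) = delta (t * s)%g x.
Proof.
apply: l2_ext => r; rewrite lambda_opE !deltaE.
by rewrite (can2_eq (mulVKg t) (mulKg t)).
Qed.

(** Pairing [lam t] with a coefficient function evaluates the function at t, so by duality S
    multiplies [lam t] by phi t. *)
Lemma multiplier_scale (phi : G -> Cx R) S :
  (forall u, fourier_algebra u -> fourier_algebra (fun t => phi t * u t)) ->
  multiplier_adjoint phi S ->
  forall (k : Cx R) t, S (k *: lam t) = (k * phi t) *: lam t.
Proof.
move=> phiA Sphi k t; apply: bop_ext => xi; apply: ip_ext => eta.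
have [|xi' [eta' xe]] := phiA (coefficient xi eta); first by exists xi, eta.
have Nt : VN (k *: lam t).
  apply: (vNZ (generated_vN_von_neumann _)); apply: sub_generated_vN.
  by exists t.
rewrite (Sphi _ xi eta xi' eta' Nt) ?xe//.
rewrite !bopZE !ipZl -mulrA; congr (_ * _).
by have := congr1 (fun f => f t) xe; rewrite /coefficient.
Qed.

(** Conjugating z, tensored with the identity, by the diagonal unitary with entries lambda_{g r}
    gives the entries z_{rs} lambda_{g r (g s)^-1}, so their matrix has norm at most K1. S applied
    entrywise inserts the factors phi(g r (g s)^-1) at the cost of K2. *)
Lemma schur_of_multiplier (phi : G -> Cx R) S (K1 K2 : R) (A : finType) (g : A -> G)
    (z : A -> A -> Cx R) : 0 < K1 -> 0 <= K2 ->
  (forall u, fourier_algebra u -> fourier_algebra (fun t => phi t * u t)) ->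
  multiplier_adjoint phi S -> (cbnorm VN S <= K2%:E)%E ->
  scle z K1 -> scle (fun r s => phi (g r * (g s)^-1)%g * z r s) (K2 * K1).
Proof.
move=> K10 K20 phiA Sphi SK zK a.
pose T r s := ((K1^-1)%:C%C * z r s) *: lam (g r * (g s)^-1)%g.
have NT r s : VN (T r s).
  apply: (vNZ (generated_vN_von_neumann _)); apply: sub_generated_vN.
  by exists (g r * (g s)^-1)%g.
have T1 : mxle T 1.
  move=> x; rewrite expr1n mul1r -lee_fin -!sumEFin.
  rewrite (eq_bigr (fun r => \esum_(w in [set: G])
      (hnorm (\sum_s (((K1^-1)%:C%C * z r s) *: x s (g s * w)%g : scal R)) ^+ 2)%:E)); last first.
    move=> r _; rewrite (esum_l2_mulg _ (g r)); apply: eq_esum => w _.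
    congr ((hnorm _ ^+ 2)%:E); rewrite l2_sumE; apply: eq_bigr => s _.
    by rewrite bopZE l2ZE lambda_opE invgM invgK -mulgA mulKg.
  rewrite [leRHS](eq_bigr (fun s => \esum_(w in [set: G])
      (hnorm (x s (g s * w)%g) ^+ 2)%:E)); last by move=> s _; rewrite (esum_l2_mulg _ (g s)).
  rewrite -!esum_sum; try by move=> *; rewrite lee_fin sqr_ge0.
  apply: le_esum => w _; rewrite !sumEFin lee_fin.
  have := zK (fun s => (K1^-1)%:C%C * x s (g s * w)%g).
  rewrite [X in _ <= _ * X](eq_bigr (fun s => K1^-1 ^+ 2 * hnorm (x s (g s * w)%g) ^+ 2)).
    rewrite -mulr_sumr mulrA -exprMn divff ?gt_eqF// expr1n mul1r.
    apply: le_trans; rewrite le_eqVlt; apply/orP; left; apply/eqP.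
    apply: eq_bigr => r _; congr (cmod _ ^+ 2); apply: eq_bigr => s _.
    by rewrite [RHS]mulrA [z r s * _]mulrC.
  move=> s _; rewrite cmodM cmodR exprMn real_normK ?num_real//.
(* On these vectors all terms of row r are multiples of the delta at g r, so the operator bound
   becomes the scalar one. *)
have := cbnorm_mxle K20 SK NT T1 (fun s => delta (g s) (a s : scal R)).
rewrite [X in _ <= _ * X](eq_bigr (fun s => cmod (a s) ^+ 2)) => [h|s _]; last first.
  by rewrite hnorm_delta.
rewrite exprMn mulrAC -ler_pdivrMr ?exprn_gt0// -exprVn mulrC mulr_sumr.
apply: le_trans h; rewrite le_eqVlt; apply/orP; left; apply/eqP.
apply: eq_bigr => r _.
rewrite (eq_bigr (fun s => delta (g r) (((K1^-1)%:C%C * z r s *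
    phi (g r * (g s)^-1)%g) *: (a s : scal R)))) => [|s _]; last first.
  by rewrite (multiplier_scale phiA Sphi) bopZE lam_delta mulgVK linearZ.
rewrite -linear_sum hnorm_delta.
have ki : K1^-1 = cmod ((K1^-1)%:C%C : Cx R) by rewrite cmodR ger0_norm// invr_ge0 ltW.
rewrite [X in X ^+ 2 * _]ki -exprMn -cmodM mulr_sumr.
congr (cmod _ ^+ 2); apply: eq_bigr => s _.
transitivity ((K1^-1)%:C%C * z r s * phi (g r * (g s)^-1)%g * a s); first by ring.
by [].
Qed.

End GroupMultipliers.

(** * From the approximation property to weak amenability *)

Section MatrixTruncation.
Variables (R : realType) (I : choiceType) (E : hilbertType R).
Implicit Types (f : {fset I} -> l2 I E) (l : l2 I E).

Definition hcvg f l : Prop :=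
  forall e : R, 0 < e -> \forall A \near totally, hnorm (f A - l) <= e.

Lemma hcvg_restr l : hcvg (fun A => restr A l) l.
Proof.
move=> e e0; have [A hA] := l2_finite_approx l e0; exists A => // B AB /=.
by rewrite hnormBC; exact: hA.
Qed.

Lemma hnorm_restr_le A l : hnorm (restr A l) <= hnorm l.
Proof.
rewrite -(@ler_pXn2r _ 2)// ?nnegrE ?hnorm_ge0//; apply: hnorm_l2_le => B.
apply: le_trans (le_hnorm_l2 l B); apply: ler_sum => i _; rewrite restrE.
by case: ifP => // _; rewrite hnorm0 expr0n sqr_ge0.
Qed.

Lemma hcvg_restr_diag f l : hcvg f l -> hcvg (fun A => restr A (f A)) l.
Proof.
move=> fl e e0; have e2 : 0 < e / 2 by rewrite divr_gt0.
apply: filterS2 (fl _ e2) (hcvg_restr l e2) => A h1 h2.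
have -> : restr A (f A) - l = restr A (f A - l) + (restr A l - l).
  apply: l2_ext => i; rewrite !(l2DE, l2NE, restrE).
  by case: ifP => _; rewrite ?add0r// addrA subrK.
rewrite (le_trans (hnormD _ _))// [leRHS]splitr lerD//.
exact: le_trans (hnorm_restr_le _ _) h1.
Qed.

Lemma hcvg_bop (T : bop (l2 I E)) f l : hcvg f l -> hcvg (fun A => T (f A)) (T l).
Proof.
move=> fl e e0; have [m m0 Tm] := bop_bound T.
have m1 : 0 < m + 1 by rewrite ltr_wpDl.
apply: filterS (fl _ (divr_gt0 e0 m1)) => A h.
rewrite -linearB (le_trans (Tm _))// (le_trans (ler_wpM2l m0 h))//.
by rewrite mulrCA ler_piMr ?(ltW e0)// ler_pdivrMr// mul1r lerDl.
Qed.

Lemma hcvg_sum J (r : seq J) (f : J -> {fset I} -> l2 I E) (l : J -> l2 I E) :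
  (forall j, hcvg (f j) (l j)) ->
  hcvg (fun A => \sum_(j <- r) f j A) (\sum_(j <- r) l j).
Proof.
move=> h; elim: r => [|j r IHr] e e0.
  by apply: (@filterE _ totally) => A; rewrite !big_nil subrr hnorm0 ltW.
have e2 : 0 < e / 2 by rewrite divr_gt0.
apply: filterS2 (h j _ e2) (IHr _ e2) => A h1 h2.
rewrite !big_cons opprD addrACA (le_trans (hnormD _ _))// [leRHS]splitr.
exact: lerD.
Qed.

Lemma hcvg_sqr_sum (J : finType) (f : J -> {fset I} -> l2 I E) (l : J -> l2 I E) (c : R) :
  (forall j, hcvg (f j) (l j)) -> (forall A, \sum_j hnorm (f j A) ^+ 2 <= c) ->
  \sum_j hnorm (l j) ^+ 2 <= c.
Proof.
move=> fl fc.
have h j : hnorm (f j A) @[A --> totally] --> hnorm (l j).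
  apply/cvgrPdist_le => e e0; apply: filterS (fl j _ e0) => A; apply: le_trans.
  by rewrite distrC; exact: hnorm_dist.
have h2 (r : seq J) : (\sum_(j <- r) hnorm (f j A) ^+ 2) @[A --> totally] -->
    \sum_(j <- r) hnorm (l j) ^+ 2.
  elim: r => [|j r IHr].
    rewrite big_nil; have h0 := @cvg_cst R (0 : R) _ (@totally I) totally_filter; apply: cvg_trans h0.
    by apply: near_eq_cvg; apply: (@filterE _ totally) => A; rewrite big_nil.
  rewrite big_cons; apply: cvg_trans (cvgD (cvgM (h j) (h j)) IHr).
  by apply: near_eq_cvg; apply: (@filterE _ totally) => A; rewrite big_cons.
by apply: (cvgr_to_le (h2 _)); apply: (@filterE _ totally).
Qed.

(** The Schur estimates concern finite matrices; truncations converge strongly along the finite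
    subsets, so bounds uniform in A pass to B. *)
Lemma mxle_of_restr (J : finType) (B : J -> J -> bop (l2 I E)) (k : R) :
  (forall A (x : J -> l2 I E),
    \sum_i hnorm (restr A (\sum_j B i j (restr A (x j)))) ^+ 2 <=
    k ^+ 2 * \sum_j hnorm (x j) ^+ 2) -> mxle B k.
Proof.
move=> h x; apply: hcvg_sqr_sum (fun A => h A x) => i.
apply: hcvg_restr_diag; apply: hcvg_sum => j; apply: hcvg_bop; exact: hcvg_restr.
Qed.

End MatrixTruncation.

Section DiagonalMatrices.
Variables (R : realType) (G : groupType) (H : hilbertType R).
Variables (M : set (bop H)) (beta : G -> bop H -> bop H).
Hypothesis sys : Wstar_dynamical_system M beta.
Hypothesis separable : exists2 D : set H, countable D & dense D.
Local Notation N := (crossed_product M beta).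

(** For fixed w, the value of block row r at g r w involves only the X at g s w, and the resulting
    map is the compression of T to the coordinates g s w. Summing the squared bounds over w gives
    the claim. *)
Lemma fc_matrix_le (A J : finType) (g : A -> G) (T : J -> J -> bop (l2 G H)) :
  injective g -> (forall i j, N (T i j)) -> mxle T 1 ->
  mxle (fun p q : A * J => fc beta (T p.2 q.2) (g p.1 * (g q.1)^-1)%g) 1.
Proof.
move=> gi NT T1 X.
have pairs (V : nmodType) (f : A * J -> V) : \sum_q f q = \sum_j \sum_r f (r, j).
  by rewrite exchange_big pair_bigA /=; apply: eq_bigr => -[].
pose xw w j := \sum_s delta (g s * w)%g (X (s, j) (g s * w)%g) : l2 G H.
rewrite expr1n mul1r -lee_fin -!sumEFin.
rewrite (eq_bigr (fun p => \esum_(w in [set: G])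
    (hnorm ((\sum_j T p.2 j (xw w j)) (g p.1 * w)%g) ^+ 2)%:E)); last first.
  move=> [r i] _; rewrite (esum_l2_mulg _ (g r)); apply: eq_esum => w _ /=.
  congr ((hnorm _ ^+ 2)%:E); rewrite !l2_sumE pairs; apply: eq_bigr => j _ /=.
  rewrite linear_sum l2_sumE; apply: eq_bigr => s _.
  by rewrite (fcE sys separable)// invgM invgK -!mulgA !(mulKg, mulVKg).
rewrite [leRHS](eq_bigr (fun q => \esum_(w in [set: G])
    (hnorm (X q (g q.1 * w)%g) ^+ 2)%:E)); last by move=> q _; rewrite (esum_l2_mulg _ (g q.1)).
rewrite -!esum_sum; try by move=> *; rewrite lee_fin sqr_ge0.
apply: le_esum => w _; rewrite !sumEFin lee_fin.
have giw : injective (fun s => (g s * w)%g) by move=> ? ? /mulIg/gi.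
apply: (@le_trans _ _ (\sum_i hnorm (\sum_j T i j (xw w j)) ^+ 2)).
  by rewrite pairs; apply: ler_sum => i _; exact: (le_hnorm_inj (\sum_j T i j (xw w j)) giw).
apply: le_trans (T1 (xw w)) _; rewrite expr1n mul1r pairs.
by apply: ler_sum => j _; rewrite /xw hnorm_sum_delta.
Qed.

End DiagonalMatrices.

Section IteratedL2.
Variables (R : realType) (I J : choiceType) (E : hilbertType R).

Lemma l2_uncurry : exists V : l2 I (l2 J E) -> l2 (I * J)%type E,
  (forall v q, V v q = v q.1 q.2) /\ forall v w, ip (V v) (V w) = ip v w.
Proof.
have gE (v : l2 I (l2 J E)) :
    \esum_(q in [set: I * J]) (hnorm (v q.1 q.2) ^+ 2)%:E = (hnorm v ^+ 2)%:E.
  rewrite -esum_l2 (eq_esum (b := fun i => \esum_(j in [set: J]) (hnorm (v i j) ^+ 2)%:E)).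
    rewrite esum_esum => [|i j _ _]; last by rewrite lee_fin sqr_ge0.
    by congr (esum _ _); apply/seteqP; split.
  by move=> i _; rewrite esum_l2.
have /choice[V VP] (v : l2 I (l2 J E)) : exists u : l2 (I * J)%type E,
    (forall q, u q = v q.1 q.2) /\ hnorm u ^+ 2 <= hnorm v ^+ 2.
  by apply: mkl2; rewrite gE.
have VE v q : V v q = v q.1 q.2 by case: (VP v).
exists V; split=> //; apply: isometry_ip => [x y|x|x].
- by apply: l2_ext => q; rewrite l2DE !VE !l2DE.
- by apply: l2_ext => q; rewrite l2ZE !VE !l2ZE.
- by apply: EFin_inj; rewrite -gE -esum_l2; apply: eq_esum => q _; rewrite VE.
Qed.

End IteratedL2.

(** * Weak* continuity of Fourier terms *)

Section EmbeddingContinuity.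
Variables (R : realType) (G : groupType) (H : hilbertType R).
Variables (M : set (bop H)) (beta : G -> bop H -> bop H).
Hypothesis G_countable : countable [set: G].
Hypothesis sys : Wstar_dynamical_system M beta.
Hypothesis separable : exists2 D : set H, countable D & dense D.
Local Notation N := (crossed_product M beta).

(** Implementing each beta_{s^-1} by an isometry turns an ultraweak functional of pi(a) lambda_t
    into a sum of <a x, y> over nat * G * nat, a countable index set as G is countable. *)
Lemma pl_continuous t : {within M, continuous (fun a => pl beta a t)}.
Proof.
apply/within_contP => -[v w].
have /choice[U UP] s : exists U : H -> l2 nat H,
    (forall a x, M a -> U (beta s a x) = diag_op (fun=> a) (U x)) /\
    forall x y, ip (U x) (U y) = ip x y.
  have [u [uP [U [UE Uip]]]] :=
    spatial_implementation (sys_vN sys) (sys_aut sys s) separable.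
  exists U; split=> // a x Ma; apply: l2_ext => n.
  by rewrite dcstE !UE uP.
have Un s x : hnorm (U s x) = hnorm x.
  apply/eqP; rewrite -(@eqrXn2 _ 2)// ?hnorm_ge0//.
  by rewrite -!ripxx /rip (UP s).2.
have [V [VE Vip]] := @l2_uncurry R nat G H.
have [V' [V'E V'ip]] := @l2_uncurry R (nat * G)%type nat H.
have h z := l2_map (fun q : nat * G => Un q.2^-1%g) (V z).
have [X XE] := h (diag_op (fun=> lambda_op H t) v).
have [Y YE] := h w.
have /countable_injP[f fi] := G_countable.
have gi : injective (fun q : nat * G * nat => choice.pickle (q.1.1, f q.1.2, q.2)).
  move=> [[n s] k] [[n' s'] k'] /(pcan_inj choice.pickleK)[-> fs ->].
  by rewrite (fi s s'); [|exact: mem_setT|exact: mem_setT|].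
apply: wcont_eq (wcont_ip M (V' X) (V' Y) gi) => a Ma.
rewrite ufunE -Vip.
have -> : diag_op (fun=> a) (V' X) = V' (diag_op (fun=> diag_op (fun=> a)) X).
  by apply: l2_ext => q; rewrite dcstE !V'E !dcstE.
rewrite V'ip !ip_l2E; congr sum; apply/funext => -[n s] /=.
rewrite dcstE XE YE !VE /= !dcstE lambda_opE (plE sys)//.
by rewrite -(UP s^-1%g).1// (UP s^-1%g).2.
Qed.

Lemma fc_continuous t : {within N, continuous (fun T => fc beta T t)}.
Proof.
apply/within_contP => p.
apply: (wcont_comp (N2 := M) (Phi := fun T => coef T t)
  (f := fun a => ultraweak_functional p (pl beta a t))) => [T NT||].
- exact: (coef_in sys).
- exact: coef_continuous.
- exact: (proj1 (within_contP M (fun a => pl beta a t)) (@pl_continuous t) p).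
Qed.

End EmbeddingContinuity.

Section MultiplierMap.
Variables (R : realType) (G : groupType) (H : hilbertType R).
Variables (M : set (bop H)) (beta : G -> bop H -> bop H).
Hypothesis sys : Wstar_dynamical_system M beta.
Hypothesis separable : exists2 D : set H, countable D & dense D.
Local Notation N := (crossed_product M beta).
Let MvN : von_neumann M := sys_vN sys.
Let NvN : von_neumann N := crossed_product_vN M beta.

Lemma fcP (k : Cx R) T S t : N T -> N S ->
  fc beta (k *: T + S) t = k *: fc beta T t + fc beta S t.
Proof. by move=> NT NS; rewrite /fc coefP (plP sys)//; exact: (coef_in sys). Qed.

Variables (phi : G -> Cx R) (A0 : seq G) (Phi : bop (l2 G H) -> bop (l2 G H)).
Hypothesis A0_uniq : uniq A0.
Hypothesis phi0 : forall t, t \notin A0 -> phi t = 0.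
Hypothesis PhiN : forall T, N T -> N (Phi T).
Hypothesis PhiL : linear_on N Phi.

(** The extension S_F as a finite sum; the list A0 contains the support of phi. *)
Definition Smap T := \sum_(t <- A0) phi t *: fc beta (Phi (fc beta T t)) t.

Let NPfc T t : N T -> N (Phi (fc beta T t)).
Proof. by move=> NT; apply: PhiN; exact: (fc_in sys). Qed.

Lemma Smap_in T : N T -> N (Smap T).
Proof.
move=> NT; apply: (vN_sum NvN) => t _; apply: (vNZ NvN); apply: (fc_in sys).
exact: NPfc.
Qed.

Lemma Smap_linear : linear_on N Smap.
Proof.
move=> k T S NT NS; rewrite /Smap scaler_sumr -big_split /=; apply: eq_bigr => t _.
rewrite fcP// PhiL ?fcP//; try exact: NPfc; try exact: (fc_in sys).
by rewrite scalerDr !scalerA mulrC.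
Qed.

Lemma Smap_continuous : countable [set: G] -> {within N, continuous Phi} ->
  {within N, continuous Smap}.
Proof.
move=> Gc Pc; apply/within_contP => p.
have e T : N T -> \sum_(t <- A0) phi t * ultraweak_functional p (fc beta (Phi (fc beta T t)) t)
    = ultraweak_functional p (Smap T).
  move=> _; rewrite /Smap; elim: A0 => [|t A IHA].
    by rewrite !big_nil ufun0.
  by rewrite !big_cons ufunP IHA.
apply: wcont_eq e _; apply: wcont_sum => t; apply: wcontZ.
have c2 := proj1 (within_contP N (fun T => fc beta T t)) (@fc_continuous _ _ _ _ _ Gc sys separable t) p.
have c1 := wcont_comp PhiN Pc c2.
apply: (wcont_comp (N2 := N) (Phi := fun T => fc beta T t) _ _ c1) => [T NT|].
  exact: (fc_in sys).
exact: (@fc_continuous _ _ _ _ _ Gc sys separable t).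
Qed.

(** Only the Fourier term at t = r s^-1 reaches the entry (r, s). This displays [Smap] as a Schur
    multiplication by phi(r s^-1). *)
Lemma Smap_entry T s x r : N T -> Smap T (delta s x) r =
  phi (r * s^-1)%g *: Phi (fc beta T (r * s^-1)%g) (delta s x) r.
Proof.
move=> NT; pose t0 := (r * s^-1)%g.
have e t : t != t0 -> fc beta (Phi (fc beta T t)) t (delta s x) r = 0.
  move=> tt0; rewrite (fcE sys separable); last exact: NPfc.
  rewrite deltaE; case: eqP => [ts|_]; last by rewrite !linear0.
  by case/eqP: tt0; rewrite /t0 -ts invgM invgK mulVKg.
rewrite bop_sumE l2_sumE -/t0.
have [tA|tA] := boolP (t0 \in A0); last first.
  rewrite phi0// scale0r big1_seq// => t /andP[_ tA0]; rewrite bopZE l2ZE e ?scaler0//.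
  by apply: contraNneq tA => <-.
rewrite (bigD1_seq t0)// big1 => [|t tt0]; last by rewrite bopZE l2ZE e ?scaler0.
rewrite [LHS]addr0 bopZE l2ZE (fcE sys separable); last exact: NPfc.
by rewrite /t0 invgM invgK mulgVK deltaE eqxx.
Qed.

Lemma fc_pl a t t' : M a -> fc beta (pl beta a t) t' = if t' == t then pl beta a t else 0.
Proof.
move=> Ma; rewrite /fc (coef_pl sys)//; case: eqP => [->//|_].
exact: (pl0 sys).
Qed.

Lemma Smap_pl a t : M a ->
  Smap (pl beta a t) = pl beta (phi t *: coef (Phi (pl beta a t)) t) t.
Proof.
move=> Ma; have Npl : N (pl beta a t) by exact: pl_in.
have Mc := coef_in sys t (PhiN Npl).
rewrite (plZ sys)// /Smap.
have e t' : t' != t -> phi t' *: fc beta (Phi (fc beta (pl beta a t) t')) t' = 0.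
  move=> /negbTE tt; rewrite fc_pl// tt (linear_on0 NvN PhiL).
  rewrite (linear_on0 NvN (Phi := fun T => fc beta T t')) ?scaler0// => k S T NS NT.
  by rewrite fcP.
have [tA|tA] := boolP (t \in A0).
  by rewrite (bigD1_seq t)//= big1// addr0 fc_pl// eqxx.
rewrite phi0// scale0r big1_seq// => s /andP[_ sA]; apply: e.
by apply: contraNneq tA => <-.
Qed.

(** After truncation to a finite A, complete boundedness of Phi applies to the matrix of Fourier
    terms, contractive by [fc_matrix_le], and [schur_block] then handles the factors phi(r s^-1). *)
Lemma Smap_cbnorm (K1 K2 : R) Sphi : 0 < K1 -> 0 <= K2 ->
  (forall u, fourier_algebra u -> fourier_algebra (fun t => phi t * u t)) ->
  multiplier_adjoint phi Sphi -> (cbnorm (@group_vN R G) Sphi <= K2%:E)%E ->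
  (cbnorm N Phi <= K1%:E)%E -> (cbnorm N Smap <= (K2 * K1)%:E)%E.
Proof.
move=> K10 K20 phiA Sm SK PK; apply/cbnorm_leP; first by rewrite mulr_ge0// ltW.
move=> n T NT T1; apply: mxle_of_restr => A x.
pose u i := \sum_j Smap (T i j) (restr A (x j)).
pose y i := restr A (u i); 
suff : \sum_i hnorm (y i) ^+ 2 <= (K2 * K1) ^+ 2 * \sum_j hnorm (x j) ^+ 2 by [].
have uE i : u i = \sum_j Smap (T i j) (restr A (x j)) by [].
have yE i : y i = restr A (u i) by []; clearbody y; clearbody u.
pose g (r : A) := val r; have gi : injective g by exact: val_inj.
pose xd (q : A * 'I_n) := delta (g q.1) (x q.2 (g q.1)).
pose wd (q : A * 'I_n) := delta (g q.1) (y q.2 (g q.1)).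
have NTfc (p q : A * 'I_n) : N (fc beta (T p.2 q.2) (g p.1 * (g q.1)^-1)%g).
  exact: (fc_in sys).
have PP := cbnorm_mxle (ltW K10) PK NTfc (fc_matrix_le sys separable gi NT T1).
have := schur_block xd wd (ltW K10) K20
  (fun z => @schur_of_multiplier R G phi Sphi K1 K2 _ g z K10 K20 phiA Sm SK) PP.
have pairs (f : A * 'I_n -> R) : \sum_q f q = \sum_j \sum_r f (r, j).
  by rewrite exchange_big pair_bigA /=; apply: eq_bigr => -[].
have xle : \sum_q hnorm (xd q) ^+ 2 <= \sum_j hnorm (x j) ^+ 2.
  rewrite pairs; apply: ler_sum => j _; apply: le_trans (le_hnorm_inj (x j) gi).
  by apply: ler_sum => r _; rewrite hnorm_delta.
have wle : \sum_q hnorm (wd q) ^+ 2 <= \sum_j hnorm (y j) ^+ 2.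
  rewrite pairs; apply: ler_sum => j _; apply: le_trans (le_hnorm_inj (y j) gi).
  by apply: ler_sum => r _; rewrite hnorm_delta.
have fsE (V : nmodType) (f : G -> V) : \sum_(r <- A) f r = \sum_(r : A) f (g r).
  by rewrite (big_seq_fsetE _ _ xpredT).
have -> : complex.Re (\sum_r \sum_s phi (g r * (g s)^-1)%g *
    \sum_i \sum_j ip (Phi (fc beta (T i j) (g r * (g s)^-1)%g) (xd (s, j))) (wd (r, i))) =
    \sum_i hnorm (y i) ^+ 2.
  transitivity (\sum_r \sum_i rip (u i (g r)) (y i (g r))).
    rewrite Re_sum; apply: eq_bigr => r _; rewrite /rip -Re_sum; congr complex.Re.
    rewrite (eq_bigr (fun s => \sum_i \sum_j phi (g r * (g s)^-1)%g *
      ip (Phi (fc beta (T i j) (g r * (g s)^-1)%g) (xd (s, j)) (g r)) (y i (g r)))).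
      rewrite exchange_big; apply: eq_bigr => i _ /=.
      rewrite exchange_big uE l2_sumE ip_suml; apply: eq_bigr => j _ /=.
      rewrite /restr linear_sum l2_sumE fsE ip_suml; apply: eq_bigr => s _.
      by rewrite Smap_entry// ipZl.
    move=> s _; rewrite mulr_sumr; apply: eq_bigr => i _.
    by rewrite mulr_sumr; apply: eq_bigr => j _; rewrite ip_deltar.
  rewrite exchange_big; apply: eq_bigr => i _ /=.
  rewrite -ripxx {2}yE /restr rip_suml fsE; apply: eq_bigr => r _.
  by rewrite /rip ip_deltal.
(* The test vectors w are built from the output y itself, so the pairing equals the sum Y of the |y
   i|^2, and 2 Y <= (K2 K1)^2 |x|^2 + Y gives the bound. *)
move=> h; have := le_trans h (lerD (ler_wpM2l (sqr_ge0 _) xle) wle).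
by rewrite mulr_natl mulr2n lerD2r.
Qed.

End MultiplierMap.

Section MultiplierCoefficients.
Variables (R : realType) (G : groupType) (H : hilbertType R).
Variables (M : set (bop H)) (beta : G -> bop H -> bop H).
Hypothesis sys : Wstar_dynamical_system M beta.
Hypothesis separable : exists2 D : set H, countable D & dense D.
Local Notation N := (crossed_product M beta).
Let MvN : von_neumann M := sys_vN sys.
Let NvN : von_neumann N := crossed_product_vN M beta.

(** The implementing isometry carries the matrix of the beta_s(a i j) to copies of the matrix a
    acting on the components u_n x. *)
Lemma beta_matrix_le s (J : finType) (a : J -> J -> bop H) :
  (forall i j, M (a i j)) -> mxle a 1 -> mxle (fun i j => beta s (a i j)) 1.
Proof.
move=> Ma a1 x.
have [u [uP [U [UE Uip]]]] := spatial_implementation MvN (sys_aut sys s) separable.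
have Un z : (hnorm z ^+ 2)%:E = \esum_(n in [set: nat]) (hnorm (u n z) ^+ 2)%:E.
  rewrite -ripxx /rip -Uip -/(rip _ _) ripxx -esum_l2.
  by apply: eq_esum => n _; rewrite UE.
rewrite expr1n mul1r -lee_fin -!sumEFin.
rewrite (eq_bigr (fun i => \esum_(n in [set: nat])
    (hnorm (\sum_j a i j (u n (x j))) ^+ 2)%:E)); last first.
  move=> i _; rewrite Un; apply: eq_esum => n _; congr ((hnorm _ ^+ 2)%:E).
  by rewrite linear_sum; apply: eq_bigr => j _; rewrite /= uP.
rewrite [leRHS](eq_bigr (fun j => \esum_(n in [set: nat]) (hnorm (u n (x j)) ^+ 2)%:E)).
  rewrite -!esum_sum; try by move=> *; rewrite lee_fin sqr_ge0.
  apply: le_esum => n _; rewrite !sumEFin lee_fin.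
  by have := a1 (fun j => u n (x j)); rewrite expr1n mul1r.
by move=> j _; rewrite Un.
Qed.

Lemma pl_matrix_le t (J : finType) (a : J -> J -> bop H) :
  (forall i j, M (a i j)) -> mxle a 1 -> mxle (fun i j => pl beta (a i j) t) 1.
Proof.
move=> Ma a1 x; rewrite expr1n mul1r -lee_fin -!sumEFin.
rewrite (eq_bigr (fun i => \esum_(s in [set: G])
    (hnorm (\sum_j beta (t * s)^-1%g (a i j) (x j s)) ^+ 2)%:E)); last first.
  move=> i _; rewrite (esum_l2_mulg _ t); apply: eq_esum => s _.
  congr ((hnorm _ ^+ 2)%:E); rewrite l2_sumE; apply: eq_bigr => j _.
  by rewrite (plE sys)// mulKg.
rewrite [leRHS](eq_bigr (fun j => \esum_(s in [set: G]) (hnorm (x j s) ^+ 2)%:E)).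
  rewrite -!esum_sum; try by move=> *; rewrite lee_fin sqr_ge0.
  apply: le_esum => s _; rewrite !sumEFin lee_fin.
  by have := beta_matrix_le (t * s)^-1%g Ma a1 (fun j => x j s); rewrite expr1n mul1r.
by move=> j _; rewrite esum_l2.
Qed.

Lemma coef_matrix_le t (J : finType) (T : J -> J -> bop (l2 G H)) (k : R) :
  mxle T k -> mxle (fun i j => coef (T i j) t) k.
Proof.
move=> Tk x; have := Tk (fun j => delta t^-1%g (x j)).
rewrite [X in _ <= _ * X -> _](eq_bigr (fun j => hnorm (x j) ^+ 2)) => [|j _]; last first.
  by rewrite hnorm_delta.
apply: le_trans; apply: ler_sum => i _.
rewrite ler_pXn2r ?nnegrE ?hnorm_ge0// (eq_bigr _ (fun j _ => coefE (T i j) t (x j))).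
by rewrite -l2_sumE l2_coord.
Qed.

(** The translation by t is isometric and Sphi scales it by phi t. *)
Lemma multiplier_le (phi : G -> Cx R) Sphi (K2 : R) t : 0 <= K2 ->
  (forall u, fourier_algebra u -> fourier_algebra (fun t => phi t * u t)) ->
  multiplier_adjoint phi Sphi -> (cbnorm (@group_vN R G) Sphi <= K2%:E)%E ->
  cmod (phi t) <= K2.
Proof.
move=> K20 phiA Sm SK.
have ln x : hnorm (lambda_op (scal R) t x) = hnorm x.
  apply/eqP; rewrite -(@eqrXn2 _ 2)// ?hnorm_ge0//; apply/eqP/EFin_inj.
  rewrite (esum_l2_mulg _ t) -esum_l2; apply: eq_esum => s _.
  by rewrite lambda_opE mulKg.
have := cbnorm_mxle K20 SK (I := 'I_1) (T := fun _ _ => lambda_op (scal R) t) _ _ (fun=> delta 1%g (1 : scal R)).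
rewrite !big_ord1 hnorm_delta -[lambda_op _ t]scale1r (multiplier_scale phiA Sm) mul1r.
rewrite bopZE hnormZ ln hnorm_delta.
have -> : hnorm (1 : scal R) = 1 by exact: cmod1.
rewrite mulr1 expr1n mulr1 ler_pXn2r ?nnegrE ?cmod_ge0//; apply=> [i j|x].
  by apply: sub_generated_vN; exists t => //; rewrite scale1r.
by rewrite !big_ord1 scale1r ln expr1n mul1r.
Qed.

Lemma coef_sumZ n (c : 'I_n -> Cx R) (b : 'I_n -> bop (l2 G H)) t :
  coef (\sum_i c i *: b i) t = \sum_i c i *: coef (b i) t.
Proof.
elim: (index_enum _) => [|i r IHr]; last by rewrite !big_cons coefP IHr.
by rewrite !big_nil; apply: bop_ext => x; rewrite coefE.
Qed.

Definition mult_coef (phi : G -> Cx R) (Phi : bop (l2 G H) -> bop (l2 G H)) t a : bop H :=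
  phi t *: coef (Phi (pl beta a t)) t.

Lemma mult_coef_multiplier (phi : G -> Cx R) Phi Sphi (K1 K2 : R) :
  countable [set: G] -> 0 < K1 -> 0 <= K2 ->
  (forall u, fourier_algebra u -> fourier_algebra (fun t => phi t * u t)) ->
  multiplier_adjoint phi Sphi -> (cbnorm (@group_vN R G) Sphi <= K2%:E)%E ->
  finite_set [set t | phi t != 0] ->
  completely_bounded N Phi -> finite_rank N Phi -> {within N, continuous Phi} ->
  (cbnorm N Phi <= K1%:E)%E -> let F := mult_coef phi Phi in
  [/\ HS_multiplier M beta F /\ finite_set [set t | exists2 a, M_beta M beta a & F t a != 0],
      forall t, CB_sigma (M_beta M beta) (F t) /\
        exists Psi, [/\ completely_bounded M Psi, finite_rank M Psi &
                        forall a, M_beta M beta a -> Psi a = F t a] &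
      (HS_norm M beta F <= (K2 * K1)%:E)%E].
Proof.
move=> Gc K10 K20 phiA Sm SK phif [PN PL _] Pfr Pc PK F.
have K0 : 0 <= K2 * K1 by rewrite mulr_ge0// ltW.
have Npl a t : M a -> N (pl beta a t) by exact: pl_in.
have FM t a : M a -> M (F t a).
  by move=> Ma; apply: (vNZ MvN); apply: (coef_in sys); apply: PN; exact: Npl.
have FL t : linear_on M (F t).
  move=> k a b Ma Mb; rewrite /F /mult_coef (plP sys)// PL; try exact: Npl.
  by rewrite coefP scalerDr !scalerA mulrC.
have FK t : (cbnorm M (F t) <= (K2 * K1)%:E)%E.
  apply/cbnorm_leP => // n a Ma a1.
  have h := coef_matrix_le t (cbnorm_mxle (ltW K10) PK (fun i j => Npl _ t (Ma i j)) (pl_matrix_le t Ma a1)).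
  move=> x; rewrite exprMn -mulrA.
  rewrite (eq_bigr (fun i => cmod (phi t) ^+ 2 *
      hnorm (\sum_j coef (Phi (pl beta (a i j) t)) t (x j)) ^+ 2)) => [|i _]; last first.
    rewrite -exprMn -hnormZ; congr (hnorm _ ^+ 2); rewrite scaler_sumr.
    by apply: eq_bigr => j _; rewrite bopZE.
  rewrite -mulr_sumr; apply: ler_pM (h x); rewrite ?sqr_ge0//.
    by apply: sumr_ge0 => i _; exact: sqr_ge0.
  by rewrite ler_pXn2r ?nnegrE ?cmod_ge0//; exact: multiplier_le phiA Sm SK.
have Fcb t : completely_bounded M (F t).
  by split=> //; [exact: FM|exact: le_lt_trans (FK t) (ltry _)].
have Fc t : {within M, continuous (F t)}.
  apply/within_contP => p.
  have e a : M a -> phi t * ultraweak_functional p (coef (Phi (pl beta a t)) t) =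
      ultraweak_functional p (F t a).
    by move=> _; rewrite /F /mult_coef ufunZ.
  apply: wcont_eq e _; apply: wcontZ.
  have c2 := proj1 (within_contP N (fun T => coef T t)) (@coef_continuous _ _ _ N t) p.
  apply: (wcont_comp (N2 := N) (Phi := fun a => pl beta a t) _ _ (wcont_comp PN Pc c2)) => //.
    by move=> a; exact: Npl.
  exact: (@pl_continuous _ _ _ _ _ Gc sys separable t).
have Ffr t : finite_rank M (F t).
  have [n [b hb]] := Pfr; exists n, (fun i => coef (b i) t) => a Ma.
  have [c hc] := hb _ (Npl _ t Ma); exists (fun i => phi t * c i).
  rewrite /F /mult_coef hc coef_sumZ scaler_sumr.
  by apply: eq_bigr => i _; rewrite scalerA.
have /finite_seqP[A0 hA0] := phif.
have phi0 t : t \notin undup A0 -> phi t = 0.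
  rewrite mem_undup => tA; apply: contrapT => /eqP ft; move/negP : tA; apply.
  by have : [set` A0] t by rewrite -hA0.
have ext : HS_extension M beta F (Smap beta phi (undup A0) Phi).
  have cb := Smap_cbnorm sys separable (undup_uniq A0) phi0 PN K10 K20 phiA Sm SK PK.
  split.
  - split; [exact: Smap_in|exact: Smap_linear|exact: le_lt_trans cb (ltry _)].
  - exact: (@Smap_continuous _ _ _ _ _ sys separable phi (undup A0) Phi PN Gc Pc).
  - by move=> a t; rewrite M_betaE => Ma; exact: (Smap_pl sys (undup_uniq A0) phi0 PN PL t Ma).
split.
- split; last first.
    apply: sub_finite_set phif => t [a Ma]; rewrite /= /F /mult_coef.
    by apply: contraNneq => ->; rewrite scale0r.
  split; first by rewrite M_betaE.
    by exists (K2 * K1) => t; rewrite M_betaE.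
  by eexists; exact: ext.
(* Since [M_beta] is M and M'' = M, F t serves as its own extension. *)
- move=> t; rewrite M_betaE; split; last by exists (F t).
  by split=> //; exists (F t); rewrite MvN.2.
- apply: le_trans (Smap_cbnorm sys separable (undup_uniq A0) phi0 PN K10 K20 phiA Sm SK PK).
  by apply: ereal_inf_lbound; eexists; [exact: ext|].
Qed.

End MultiplierCoefficients.

Section ProductNets.
Variables (I J : Type) (le1 : I -> I -> Prop) (le2 : J -> J -> Prop).

Definition prod_le (p q : I * J) : Prop := le1 p.1 q.1 /\ le2 p.2 q.2.

Lemma prod_directed : directed_set le1 -> directed_set le2 -> directed_set prod_le.
Proof.
move=> [[i0] r1 t1 d1] [[j0] r2 t2 d2]; split.
- exact: (inhabits (i0, j0)).
- by move=> p; split.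
- by move=> p q r [pq1 pq2] [qr1 qr2]; split; [exact: t1 pq1 qr1|exact: t2 pq2 qr2].
- move=> [i j] [i' j']; have [k [ik i'k]] := d1 i i'; have [l [jl j'l]] := d2 j j'.
  by exists (k, l).
Qed.

Lemma prod_fst : directed_set le2 -> fst @ tails prod_le --> tails le1.
Proof.
move=> [[j0] _ _ _] A [i _ iA]; exists (i, j0) => // -[k l] [/= ik _]; exact: iA.
Qed.

Lemma prod_snd : directed_set le1 -> snd @ tails prod_le --> tails le2.
Proof.
move=> [[i0] _ _ _] A [j _ jA]; exists (i0, j) => // -[k l] [/= _ jl]; exact: jA.
Qed.

End ProductNets.

Section CBAPToSystem.
Variables (R : realType) (G : groupType) (H : hilbertType R).
Variables (M : set (bop H)) (beta : G -> bop H -> bop H).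
Hypothesis G_countable : countable [set: G].
Hypothesis separable : exists2 D : set H, countable D & dense D.
Hypothesis sys : Wstar_dynamical_system M beta.

Lemma CBAP_weakly_amenable_system : weakly_amenable_group R G ->
  weakstar_CBAP (crossed_product M beta) -> weakly_amenable_system M beta.
Proof.
move=> [J [le2 [phi [dir2 phiP phi1 [c2 phic]]]]] [I [le1 [Phi [dir1 PhiP Phi1 [c1 Phic]]]]].
pose K1 := Num.max c1 0 + 1; pose K2 := Num.max c2 0 + 1.
have K10 : 0 < K1 by rewrite ltr_wpDl// le_max lexx orbT.
have K20 : 0 <= K2 by rewrite addr_ge0// le_max lexx orbT.
have PK i : (cbnorm (crossed_product M beta) (Phi i) <= K1%:E)%E.
  by rewrite (le_trans (Phic i))// lee_fin (le_trans (_ : _ <= Num.max c1 0))// ?lerDl// le_max lexx.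
have FP q : [/\ HS_multiplier M beta (mult_coef beta (phi q.2) (Phi q.1)) /\
      finite_set [set t | exists2 a, M_beta M beta a & mult_coef beta (phi q.2) (Phi q.1) t a != 0],
      forall t, CB_sigma (M_beta M beta) (mult_coef beta (phi q.2) (Phi q.1) t) /\
        exists Psi, [/\ completely_bounded M Psi, finite_rank M Psi &
          forall a, M_beta M beta a -> Psi a = mult_coef beta (phi q.2) (Phi q.1) t a] &
      (HS_norm M beta (mult_coef beta (phi q.2) (Phi q.1)) <= (K2 * K1)%:E)%E].
  have [[phiA _] phif] := phiP q.2; have [cb fr ct] := PhiP q.1.
  have [_ [S Sm <-] Sc] := ereal_inf_approx (phic q.2).
  apply: (mult_coef_multiplier sys separable G_countable K10 K20 phiA Sm _ phif cb fr ct (PK q.1)).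
  by rewrite (le_trans Sc)// lee_fin lerD2r le_max lexx.
exists (I * J)%type, (prod_le le1 le2), (fun q => mult_coef beta (phi q.2) (Phi q.1)); split.
- exact: prod_directed.
- by move=> q; case: (FP q).
- by move=> q; case: (FP q).
(* A functional of F(t)(a) is a product of two scalars, phi_j(t) -> 1 and a functional of
   Phi_i(pi(a) lambda_t). Each depends on one index, so convergence holds along the product
   order. *)
- move=> t a Ma; have FF := tails_filter (prod_directed dir1 dir2).
  have F1 := tails_filter dir1.
  apply/ultraweak_cvgP => p; have [p' p'E] := coef_ufun (G := G) t p.
  have h2 := cvg_comp _ _ (prod_snd (le2 := le2) dir1) (phi1 t).
  have F2 : Filter ((fun i => Phi i (pl beta a t)) @ tails le1) by exact: fmap_filter.
  have Npl : crossed_product M beta (pl beta a t) by exact: pl_in.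
  have h0 := proj1 (ultraweak_cvgP _ F2) (Phi1 _ Npl) p'.
  have h1 := cvg_comp _ _ (prod_fst (le1 := le1) dir2) h0.
  have lE : 1 * ultraweak_functional p' (pl beta a t) = ultraweak_functional p a.
    by rewrite mul1r -p'E (coef_pl sys)// eqxx.
  have h := proj1 (cvgCP FF _ _) (cvgM h2 h1).
  apply/(cvgCP FF) => e e0; have he := h FF e e0.
  apply: (@filterS _ _ FF _ _ _ he) => q.
  by rewrite lE /mult_coef ufunZ p'E.
- by exists (K2 * K1) => q; case: (FP q).
Qed.

End CBAPToSystem.

Theorem theorem4p6 (R : realType) (G : groupType) (H : hilbertType R)
    (M : set (bop H)) (beta : G -> bop H -> bop H)
    (G_countable : countable [set: G])
    (H_separable : exists2 D : set H, countable D & dense D)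
    (M_beta_system : Wstar_dynamical_system M beta) :
  (weakly_amenable_system M beta -> weakstar_CBAP (crossed_product M beta)) /\
  (weakly_amenable_group R G ->
    (weakly_amenable_system M beta <->
     weakstar_CBAP (crossed_product M beta))).
Proof.
split; first exact: weakly_amenable_system_CBAP.
move=> Gwa; split; first exact: weakly_amenable_system_CBAP.
exact: CBAP_weakly_amenable_system.
Qed.
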